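(* Let $p>2$ be a prime number and $d\ge 1$. Denote by $\widehat{\mathbb{H}}_d$ the unitary dual of $\mathbb{H}_d=\mathbb{H}_d(\mathbb{Z}_p)$, i.e. the collection of all equivalence classes of unitary irreducible representations of $\mathbb{H}_d$. Then $\widehat{\mathbb{H}}_d$ can be identified with the following subset of $\widehat{\mathbb{Z}}_p^{2d+1}\cong \mathbb{Q}_p^{2d+1}/\mathbb{Z}_p^{2d+1}$: $$\widehat{\mathbb{H}}_d=\{(\xi,\eta,\lambda)\in\widehat{\mathbb{Z}}_p^{2d+1} : (\xi,\eta)\in \mathbb{Q}_p^{2d}/p^{\vartheta(\lambda)}\mathbb{Z}_p^{2d}\}.$$ Moreover, each non-trivial representation $[\pi_{(\xi,\eta,\lambda)}]\in\widehat{\mathbb{H}}_d$ can be realized in the finite-dimensional subspace $\mathcal{H}_\lambda$ of $L^2(\mathbb{Z}_p^d)$ defined as $$\mathcal{H}_\lambda:=\mathrm{span}_{\mathbb{C}}\{\varphi_h : h\in\mathbb{Z}_p^d/p^{-\vartheta(\lambda)}\mathbb{Z}_p^d\},\qquad \varphi_h(u):=|\lambda|_p^{d/2}\,\mathbf{1}_{h+p^{-\vartheta(\lambda)}\mathbb{Z}_p^d}(u),\qquad \dim(\mathcal{H}_\lambda)=|\lambda|_p^d,$$ where the representation acts on functions $\varphi\in\mathcal{H}_\lambda$ according to the formula $$\pi_{(\xi,\eta,\lambda)}(\mathbf{x},\mathbf{y},z)\varphi(u):=e^{2\pi i\{\xi\cdot\mathbf{x}+\eta\cdot\mathbf{y}+\lambda(z+u\cdot\mathbf{y})\}_p}\,\varphi(u+\mathbf{x}),\qquad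 \varphi\in\mathcal{H}_\lambda .$$ With this explicit realization, and choosing the basis $\{\varphi_h : h\in\mathbb{Z}_p^d/p^{-\vartheta(\lambda)}\mathbb{Z}_p^d\}$ for each representation space, the associated matrix coefficients are given by $$(\pi_{(\xi,\eta,\lambda)})_{hh'}(\mathbf{x},\mathbf{y},z)=e^{2\pi i\{(\xi\cdot\mathbf{x}+\eta\cdot\mathbf{y})+\lambda(z+h'\cdot\mathbf{y})\}_p}\,\mathbf{1}_{h-h'+p^{-\vartheta(\lambda)}\mathbb{Z}_p^d}(\mathbf{x}),$$ and the corresponding characters are $$\chi_{\pi_{(\xi,\eta,\lambda)}}(\mathbf{x},\mathbf{y},z)=|\lambda|_p^d\,e^{2\pi i\{\xi\cdot\mathbf{x}+\eta\cdot\mathbf{y}+\lambda z\}_p}\,\mathbf{1}_{p^{-\vartheta(\lambda)}\mathbb{Z}_p^d}(\mathbf{x})\,\mathbf{1}_{p^{-\vartheta(\lambda)}\mathbb{Z}_p^d}(\mathbf{y}).$$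
   Context: $p>2$ is a fixed prime, $|\cdot|_p$ is the $p$-adic absolute value on $\mathbb{Q}_p$, $\vartheta$ is the $p$-adic valuation (so $|\lambda|_p=p^{-\vartheta(\lambda)}$), and $\{\cdot\}_p$ is the $p$-adic fractional part: $\{u\}_p=0$ if $u\in\mathbb{Z}_p$, and $\{u\}_p=\sum_{j<0}u_jp^j\in\mathbb{Q}$ if $u=\sum_{j\ge\vartheta(u)}u_jp^j$ with digits $u_j\in\{0,\dots,p-1\}$. $\mathbf{1}_A$ is the indicator function of $A$, and $u\cdot v=\sum_j u_jv_j$. The Heisenberg group $\mathbb{H}_d=\mathbb{H}_d(\mathbb{Z}_p)$ is the compact group $\mathbb{Z}_p^{2d+1}=\{(\mathbf{x},\mathbf{y},z):\mathbf{x},\mathbf{y}\in\mathbb{Z}_p^d, z\in\mathbb{Z}_p\}$ with operation $(\mathbf{x},\mathbf{y},z)\star(\mathbf{x}',\mathbf{y}',z')=(\mathbf{x}+\mathbf{x}',\mathbf{y}+\mathbf{y}',z+z'+\mathbf{x}\cdot\mathbf{y}')$. Representations are continuous. Conventions on representatives. $\widehat{\mathbb{Z}}_p\cong\mathbb{Q}_p/\mathbb{Z}_p$ is the Pontryagin dual of $\mathbb{Z}_p$; each class $\lambda$ is identified with its representative in the complete system $\{1\}\cup\{\sum_{k\ge1}\lambda_kp^{-k} : \text{only finitely many }\lambda_k\in\{0,\dots,p-1\}\text{ are non-zero}\}$, where the trivial class is represented by $1$ (so for it $|\lambda|_p=1$, $\vartheta(\lambda)=0$). Similarly, elements of $\mathbb{Q}_p/p^{-n}\mathbb{Z}_p$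 ($n\geq 0$) are identified with representatives in $\{1\}\cup\{\sum_{k\ge n+1}\lambda_kp^{-k} : \text{only finitely many }\lambda_k\text{ non-zero}\}$, again with the trivial class represented by $1$; for vectors this is done in each coordinate. Thus the condition $(\xi,\eta)\in\mathbb{Q}_p^{2d}/p^{\vartheta(\lambda)}\mathbb{Z}_p^{2d}$ means that $(\xi,\eta)$ is the chosen representative of a class modulo $p^{\vartheta(\lambda)}\mathbb{Z}_p^{2d}$, so that each such class is counted once. The matrix coefficients are $(\pi_{(\xi,\eta,\lambda)})_{hh'}=(\pi_{(\xi,\eta,\lambda)}\varphi_h,\varphi_{h'})_{L^2(\mathbb{Z}_p^d)}$, with $\mathbb{Z}_p^d$ carrying normalized Haar measure. *)

(* Defs.v *)
From HB Require Import structures.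
From mathcomp Require Import all_boot all_order all_algebra complex.
From mathcomp Require Import all_classical all_reals all_analysis ring.
Import Order.TTheory GRing.Theory Num.Theory numFieldNormedType.Exports.

Set Implicit Arguments.
Unset Strict Implicit.
Unset Printing Implicit Defensive.

Local Open Scope classical_set_scope.
Local Open Scope ring_scope.

(* res n is the canonical representative, in {0, ..., p^n - 1}, of the class
   modulo p^n. *)
Record padic_int (p : nat) (pp : prime p) := PadicInt {
  res :> nat -> nat;
  _ : `[< forall n, res n = (res n.+1 %% p ^ n)%N >] }.

Arguments PadicInt {p pp} res _.

Section PadicIntRing.
Context (p : nat) (pp : prime p).
Local Notation Zp := (padic_int pp).
Implicit Types x y z : Zp.

HB.instance Definition _ := [isSub for @res p pp].
HB.instance Definition _ := [Choice of Zp by <:].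

Lemma res_proj x n : (x n.+1 %% p ^ n)%N = x n.
Proof. by case: x => f /= /asboolP. Qed.

Lemma expp_gt0 n : (0 < p ^ n)%N.
Proof. by rewrite expn_gt0 prime_gt0. Qed.

Lemma res_mod x n : (x n %% p ^ n)%N = x n.
Proof. by rewrite -[in LHS](res_proj x n) modn_mod res_proj. Qed.

Lemma padic_int_ext x y : x =1 y -> x = y.
Proof. by move=> xy; apply/val_inj/funext. Qed.

Lemma padic_int_of_subproof (f : nat -> nat) :
  (forall n, f n.+1 = f n %[mod p ^ n])%N ->
  `[< forall n, f n %% p ^ n = (f n.+1 %% p ^ n.+1) %% p ^ n >]%N.
Proof.
move=> fE; apply/asboolP => n.
by rewrite modn_dvdm ?dvdn_exp2l.
Qed.

Definition padic_int_of f (fE : (forall n, f n.+1 = f n %[mod p ^ n])%N) : Zp :=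
  PadicInt (fun n => f n %% p ^ n)%N (padic_int_of_subproof fE).

Lemma res_step x n : (x n.+1 = x n %[mod p ^ n])%N.
Proof. by rewrite res_proj res_mod. Qed.

Lemma zp_add_subproof x y n :
  (x n.+1 + y n.+1 = x n + y n %[mod p ^ n])%N.
Proof. by rewrite -modnDm !res_step modnDm. Qed.

Lemma zp_mul_subproof x y n :
  (x n.+1 * y n.+1 = x n * y n %[mod p ^ n])%N.
Proof. by rewrite -modnMm !res_step modnMm. Qed.

Lemma zp_opp_subproof x n :
  (p ^ n.+1 - x n.+1 = p ^ n - x n %[mod p ^ n])%N.
Proof.
have le m : (x m <= p ^ m)%N.
  by rewrite -(res_mod x m) ltnW // ltn_pmod ?expp_gt0.
apply/eqP; rewrite -(eqn_modDr (x n.+1)) subnK // -modnDmr res_step modnDmr.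
by rewrite subnK // modnn expnS modnMl.
Qed.

Definition zp_add x y := padic_int_of (zp_add_subproof x y).
Definition zp_mul x y := padic_int_of (zp_mul_subproof x y).
Definition zp_opp x := padic_int_of (zp_opp_subproof x).
Definition zp_nat (k : nat) : Zp := @padic_int_of (fun=> k) (fun=> erefl).

Lemma zp_addA : associative zp_add.
Proof.
by move=> x y z; apply: padic_int_ext => n /=; rewrite modnDmr modnDml addnA.
Qed.

Lemma zp_addC : commutative zp_add.
Proof. by move=> x y; apply: padic_int_ext => n /=; rewrite addnC. Qed.

Lemma zp_add0 : left_id (zp_nat 0) zp_add.
Proof.
by move=> x; apply: padic_int_ext => n /=; rewrite modnDml add0n res_mod.
Qed.

Lemma zp_addN : left_inverse (zp_nat 0) zp_opp zp_add.
Proof.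
move=> x; apply: padic_int_ext => n /=; rewrite modnDml subnK ?modnn ?mod0n //.
by rewrite -(res_mod x n) ltnW // ltn_pmod ?expp_gt0.
Qed.

HB.instance Definition _ :=
  GRing.isZmodule.Build Zp zp_addA zp_addC zp_add0 zp_addN.

Lemma zp_mulA : associative zp_mul.
Proof.
by move=> x y z; apply: padic_int_ext => n /=; rewrite modnMmr modnMml mulnA.
Qed.

Lemma zp_mulC : commutative zp_mul.
Proof. by move=> x y; apply: padic_int_ext => n /=; rewrite mulnC. Qed.

Lemma zp_mul1 : left_id (zp_nat 1) zp_mul.
Proof.
by move=> x; apply: padic_int_ext => n /=; rewrite modnMml mul1n res_mod.
Qed.

Lemma zp_mulDl : left_distributive zp_mul zp_add.
Proof.
move=> x y z; apply: padic_int_ext => n /=.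
by rewrite modnMml modnDm mulnDl.
Qed.

Lemma zp_oner_neq0 : zp_nat 1 != 0.
Proof.
apply/eqP => /(congr1 (fun x : Zp => x 1%N)) /=.
by rewrite expn1 mod0n modn_small ?prime_gt1.
Qed.

HB.instance Definition _ := GRing.Zmodule_isComNzRing.Build Zp
  zp_mulA zp_mulC zp_mul1 zp_mulDl zp_oner_neq0.

Definition zp_unit : {pred Zp} := [pred x | `[< exists y, y * x = 1 >]].
Definition zp_inv x : Zp :=
  if x \in zp_unit then xget x [set y | y * x = 1] else x.

Lemma zp_mulVx : {in zp_unit, left_inverse 1 zp_inv *%R}.
Proof.
move=> x ux; rewrite /zp_inv ux; case: xgetP => [y _ //|no].
by move: ux => /asboolP[y yx1]; have := no y.
Qed.

Lemma zp_unitPl x y : y * x = 1 -> zp_unit x.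
Proof. by move=> yx1; apply/asboolP; exists y. Qed.

Lemma zp_inv_out : {in [predC zp_unit], zp_inv =1 id}.
Proof. by move=> x /negPf ux; rewrite /zp_inv ux. Qed.

HB.instance Definition _ := GRing.ComNzRing_hasMulInverse.Build Zp
  zp_mulVx zp_unitPl zp_inv_out.

Lemma res_modD x m k : (x (m + k) %% p ^ m)%N = x m.
Proof.
elim: k => [|k IH]; first by rewrite addn0 res_mod.
by rewrite addnS -IH -(res_proj x (m + k)) modn_dvdm // dvdn_exp2l ?leq_addr.
Qed.

Lemma zp_mulf_eq0 x y : x * y = 0 -> (x == 0) || (y == 0).
Proof.
move=> xy0; apply: contraT; rewrite negb_or => /andP[x0 y0].
have nz (z : Zp) : z != 0 -> exists n, z n != 0%N.
  move=> /eqP z0; apply/not_existsP => zn; apply: z0.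
  apply: padic_int_ext => n /=; rewrite mod0n.
  by apply/eqP; apply/negP => /negP /zn.
have [n xn] := nz _ x0; have [m ym] := nz _ y0.
have : (p ^ (n + m) %| x (n + m) * y (n + m))%N.
  have /(congr1 (fun z : Zp => z (n + m)%N)) /= := xy0.
  by rewrite mod0n => /eqP.
have xn' : ~~ (p ^ n %| x (n + m))%N by rewrite /dvdn res_modD.
have ym' : ~~ (p ^ m %| y (n + m))%N by rewrite /dvdn addnC res_modD.
have gt0 k (a : nat) : ~~ (p ^ k %| a)%N -> (0 < a)%N.
  by case: a => [|//]; rewrite dvdn0.
have x_gt0 := gt0 _ _ xn'; have y_gt0 := gt0 _ _ ym'.
rewrite pfactor_dvdn ?muln_gt0 ?x_gt0 // lognM // leqNgt => /negP; case.
rewrite -addnS leq_add //; first by rewrite ltnW // ltnNge -pfactor_dvdn.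
by rewrite ltnNge -pfactor_dvdn.
Qed.

HB.instance Definition _ := GRing.ComUnitRing_isIntegral.Build Zp zp_mulf_eq0.

(* The inverse limit topology: the one induced by the product of the discrete
   topologies on the residues. *)
HB.instance Definition _ := Topological.copy Zp
  (initial_topology (@res p pp : Zp -> {ptws nat -> nat})).
HB.instance Definition _ := isPointed.Build Zp 0.

End PadicIntRing.

Notation padic pp := {fraction (padic_int pp)}.
Notation "a %:F" := (tofrac a) : ring_scope.

Section Padic.
Context (p : nat) (pp : prime p).
Local Notation Zp := (padic_int pp).
Local Notation Qp := (padic pp).
Implicit Types (u : Qp) (a : Zp).

(* The integer m such that u = p^m a with a a unit of Z_p; junk value 0 at
   u = 0. *)
Definition padic_val u : int :=
  xget 0 [set m : int |
    exists2 a, a \is a GRing.unit & u = p%:R ^ m * a%:F].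

Definition padic_norm (R : realType) u : R :=
  if u == 0 then 0 else p%:R ^ (- padic_val u).

Definition padic_unit_part u : Zp :=
  xget 0 [set a | u = p%:R ^ padic_val u * a%:F].

(* The coefficient of p^k in the p-adic expansion of a. *)
Definition zp_digit a (k : nat) : nat := (a k.+1 %/ p ^ k)%N.

(* The digit of u at index j = padic_val u + k is the digit of its unit part at
   index k, and the negative indices j are those with k < - padic_val u. *)
Definition padic_frac u : rat :=
  if 0 <= padic_val u then 0 else
  \sum_(k < `|padic_val u|%N)
    (zp_digit (padic_unit_part u) k)%:R * p%:R ^ (padic_val u + k%:Z).

Definition padic_exp (R : realType) u : R[i] :=
  let t : R := 2 * pi * ratr (padic_frac u) in (cos t +i* sin t)%C.

(* The fractional ideal p^m Z_p. *)
Definition padic_ideal (m : int) : set Qp :=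
  [set p%:R ^ m * a%:F | a in [set: Zp]].

(* Representatives of Q_p / p^(-n) Z_p, the trivial class being represented by
   1 instead of 0. *)
Definition quot_reps (n : nat) : set Qp :=
  [set 1] `|`
  [set u | u != 0 /\ exists N (c : nat -> 'I_p),
     u = \sum_(n.+1 <= k < N) (c k)%:R * p%:R ^ (- k%:Z)].

End Padic.

Arguments padic_norm {p pp} R u.
Arguments padic_exp {p pp} R u.
Arguments padic_ideal {p} pp m.
Arguments quot_reps {p} pp n.

Definition dotv (A : pzSemiRingType) d (u v : 'rV[A]_d) : A :=
  \sum_(j < d) u 0 j * v 0 j.

Definition heis (p : nat) (pp : prime p) (d : nat) : Type :=
  ('rV[padic_int pp]_d * 'rV[padic_int pp]_d * padic_int pp)%type.

Section Heisenberg.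
Context (p : nat) (pp : prime p) (d : nat).
Local Notation H := (heis pp d).
Implicit Types g h : H.

HB.instance Definition _ := Choice.on H.
HB.instance Definition _ := Topological.on H.

Definition heis_mul g h : H :=
  let: (x, y, z) := g in let: (x', y', z') := h in
  (x + x', y + y', z + z' + dotv x y').

Definition heis_one : H := (0, 0, 0).

Definition heis_inv g : H :=
  let: (x, y, z) := g in (- x, - y, - z + dotv x y).

Lemma dotvDl (u v w : 'rV[padic_int pp]_d) :
  dotv (u + v) w = dotv u w + dotv v w.
Proof.
by rewrite /dotv -big_split; apply: eq_bigr => j _; rewrite mxE mulrDl.
Qed.

Lemma dotvDr (u v w : 'rV[padic_int pp]_d) :
  dotv u (v + w) = dotv u v + dotv u w.
Proof.
by rewrite /dotv -big_split; apply: eq_bigr => j _; rewrite mxE mulrDr.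
Qed.

Lemma dotvNl (u v : 'rV[padic_int pp]_d) : dotv (- u) v = - dotv u v.
Proof.
by rewrite /dotv -sumrN; apply: eq_bigr => j _; rewrite mxE mulNr.
Qed.

Lemma dotvNr (u v : 'rV[padic_int pp]_d) : dotv u (- v) = - dotv u v.
Proof.
by rewrite /dotv -sumrN; apply: eq_bigr => j _; rewrite mxE mulrN.
Qed.

Lemma heis_mulA : associative heis_mul.
Proof.
move=> [[x y] z] [[x' y'] z'] [[x'' y''] z''] /=.
by rewrite !addrA dotvDl dotvDr !addrA; congr (_, _, _); ring.
Qed.

Lemma heis_mul1 : left_id heis_one heis_mul.
Proof.
move=> [[x y] z] /=; rewrite !add0r; congr (_, _, _).
by rewrite /dotv big1 ?addr0 // => j _; rewrite mxE mul0r.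
Qed.

Lemma heis_mulr1 : right_id heis_one heis_mul.
Proof.
move=> [[x y] z] /=; rewrite !addr0; congr (_, _, _).
by rewrite /dotv big1 ?addr0 // => j _; rewrite mxE mulr0.
Qed.

Lemma heis_mulV : left_inverse heis_one heis_inv heis_mul.
Proof.
move=> [[x y] z] /=; rewrite !addNr dotvNl; congr (_, _, _).
by rewrite addrAC addrK addNr.
Qed.

Lemma heis_mulrV : right_inverse heis_one heis_inv heis_mul.
Proof.
move=> [[x y] z] /=; rewrite !subrr dotvNr; congr (_, _, _).
by rewrite addrA subrr add0r subrr.
Qed.

HB.instance Definition _ :=
  isGroup.Build H heis_mulA heis_mul1 heis_mulr1 heis_mulV heis_mulrV.

End Heisenberg.

Section LinearAlgebra.
Context (R : realType) (V : lmodType R[i]).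

Definition linear_subspace (W : set V) :=
  W 0 /\ forall (a : R[i]) u v, W u -> W v -> W (a *: u + v).

Definition lin_span (S : set V) : set V :=
  [set v | exists n (c : 'I_n -> R[i]) (w : 'I_n -> V),
     (forall i, S (w i)) /\ v = \sum_(i < n) c i *: w i].

Definition lin_basis n (W : set V) (b : 'I_n -> V) :=
  (forall c : 'I_n -> R[i], \sum_(i < n) c i *: b i = 0 -> forall i, c i = 0)
  /\ W = lin_span (range b).

Definition has_dim (W : set V) (n : nat) :=
  exists b : 'I_n -> V, lin_basis W b.

(* The trace of the restriction of f to the finite-dimensional, f-stable space
   W, which does not depend on the basis. *)
Definition is_trace (W : set V) (f : V -> V) (t : R[i]) :=
  exists n (b : 'I_n -> V) (M : 'M[R[i]]_n),
    [/\ lin_basis W b, forall j, f (b j) = \sum_(i < n) M i j *: b i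
      & t = \tr M].

End LinearAlgebra.

(* Raw data of a representation; the Hilbert space is a subspace of an ambient
   vector space, the values of dot and act outside of it being irrelevant. *)
Record prerep (R : realType) (p : nat) (pp : prime p) (d : nat) := Prerep {
  ambient : lmodType R[i];
  carrier : set ambient;
  dot : ambient -> ambient -> R[i];
  act : heis pp d -> ambient -> ambient }.

Arguments carrier {R p pp d} _ _.

Section Representations.
Context (R : realType) (p : nat) (pp : prime p) (d : nat).
Local Notation G := (heis pp d).
Local Notation prerep := (prerep R pp d).
Implicit Types r : prerep.

Definition hnorm r (v : ambient r) : R := Num.sqrt (complex.Re (dot v v)).

Definition is_inner_product r :=
  [/\ forall (a : R[i]) (u v w : ambient r),
        carrier r u -> carrier r v -> carrier r w ->
        dot (a *: u + v) w = a * dot u w + dot v w,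
      forall u v : ambient r,
        carrier r u -> carrier r v -> dot v u = (dot u v)^*
    & forall u : ambient r, carrier r u -> u != 0 -> 0 < dot u u].

Definition hcvg r (s : nat -> ambient r) (l : ambient r) :=
  hnorm (s n - l) @[n --> \oo] --> (0 : R).

Definition is_complete r :=
  forall s : nat -> ambient r, (forall n, carrier r (s n)) ->
    (forall e : R, 0 < e ->
       exists N, forall m n, (N <= m)%N -> (N <= n)%N ->
         hnorm (s m - s n) < e) ->
    exists2 l, carrier r l & hcvg s l.

Definition is_hilbert r :=
  [/\ linear_subspace (carrier r), is_inner_product r & is_complete r].

Definition is_unitary_action r :=
  [/\ forall g (v : ambient r), carrier r v -> carrier r (act g v),
      forall g (a : R[i]) (u v : ambient r), carrier r u -> carrier r v ->
        act g (a *: u + v) = a *: act g u + act g v,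
      forall v : ambient r, carrier r v -> act 1%g v = v,
      forall g h (v : ambient r), carrier r v ->
        act (g * h)%g v = act g (act h v)
    & forall g (u v : ambient r), carrier r u -> carrier r v ->
        dot (act g u) (act g v) = dot u v].

Definition strongly_continuous r :=
  forall v : ambient r, carrier r v -> forall g : G,
    hnorm (act h v - act g v) @[h --> g] --> (0 : R).

Definition is_unitary_rep r :=
  [/\ is_hilbert r, is_unitary_action r & strongly_continuous r].

Definition hclosed r (W : set (ambient r)) :=
  forall (s : nat -> ambient r) (l : ambient r),
    (forall n, W (s n)) -> carrier r l -> hcvg s l -> W l.

Definition is_irreducible r :=
  (exists2 v : ambient r, carrier r v & v != 0) /\
  forall W : set (ambient r), W `<=` carrier r ->
    linear_subspace W -> hclosed W ->
    (forall g v, W v -> W (act g v)) ->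
    W = [set 0] \/ W = carrier r.

Definition is_uirrep r := is_unitary_rep r /\ is_irreducible r.

Definition unitarily_equiv r r' :=
  exists T : ambient r -> ambient r',
    [/\ forall (a : R[i]) u v, carrier r u -> carrier r v ->
          T (a *: u + v) = a *: T u + T v,
        T @` carrier r = carrier r',
        forall u v, carrier r u -> carrier r v -> dot (T u) (T v) = dot u v
      & forall g v, carrier r v -> T (act g v) = act g (T v)].

(* Equivalence classes and the dual are plain predicates, not of type [set _],
   because prerep lives in too large a universe for the latter. *)
Definition rep_class r : prerep -> Prop :=
  fun r' => is_uirrep r' /\ unitarily_equiv r r'.

Definition unitary_dual : (prerep -> Prop) -> Prop :=
  fun c => exists2 r, is_uirrep r & c = rep_class r.

(* The counterpart of set_bij for unitary_dual. *)
Definition bij_onto_dual (I : Type) (A : set I) (F : I -> prerep -> Prop) :=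
  [/\ forall t, A t -> unitary_dual (F t),
      forall t t', A t -> A t' -> F t = F t' -> t = t'
    & forall c, unitary_dual c -> exists2 t, A t & F t = c].

Definition matrix_coef r (v w : ambient r) (g : G) : R[i] := dot (act g v) w.

Definition is_character r (chi : G -> R[i]) :=
  forall g, is_trace (carrier r) (act g) (chi g).

End Representations.

Section HeisenbergReps.
Context (R : realType) (p : nat) (pp : prime p) (d : nat).
Local Notation Zp := (padic_int pp).
Local Notation Qp := (padic pp).
Local Notation Zpd := 'rV[Zp]_d.
Local Notation Qpd := 'rV[Qp]_d.

Definition borel_Zpd := g_sigma_algebraType (@open Zpd).

(* This characterizes the normalized Haar measure among the Borel probability
   measures. *)
Definition translation_invariant (mu : probability borel_Zpd R) :=
  forall (a : Zpd) (A : set borel_Zpd), measurable A ->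
    mu [set (a + x : Zpd) | x in A] = mu A.

Definition cintegral (mu : probability borel_Zpd R) (f : Zpd -> R[i]) : R[i] :=
  (Rintegral mu setT (fun u => complex.Re (f u)) +i*
   Rintegral mu setT (fun u => complex.Im (f u)))%C.

Definition L2 (mu : probability borel_Zpd R) : set (Zpd -> R[i]) :=
  [set f : Zpd -> R[i] |
    [/\ measurable_fun [set: borel_Zpd] (fun u => complex.Re (f u)),
        measurable_fun [set: borel_Zpd] (fun u => complex.Im (f u))
      & (\int[mu]_u (complex.Re (`|f u| ^+ 2))%:E < +oo)%E]].

Definition L2_dot (mu : probability borel_Zpd R) (f g : Zpd -> R[i]) : R[i] :=
  cintegral mu (fun u => f u * (g u)^*).

Definition to_Qpd (x : Zpd) : Qpd := map_mx (@tofrac _) x.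

(* p^m Z_p^d, as a subset of Z_p^d; only meant for m >= 0. *)
Definition Zpd_ideal (m : int) : set Zpd :=
  [set x | forall j, padic_ideal pp m (x 0 j)%:F].

Definition Zpd_coset (h : Zpd) (m : int) : set Zpd :=
  [set h + w | w in Zpd_ideal m].

(* h enumerates Z_p^d / p^m Z_p^d. *)
Definition coset_system (m : int) n (h : 'I_n -> Zpd) :=
  forall u, exists! i, Zpd_coset (h i) m u.

(* |padic_val lambda| = - padic_val lambda, since padic_val lambda <= 0 for
   lambda in quot_reps pp 0. *)
Definition dual_index : set (Qpd * Qpd * Qp) :=
  [set t : Qpd * Qpd * Qp | let: (xi, eta, lambda) := t in
    [/\ forall j, quot_reps pp 0 (xi 0 j),
        forall j, quot_reps pp 0 (eta 0 j),
        quot_reps pp 0 lambda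
      & forall j, quot_reps pp `|padic_val lambda|%N (xi 0 j) /\
                  quot_reps pp `|padic_val lambda|%N (eta 0 j)]].

(* The functions phi h are locally constant and the open sets have positive
   measure, so that Hspace embeds into the quotient of L2 by almost everywhere
   equality. *)
Definition phi (lambda : Qp) (h : Zpd) : Zpd -> R[i]^o := fun u =>
  ((padic_norm R lambda) `^ (d%:R / 2))%:C%C *
  \1_(Zpd_coset h (- padic_val lambda)) u.

Definition Hspace (lambda : Qp) : set (Zpd -> R[i]^o) :=
  lin_span (range (phi lambda)).

Definition heis_rep_act (t : Qpd * Qpd * Qp) (g : heis pp d)
    (f : Zpd -> R[i]^o) : Zpd -> R[i]^o := fun u =>
  let: (xi, eta, lambda) := t in let: (x, y, z) := g in
  padic_exp R (dotv xi (to_Qpd x) + dotv eta (to_Qpd y)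
               + lambda * (z + dotv u y)%:F) * f (u + x).

Definition heis_rep (mu : probability borel_Zpd R) (t : Qpd * Qpd * Qp) :
    prerep R pp d :=
  {| ambient := (Zpd -> R[i]^o) : lmodType R[i];
     carrier := Hspace t.2; dot := L2_dot mu; act := heis_rep_act t |}.

End HeisenbergReps.

Arguments dual_index {p} pp d.
Arguments Zpd_coset {p pp d} h m.
Arguments phi R {p pp d} lambda h.
Arguments Hspace R {p pp} d lambda.
Arguments borel_Zpd {p} pp d.

(* Main.v *)
(* The model spaces consist of the functions on Z_p^d that are periodic modulo
   p^m Z_p^d, where lambda = a / p^m with a a unit, and Haar integrals of such
   functions are averages over the finite set of residues. A nonzero invariant
   subspace of a model contains, by orthogonality of the characters of the
   y-variable, one phi_h, and hence, by translation in x, all of them.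

   Conversely, in an irreducible unitary representation the averages of a vector
   over the cosets of a small open subgroup converge, so that a continuous
   unitary action of Z_p^k has a vector fixed by an open subgroup and, by finite
   Fourier inversion, an eigenvector. Schur's argument then makes the centre act
   by e(lambda z) and p^m Z_p^d in the x-variable by e(xi x). An eigenvector of
   the y-variable can be moved by x-translations to one, v, whose eigenvalue
   e(eta y) is the chosen representative, since lambda Z_p = p^(-m) Z_p. With
   w_u = e(xi u) pi(-u, 0, 0) v, the map sending a vector f to the function
   u |-> |lambda|^(d/2) (f, w_u) is the unitary equivalence with the model.
   The scalars by which the centre and p^m Z_p^d act recover the parameters. *)

Require Import Defs.
From HB Require Import structures.
From mathcomp Require Import all_boot all_order all_algebra complex.
From mathcomp Require Import all_classical all_reals all_analysis.
From mathcomp Require Import cyclic ring lra zify.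
Import Order.TTheory GRing.Theory Num.Theory numFieldNormedType.Exports.

Set Implicit Arguments.
Unset Strict Implicit.

Local Open Scope classical_set_scope.
Local Open Scope ring_scope.

(** * Arithmetic of p-adic numbers *)

(** An irreducible representation is given on a Hilbert space of unknown dimension, so no
    eigenvector comes for free. Vector-valued integration is replaced by means over finite residue
    systems: a shift changes the mean over residues modulo p^m by no more than the oscillation of
    the vector under p^m Z_p^k, and completeness does the rest. Irreducibility of the given
    representation is then used only on closed subspaces cut out by equations: an eigenspace in
    Schur's argument, the kernel of the intertwiner at the end. Surjectivity of the intertwiner
    comes instead from irreducibility of the model, and the finite expansion in the vectors w_u,
    hence finite dimension, is a conclusion. On the arithmetic side everything is reduced to
    numerators: a p-adic number is a / p^M with a in Z_p, and its fractional part is read off the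
    residue of a modulo p^M. That a is a unit in lambda = a / p^m makes p^m the exact conductor of t
    |-> e(lambda t), which is what separates the cosets of p^m Z_p^d. The trivial class, represented
    by 1, is the case m = 0 and follows the same argument. *)

Section PadicArith.
Context {p : nat} {pp : prime p}.
Local Notation Zp := (padic_int pp).
Local Notation Qp := (padic pp).
Implicit Types (x y a b : Zp) (u v : Qp) (n m k M : nat).

Lemma resD x y n : (x + y) n = ((x n + y n) %% p ^ n)%N.
Proof. by []. Qed.

Lemma resM x y n : (x * y) n = ((x n * y n) %% p ^ n)%N.
Proof. by []. Qed.

Lemma res0 n : (0 : Zp) n = 0%N.
Proof. exact: mod0n. Qed.

Lemma res_nat k n : (k%:R : Zp) n = (k %% p ^ n)%N.
Proof.
elim: k => [|k IH]; first by rewrite res0 mod0n.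
by rewrite -addn1 natrD resD IH modnDm.
Qed.

Lemma res_at0 x : x 0%N = 0%N.
Proof. by rewrite -(res_mod x) modn1. Qed.

Lemma res_le x n m : (n <= m)%N -> x n = (x m %% p ^ n)%N.
Proof. by move=> /subnKC <-; rewrite res_modD. Qed.

Lemma res_lt x n : (x n < p ^ n)%N.
Proof. by rewrite -res_mod ltn_pmod ?expp_gt0. Qed.

Lemma res_nat_expp n k : (p%:R ^+ n : Zp) k = (p ^ n %% p ^ k)%N.
Proof. by rewrite -natrX res_nat. Qed.

(** The quotient by p^k has residues [x (n + k) %/ p ^ k]: looking k places ahead makes the division
    exact at every level. *)
Lemma res_eq0_dvd x k : x k = 0%N -> exists b, x = p%:R ^+ k * b.
Proof.
move=> xk0.
have bE n : (x (n.+1 + k) %/ p ^ k = x (n + k) %/ p ^ k %[mod p ^ n])%N.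
  rewrite (@res_le x (n + k) (n.+1 + k)) ?leq_add2r //.
  rewrite [in LHS](divn_eq (x (n.+1 + k)) (p ^ (n + k))) {2}expnD mulnA.
  by rewrite divnMDl ?expp_gt0 // modnMDl.
exists (padic_int_of pp bE).
apply: padic_int_ext => n; rewrite resM res_nat_expp /= modnMml modnMmr.
have dv : (p ^ k %| x (n + k))%N by rewrite /dvdn -res_le ?leq_addl // xk0.
by rewrite mulnC divnK // -res_le // leq_addr.
Qed.

Lemma res_expM n a m : (p%:R ^+ n * a) (n + m)%N = (p ^ n * a m)%N.
Proof.
rewrite resM res_nat_expp modnMml (expnD p n m) -muln_modr.
by rewrite (@res_le a m (n + m)) ?leq_addl.
Qed.

Lemma res_expM0 n a m : (m <= n)%N -> (p%:R ^+ n * a) m = 0%N.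
Proof.
move=> mn; have := res_expM n a 0; rewrite addn0 res_at0 muln0 => h.
by rewrite (res_le _ mn) h mod0n.
Qed.

Lemma res1_unit x : (x \is a GRing.unit) = (x 1%N != 0)%N.
Proof.
apply/idP/idP => [/asboolP[y yx1]|x1].
  apply/eqP => x10; have /(congr1 (fun z : Zp => z 1%N)) := yx1.
  rewrite resM x10 muln0 mod0n (res_nat 1) expn1 modn_small //.
  exact: prime_gt1.
have cop n : coprime (x n) (p ^ n).
  case: n => [|n]; first by rewrite coprimen1.
  rewrite coprimeXr // coprime_sym prime_coprime // /dvdn.
  by rewrite -{2}(expn1 p) -(@res_le x 1).
(* Euler's theorem gives an explicit inverse at each level; these are compatible because an inverse
   modulo p^n is unique. *)
pose f n := (x n ^ (totient (p ^ n)).-1)%N.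
have fx n : (f n * x n = 1 %[mod p ^ n])%N.
  rewrite /f -expnSr prednK ?totient_gt0 ?expp_gt0 //.
  exact: Euler_exp_totient.
have fE n : (f n.+1 = f n %[mod p ^ n])%N.
  have h : (f n.+1 * x n = 1 %[mod p ^ n])%N.
    rewrite (@res_le x n n.+1) // modnMmr.
    rewrite -(@modn_dvdm (p ^ n.+1)) ?dvdn_exp2l // fx modn_dvdm //.
    by rewrite dvdn_exp2l.
  rewrite -[in LHS](muln1 (f n.+1)) -modnMmr -(fx n) modnMmr mulnCA.
  by rewrite -modnMmr h modnMmr muln1.
apply: (@zp_unitPl _ _ _ (padic_int_of pp fE)); apply: padic_int_ext => n.
by rewrite resM /= modnMml fx.
Qed.

(** The exponent k is one less than the first level with a nonzero residue; were the cofactor b not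
    a unit, x would also vanish at level k + 1. *)
Lemma zp_decomp x : x != 0 ->
  exists k b, b \is a GRing.unit /\ x = p%:R ^+ k * b.
Proof.
move=> /eqP x0.
have ex : exists n, x n != 0%N.
  apply/not_existsP => xn; apply: x0; apply: padic_int_ext => n.
  by rewrite res0; apply/eqP; apply/negP => /negP /xn.
case: (ex_minnP ex) => -[|k]; first by rewrite res_at0.
move=> xk min.
have [|b xE] := @res_eq0_dvd x k.
  by apply/eqP; apply: contraT => /min; rewrite ltnn.
exists k, b; split=> //; rewrite res1_unit; apply: contraNneq xk => b10.
have [c bE] := res_eq0_dvd b10.
by rewrite xE bE mulrA -exprSr res_expM0.
Qed.

Lemma zp_p_neq0 : p%:R != 0 :> Zp.
Proof.
apply/eqP => /(congr1 (fun z : Zp => z 2%N)); rewrite res0 res_nat modn_small.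
  by move=> p0; have := prime_gt0 pp; rewrite p0.
by rewrite -{1}(expn1 p) ltn_exp2l ?prime_gt1.
Qed.

Lemma qp_p_neq0 : p%:R != 0 :> Qp.
Proof. by rewrite -(rmorph_nat (@tofrac Zp)) tofrac_eq0 zp_p_neq0. Qed.

Lemma qp_expp_neq0 n : p%:R ^+ n != 0 :> Qp.
Proof. by rewrite expf_neq0 // qp_p_neq0. Qed.

Lemma tofrac_expp n : (p%:R ^+ n : Zp)%:F = p%:R ^+ n.
Proof. by rewrite rmorphXn rmorph_nat. Qed.

(** The fraction field is a quotient of pairs, so the equation is checked on a representative
    pair. *)
Lemma qp_ratio u : exists x y, y != 0 /\ u = x%:F / y%:F.
Proof.
pose v := repr u.
exists (frac v).1, (frac v).2; split; first exact: denom_ratioP.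
apply: (canRL (mulfK _)); first by rewrite tofrac_eq0 denom_ratioP.
rewrite -[u]reprK -/v; unlock tofrac.
rewrite -[LHS]FracField.pi_mul; apply/eqmodP.
rewrite /= FracField.equivfE /FracField.mulf !numden_Ratio ?oner_neq0 //.
- by rewrite !mulr1 mulrC.
- by rewrite mulr1 denom_ratioP.
- by rewrite mulr1 denom_ratioP.
Qed.

(** The unit part of the denominator goes into the numerator. The fraction need not be reduced, so 0
    and integers are covered as well. *)
Lemma qp_form u : exists M a, u = a%:F / p%:R ^+ M.
Proof.
have [x [y [y0 ->]]] := qp_ratio u.
have [k [b [bU ->]]] := zp_decomp y0.
exists k, (x / b); rewrite !tofracM tofrac_expp invfM rmorphV //.
by rewrite [_^-1 * _]mulrC mulrA.
Qed.

Lemma tofrac_unit_neq0 a : a \is a GRing.unit -> a%:F != 0 :> Qp.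
Proof. by rewrite tofrac_eq0; apply: contraTneq => ->; rewrite unitr0. Qed.

Lemma padic_val_eq (m : int) a :
  a \is a GRing.unit -> padic_val (p%:R ^ m * a%:F : Qp) = m.
Proof.
(* One inequality suffices by symmetry: if m1 < m2, the unit a1 would be a positive power of p times
   a2. *)
have main (m1 m2 : int) a1 a2 : a1 \is a GRing.unit ->
    (p%:R ^ m1 * a1%:F : Qp) = p%:R ^ m2 * a2%:F -> (m2 <= m1)%R.
  move=> a1U /(congr1 (fun u => p%:R ^ (- m1) * u)).
  rewrite !mulrA -!expfzDr ?qp_p_neq0 // addNr expr0z mul1r => a1E.
  rewrite leNgt; apply/negP => m12.
  have [n nE] : exists n : nat, - m1 + m2 = n.+1%:Z.
    by exists (`|m2 - m1|%N.-1); lia.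
  move: a1E a1U; rewrite nE -exprnP -tofrac_expp -tofracM => /eqP.
  by rewrite tofrac_eq => /eqP ->; rewrite res1_unit res_expM0.
move=> aU; rewrite /padic_val; case: xgetP => [m' _ [b bU E]|/(_ m)[]].
  by apply/eqP; rewrite eq_le (main m' m b a) ?(main m m' a b).
by exists a.
Qed.

Lemma padic_val0 : padic_val (0 : Qp) = 0.
Proof.
rewrite /padic_val; case: xgetP => [m _ [b bU /esym/eqP]|//].
by rewrite mulf_eq0 (negPf (tofrac_unit_neq0 bU)) expfz_eq0 (negPf qp_p_neq0)
  andbF.
Qed.

Lemma padic_unit_part_eq (m : int) a :
  a \is a GRing.unit -> padic_unit_part (p%:R ^ m * a%:F : Qp) = a.
Proof.
move=> aU; rewrite /padic_unit_part; case: xgetP => [b _ /=|/(_ a)[]/=].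
  rewrite padic_val_eq // => /mulfI; rewrite expfz_neq0 ?qp_p_neq0 //.
  by move=> /(_ isT)/eqP; rewrite tofrac_eq => /eqP.
by rewrite padic_val_eq.
Qed.

Lemma sum_zp_digit a n : (\sum_(k < n) zp_digit a k * p ^ k)%N = a n.
Proof.
elim: n => [|n IH]; first by rewrite big_ord0 res_at0.
rewrite big_ord_recr /= IH /zp_digit (@res_le a n n.+1) //.
by rewrite addnC -divn_eq.
Qed.

(** Replaces the digit sum by one residue. A common factor p^k of numerator and denominator cancels
    on both sides, which leaves the digits of the unit part. *)
Lemma padic_frac_form M a :
  padic_frac (a%:F / p%:R ^+ M : Qp) = (a M)%:R / p%:R ^+ M.
Proof.
have pQ : (p%:R : rat) != 0 by rewrite pnatr_eq0 -lt0n prime_gt0.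
have [->|/zp_decomp[k [b [bU ->]]]] := eqVneq a 0.
  by rewrite rmorph0 mul0r /padic_frac padic_val0 lexx res0 mul0r.
have uE : (p%:R ^+ k * b)%:F / p%:R ^+ M = p%:R ^ (k%:Z - M%:Z) * b%:F :> Qp.
  rewrite expfzDr ?qp_p_neq0 // tofracM tofrac_expp -mulrA [b%:F * _]mulrC.
  by rewrite mulrA -exprnN.
rewrite uE /padic_frac padic_val_eq // padic_unit_part_eq //.
(* If M <= k the number is integral and both sides vanish; otherwise exactly M - k digits lie at
   negative indices. *)
have [Mk|kM] := leqP M k.
  by rewrite res_expM0 // mul0r ifT // subr_ge0 lez_nat.
rewrite ifF; last by apply/negbTE; rewrite -ltNge subr_lt0 ltz_nat.
have [j ->] : exists j, M = (k + j)%N by exists (M - k)%N;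
  rewrite subnKC // ltnW.
have -> : k%:Z - (k + j)%N%:Z = - j%:Z by rewrite PoszD opprD addrA subrr add0r.
rewrite abszN absz_nat res_expM natrM exprD natrX -mulf_div divff ?expf_neq0 //.
rewrite mul1r -(sum_zp_digit b j) natr_sum mulr_suml; apply: eq_bigr => i _.
by rewrite natrM natrX expfzDr // -exprnN -mulrA [_^-1 * _]mulrC.
Qed.

End PadicArith.

(** * The additive character *)

Section PadicExp.
Context {R : realType} {p : nat} {pp : prime p}.
Local Notation Zp := (padic_int pp).
Local Notation Qp := (padic pp).
Implicit Types (a b : Zp) (u v : Qp) (n m k M : nat) (s t : R).

Definition cis t : R[i] := (cos (2 * pi * t) +i* sin (2 * pi * t))%C.

Lemma cisD s t : cis (s + t) = cis s * cis t.
Proof.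
by rewrite /cis mulrDr cosD sinD; apply/eqP; rewrite eq_complex /= !eqxx
  [cos _ * sin _ + _]addrC eqxx.
Qed.

Lemma cis0 : cis 0 = 1.
Proof. by rewrite /cis mulr0 cos0 sin0. Qed.

Lemma cis1 : cis 1 = 1.
Proof. by rewrite /cis mulr1 mulrC mulr_natr cos2pi sin2pi. Qed.

Lemma cisMn k t : cis (k%:R * t) = cis t ^+ k.
Proof.
elim: k => [|k IH]; first by rewrite mul0r cis0.
by rewrite -[in LHS]addn1 natrD mulrDl mul1r cisD IH exprSr.
Qed.

Lemma cisN_mul t : cis (- t) * cis t = 1.
Proof. by rewrite -cisD addNr cis0. Qed.

Lemma cis_conj t : (cis t)^* = cis (- t).
Proof. by rewrite /cis mulrN cosN sinN. Qed.

Lemma cis_mod n k : (0 < n)%N ->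
  cis (k%:R / n%:R) = cis ((k %% n)%N%:R / n%:R).
Proof.
move=> n0; rewrite {1}(divn_eq k n) natrD mulrDl cisD natrM mulfK.
  by rewrite -[_%:R]mulr1 cisMn cis1 expr1n mul1r.
by rewrite pnatr_eq0 -lt0n.
Qed.

(** By the double angle formula sin (pi t) = 0, whereas sin (pi t) > 0 for 0 < t < 1. *)
Lemma cis_eq1 t : 0 <= t < 1 -> cis t = 1 -> t = 0.
Proof.
move=> /andP[t0 t1] /(congr1 (@complex.Re R)) /=.
rewrite -mulrA [2 * _]mulrC mulr_natr cos_mulr2n => c1.
apply/eqP; apply: contraT => tN0.
have /sin_gt0_pi s0 : 0 < pi * t < pi.
  by rewrite mulr_gt0 ?pi_gt0 //= ?gtr_pMr ?pi_gt0 // lt_def tN0.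
have := cos2Dsin2 (pi * t); have : 0 < sin (pi * t) ^+ 2 by rewrite exprn_gt0.
by move: c1; rewrite mulr2n; lra.
Qed.

Lemma padic_expE M a :
  padic_exp R (a%:F / p%:R ^+ M : Qp) = cis ((a M)%:R / (p ^ M)%N%:R).
Proof.
rewrite /padic_exp padic_frac_form /cis.
by rewrite [ratr _]fmorph_div /= rmorphXn /= !ratr_nat natrX.
Qed.

Lemma qp_form2 u v : exists M a b,
  u = a%:F / p%:R ^+ M /\ v = b%:F / p%:R ^+ M.
Proof.
have [M [a ->]] := qp_form u; have [L [b ->]] := qp_form v.
exists (M + L)%N, (a * p%:R ^+ L), (b * p%:R ^+ M).
rewrite !tofracM !tofrac_expp exprD; split; first by rewrite -mulf_div divff
  ?mulr1 ?expf_neq0 ?qp_p_neq0.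
by rewrite [p%:R ^+ M * _]mulrC -mulf_div divff ?mulr1 ?expf_neq0 ?qp_p_neq0.
Qed.

(** Over a common denominator p^M fractional parts add up to an integer, which [cis] does not
    see. *)
Lemma padic_expD u v :
  padic_exp R (u + v) = padic_exp R u * padic_exp R v.
Proof.
have [M [a [b [-> ->]]]] := qp_form2 u v.
rewrite -mulrDl -tofracD !padic_expE resD -cis_mod ?expp_gt0 //.
by rewrite natrD mulrDl cisD.
Qed.

Lemma padic_exp_zp a : padic_exp R (a%:F : Qp) = 1.
Proof.
have -> : a%:F = a%:F / p%:R ^+ 0 :> Qp by rewrite expr0 divr1.
by rewrite padic_expE res_at0 mul0r cis0.
Qed.

Lemma padic_exp0 : padic_exp R (0 : Qp) = 1.
Proof. by rewrite -tofrac0 padic_exp_zp. Qed.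

Lemma padic_exp_conj u : (padic_exp R u)^* = padic_exp R (- u).
Proof.
have : padic_exp R u * (padic_exp R u)^* = 1.
  by rewrite /padic_exp -/(cis _) cis_conj mulrC cisN_mul.
have : padic_exp R u * padic_exp R (- u) = 1.
  by rewrite -padic_expD subrr padic_exp0.
have [->|u0] := eqVneq (padic_exp R u) 0.
  by rewrite mul0r => /esym/eqP; rewrite oner_eq0.
by move=> <- /(mulfI u0).
Qed.

Lemma padic_expN_mul u : padic_exp R (- u) * padic_exp R u = 1.
Proof. by rewrite -padic_expD addNr padic_exp0. Qed.

(** The kernel of the character is Z_p; through this every equality of phases becomes a
    congruence. *)
Lemma padic_exp_eq1 u : padic_exp R u = 1 -> exists a, u = a%:F.
Proof.
have [M [a ->]] := qp_form u; rewrite padic_expE.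
have pM : 0 < (p ^ M)%N%:R :> R by rewrite ltr0n expp_gt0.
move=> /cis_eq1; rewrite divr_ge0 // ltr_pdivrMr // mul1r ltr_nat res_lt.
move=> /(_ isT)/eqP; rewrite mulf_eq0 invr_eq0 (gt_eqF pM) orbF pnatr_eq0.
move=> /eqP/res_eq0_dvd[b ->]; exists b.
by rewrite tofracM tofrac_expp mulrC mulKf ?expf_neq0 ?qp_p_neq0.
Qed.

Lemma padic_exp_addzp u a : padic_exp R (u + a%:F) = padic_exp R u.
Proof. by rewrite padic_expD padic_exp_zp mulr1. Qed.

End PadicExp.

(** * Canonical representatives of Q_p modulo p^(-n) Z_p *)

Section Representatives.
Context {p : nat} {pp : prime p}.
Local Notation Zp := (padic_int pp).
Local Notation Qp := (padic pp).
Implicit Types (a b : Zp) (u v : Qp) (n L N : nat).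

Lemma digits_frac n L (c : nat -> 'I_p) : exists2 j : nat, (j < p ^ L)%N &
  \sum_(n.+1 <= k < (n.+1 + L)%N) (c k)%:R * p%:R ^ (- k%:Z) =
    j%:R / p%:R ^+ (n + L) :> Qp.
Proof.
elim: L => [|L [j jL IH]]; first by exists 0%N;
  rewrite // addn0 big_geq // mul0r.
(* Horner's rule: the digit at the most negative power of p is the least significant digit of the
   numerator. *)
exists (j * p + c (n.+1 + L))%N.
  by rewrite expnSr; have := ltn_ord (c (n.+1 + L)%N); nia.
rewrite addnS big_nat_recr ?leq_addr //= IH natrD mulrDl addnS addSn.
by rewrite -exprnN exprSr natrM -mulf_div divff ?mulr1 ?qp_p_neq0.
Qed.

Lemma frac_digits n L (j : nat) : (j < p ^ L)%N ->
  exists c : nat -> 'I_p,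
    j%:R / p%:R ^+ (n + L) =
    \sum_(n.+1 <= k < (n.+1 + L)%N) (c k)%:R * p%:R ^ (- k%:Z) :> Qp.
Proof.
have p0 := prime_gt0 pp.
elim: L j => [|L IH] j jL.
  exists (fun=> Ordinal p0); rewrite !addn0 big_geq //.
  by move: jL; rewrite expn0 ltnS leqn0 => /eqP ->; rewrite mul0r.
have [|c cE] := IH (j %/ p)%N; first by rewrite ltn_divLR // -expnSr.
exists (fun k => if k == (n.+1 + L)%N then Ordinal (ltn_pmod j p0) else c k).
rewrite !addnS big_nat_recr ?leq_addr //= eqxx.
rewrite [in RHS](eq_big_nat _ _ (F2 := fun k => (c k)%:R * p%:R ^ (- k%:Z))).
  rewrite -cE {1}(divn_eq j p) natrD mulrDl ?addSn -exprnN exprSr natrM.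
  by rewrite -mulf_div divff ?mulr1 ?qp_p_neq0.
by move=> k /andP[_ kL]; rewrite ltn_eqF.
Qed.

Lemma qp_natr_neq0 (j : nat) : (0 < j)%N -> j%:R != 0 :> Qp.
Proof.
move=> j0; rewrite -(rmorph_nat (@tofrac Zp)) tofrac_eq0; apply/eqP.
(* Since j < p^j, the residue of j at level j is j itself. *)
move=> /(congr1 (fun z : Zp => z j)); rewrite res_nat res0 modn_small.
  by move=> jE; rewrite jE in j0.
by rewrite ltn_expl ?prime_gt1.
Qed.

(** A nontrivial representative becomes one bounded numerator; j > 0 because the zero class is
    represented by 1. *)
Lemma quot_repsP n u : quot_reps pp n u <->
  u = 1 \/ exists L j, (0 < j < p ^ L)%N /\ u = j%:R / p%:R ^+ (n + L).
Proof.
split=> [[->|[u0 [N [c uE]]]]|[->|[L [j [/andP[j0 jL] ->]]]]].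
- by left.
- right; have [Nn|/ltnW nN] := leqP N n.+1.
    by move: u0; rewrite uE big_geq // eqxx.
  have [j jL E] := digits_frac n (N - n.+1) c.
  rewrite subnKC // -uE in E; exists (N - n.+1)%N, j; split=> //.
  rewrite jL andbT lt0n; apply: contraNneq u0 => j0.
  by rewrite E j0 mul0r.
- by left.
right; split; first by rewrite mulf_neq0 ?invr_eq0 ?qp_expp_neq0 ?qp_natr_neq0.
have [c cE] := frac_digits n jL.
by exists (n.+1 + L)%N, c.
Qed.

Lemma quot_reps_sub n u : quot_reps pp n u -> quot_reps pp 0 u.
Proof.
move=> /quot_repsP[->|[L [j [/andP[j0 jL] ->]]]]; apply/quot_repsP;
  first by left.
right; exists (n + L)%N, j; split=> //; rewrite j0 (leq_trans jL) //.
by rewrite leq_exp2l ?prime_gt1 ?leq_addl.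
Qed.

Lemma quot_reps_ex n u :
  exists v a, quot_reps pp n v /\ u = v + p%:R ^- n * a%:F.
Proof.
have [M [b uE]] := qp_form u.
have [x uE2] : exists x : Zp, u = x%:F / p%:R ^+ (n + M).
  exists (b * p%:R ^+ n); rewrite uE tofracM tofrac_expp (exprD _ n M) [p%:R ^+
    n * _]mulrC.
  by rewrite -mulf_div divff ?mulr1 ?qp_expp_neq0.
have [y yE] : exists y, x - (x M)%:R = p%:R ^+ M * y.
  apply: res_eq0_dvd; have : x - (x M)%:R + (x M)%:R = x by rewrite subrK.
  move=> /(congr1 (fun z : Zp => z M)); rewrite resD res_nat modnDmr.
  move=> h; have : ((x - (x M)%:R)%R M + x M = 0 + x M %[mod p ^ M])%N.
    by rewrite h add0n res_mod.
  by move=> /eqP; rewrite eqn_modDr mod0n res_mod => /eqP.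
have {}uE2 : u = (x M)%:R / p%:R ^+ (n + M) + p%:R ^- n * y%:F.
  rewrite uE2 -[x in LHS](subrK (x M)%:R) yE tofracD tofracM tofrac_expp addrC.
  rewrite rmorph_nat mulrDl; congr (_ + _).
  rewrite exprD [p%:R ^+ n * _]mulrC -mulf_div divff ?qp_expp_neq0 //.
  by rewrite mul1r mulrC.
(* A zero residue means the trivial class; its representative 1 equals p^(-n) p^n, hence the
   correction of y by p^n below. *)
have [x0|x0] := eqVneq (x M) 0%N; last first.
  exists ((x M)%:R / p%:R ^+ (n + M)), y; split=> //.
  by apply/quot_repsP; right; exists M, (x M); rewrite lt0n x0 res_lt.
exists 1, (y - p%:R ^+ n); split; first by left.
rewrite uE2 x0 mul0r add0r tofracB mulrBr tofrac_expp mulVf ?qp_expp_neq0 //.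
by rewrite addrC subrK.
Qed.

Lemma quot_reps_inj n u v a : quot_reps pp n u -> quot_reps pp n v ->
  u = v + p%:R ^- n * a%:F -> u = v.
Proof.
(* Clearing denominators leaves a congruence modulo p^L between numbers below p^L. *)
have res_eq L (j k : nat) (b : Zp) : (j < p ^ L)%N -> (k < p ^ L)%N ->
    j%:R / p%:R ^+ (n + L) = k%:R / p%:R ^+ (n + L) + p%:R ^- n * b%:F :> Qp ->
    j = k.
  move=> jL kL /(congr1 (fun w => w * p%:R ^+ (n + L))).
  rewrite mulrDl !mulfVK ?qp_expp_neq0 // exprD [_ * b%:F]mulrC mulrA mulrVK.
    rewrite -tofrac_expp -!(rmorph_nat (@tofrac Zp)) -tofracM -tofracD => /eqP.
    rewrite tofrac_eq => /eqP/(congr1 (fun z : Zp => z L)).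
    by rewrite resD [b * _]mulrC res_expM0 // addn0 !res_nat modn_mod
      !modn_small.
  by rewrite unitfE qp_expp_neq0.
(* As 1 lies in p^(-n) Z_p, a fraction congruent to it would have numerator 0. *)
have one_rep L (j : nat) (b : Zp) : (0 < j < p ^ L)%N ->
    j%:R / p%:R ^+ (n + L) <> 1 + p%:R ^- n * b%:F :> Qp.
  move=> /andP[j0 jL] E; suff j0' : j = 0%N by rewrite j0' in j0.
  apply: (res_eq L _ _ (b + p%:R ^+ n)) => //; first by rewrite expp_gt0.
  rewrite E mul0r add0r tofracD tofrac_expp mulrDr mulVf ?qp_expp_neq0 //.
  by rewrite addrC.
move=> /quot_repsP[->|[L [j [jL ->]]]] /quot_repsP[->|[L' [k [kL ->]]]] //.
- move=> E; exfalso; apply: (one_rep _ _ (- a) kL).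
  by rewrite tofracN mulrN; apply/eqP; rewrite eq_sym subr_eq; apply/eqP.
- by move=> /(one_rep _ _ _ jL).
move: jL kL => /andP[_ jL] /andP[_ kL].
(* Padding with zero digits gives both representatives the same length L + L'. *)
have ext l l' (i : nat) : (i < p ^ l)%N -> (i * p ^ l' < p ^ (l + l'))%N /\
    i%:R / p%:R ^+ (n + l) = (i * p ^ l')%N%:R / p%:R ^+ (n + (l + l')) :> Qp.
  move=> il; rewrite expnD ltn_pmul2r ?expp_gt0 // il; split=> //.
  rewrite addnA (exprD _ (n + l)%N) natrM natrX -mulf_div divff ?mulr1 //.
  by rewrite qp_expp_neq0.
have [jL1 ->] := ext _ L' _ jL; have [kL1 ->] := ext _ L _ kL.
by rewrite [in (L' + L)%N]addnC in kL1 *; move=> /res_eq ->.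
Qed.

End Representatives.

(** * Residue systems and periodic functions *)

Section Residues.
Context {p : nat} {pp : prime p} {d : nat}.
Local Notation Zp := (padic_int pp).
Local Notation Qp := (padic pp).
Local Notation Zpd := 'rV[Zp]_d.
Implicit Types (m : nat) (x y u w : Zpd).

Lemma res_sub_eq0 (a b : Zp) m : ((a - b) m == 0%N) = (a m == b m).
Proof.
have E : (((a - b)%R m + b m) %% p ^ m = a m)%N by rewrite -resD subrK.
have -> : (a m == b m) = ((a - b)%R m + b m == 0 + b m %[mod p ^ m])%N.
  by rewrite E add0n res_mod.
by rewrite eqn_modDr res_mod mod0n.
Qed.

Lemma padic_idealP m (a : Zp) : padic_ideal pp m%:Z a%:F <-> a m = 0%N.
Proof.
split=> [[b _ /eqP]|/res_eq0_dvd[b ->]]; last first.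
  by exists b; rewrite // tofracM tofrac_expp exprnP.
by rewrite -exprnP -tofrac_expp -tofracM tofrac_eq => /eqP <-; exact: res_expM0.
Qed.

Lemma Zpd_idealP m x : Zpd_ideal m%:Z x <-> forall j, x 0 j m = 0%N.
Proof. by split=> h j; apply/padic_idealP. Qed.

Lemma Zpd_ideal0 m : Zpd_ideal m%:Z (0 : Zpd).
Proof. by apply/Zpd_idealP => j; rewrite mxE res0. Qed.

Lemma Zpd_ideal_sub m x y :
  Zpd_ideal m%:Z (x - y) <-> forall j, x 0 j m = y 0 j m.
Proof.
rewrite Zpd_idealP; split=> h j.
  by have := h j; rewrite !mxE => /eqP; rewrite res_sub_eq0 => /eqP.
by rewrite !mxE; apply/eqP; rewrite res_sub_eq0 h.
Qed.

Lemma Zpd_idealN m x : Zpd_ideal m%:Z x -> Zpd_ideal m%:Z (- x).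
Proof.
move=> /Zpd_idealP xm; rewrite -[- x]add0r; apply/Zpd_ideal_sub => j.
by rewrite mxE xm res0.
Qed.

Lemma Zpd_idealD m x y :
  Zpd_ideal m%:Z x -> Zpd_ideal m%:Z y -> Zpd_ideal m%:Z (x + y).
Proof.
move=> /Zpd_idealP xm /Zpd_idealP ym; apply/Zpd_idealP => j.
by rewrite mxE resD xm ym mod0n.
Qed.

Lemma Zpd_idealC m x y : Zpd_ideal m%:Z (x - y) <-> Zpd_ideal m%:Z (y - x).
Proof. by split=> /Zpd_idealN; rewrite opprB. Qed.

Lemma Zpd_ideal_dvd m x : Zpd_ideal m%:Z x -> exists y, x = p%:R ^+ m *: y.
Proof.
move=> /Zpd_idealP xm; pose f j := xget 0 [set b | x 0 j = p%:R ^+ m * b].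
exists (\row_j f j); apply/rowP => j; rewrite !mxE /f.
by case: xgetP => [b _ //|no]; have [b bE] := res_eq0_dvd (xm j); have := no b.
Qed.

Lemma Zpd_ideal_scale m x : Zpd_ideal m%:Z (p%:R ^+ m *: x).
Proof. by apply/Zpd_idealP => j; rewrite mxE res_expM0. Qed.

Lemma Zpd_cosetP m h u : Zpd_coset h m%:Z u <-> Zpd_ideal m%:Z (u - h).
Proof.
split=> [[w wI <-]|]; first by rewrite addrC addKr.
by move=> uh; exists (u - h) => //; rewrite addrC subrK.
Qed.

(** A finite type for Z_p^d / p^m Z_p^d, so that Haar integrals of periodic functions become big
    operators. *)
Definition residue m := {ffun 'I_d -> 'I_(p ^ m)}.

Definition residue_rep m (e : residue m) : Zpd := \row_j (e j)%:R.

Definition residue_of m x : residue m := [ffun j => Ordinal (res_lt (x 0 j) m)].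

Lemma residue_of_eq m x y :
  residue_of m x = residue_of m y <-> Zpd_ideal m%:Z (x - y).
Proof.
rewrite Zpd_ideal_sub; split=> [/ffunP h j|h].
  by have := h j; rewrite !ffunE => /(congr1 val).
by apply/ffunP => j; rewrite !ffunE; apply/val_inj/h.
Qed.

Lemma residue_repK m (e : residue m) : residue_of m (residue_rep e) = e.
Proof.
by apply/ffunP => j; rewrite ffunE; apply: val_inj; rewrite /= mxE res_nat
  modn_small.
Qed.

Lemma residue_rep_of m x : Zpd_ideal m%:Z (residue_rep (residue_of m x) - x).
Proof. by apply/residue_of_eq; rewrite residue_repK. Qed.

Lemma card_residue m : #|{: residue m}| = ((p ^ m) ^ d)%N.
Proof. by rewrite card_ffun !card_ord. Qed.

Lemma card_residue_gt0 m : (0 < #|{: residue m}|)%N.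
Proof. by rewrite card_residue expn_gt0 expp_gt0. Qed.

Definition mod_periodic (T : Type) m (f : Zpd -> T) :=
  forall u w, Zpd_ideal m%:Z w -> f (u + w) = f u.

Lemma mod_periodic_eq (T : Type) m (f : Zpd -> T) x y :
  mod_periodic m f -> Zpd_ideal m%:Z (x - y) -> f x = f y.
Proof. by move=> fP /(fP y); rewrite addrC subrK. Qed.

Lemma mod_periodic_rep (T : Type) m (f : Zpd -> T) x :
  mod_periodic m f -> f (residue_rep (residue_of m x)) = f x.
Proof. by move=> fP; apply: (mod_periodic_eq fP); exact: residue_rep_of. Qed.

Lemma residue_of_shift m x y a :
  Zpd_ideal m%:Z (x - y) -> residue_of m (x + a) = residue_of m (y + a).
Proof.
by move=> xy; apply/residue_of_eq; rewrite opprD addrACA subrr addr0.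
Qed.

Lemma shift_residueK m (a : Zpd) :
  cancel (fun e : residue m => residue_of m (residue_rep e + a))
         (fun e => residue_of m (residue_rep e - a)).
Proof.
move=> e; rewrite (residue_of_shift _ (residue_rep_of m _)).
by rewrite addrK residue_repK.
Qed.

Lemma shift_residue_inj m (a : Zpd) :
  injective (fun e : residue m => residue_of m (residue_rep e + a)).
Proof. exact: can_inj (shift_residueK a). Qed.

(** A shift permutes the classes, and periodicity hides the difference between a shifted
    representative and the representative of the shifted class. *)
Lemma sum_residue_shift (V : nmodType) m (f : Zpd -> V) a : mod_periodic m f ->
  \sum_(e : residue m) f (residue_rep e + a) =
  \sum_(e : residue m) f (residue_rep e).
Proof.
move=> fP; rewrite [RHS](reindex_inj (@shift_residue_inj m a)).
by apply: eq_bigr => e _; rewrite mod_periodic_rep.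
Qed.

(** These rules are stated over general rings because [dotv] pairs vectors over Q_p as well as over
    Z_p. *)
Lemma dotv_comm (A : comPzRingType) (x y : 'rV[A]_d) : dotv x y = dotv y x.
Proof. by apply: eq_bigr => j _; rewrite mulrC. Qed.

Lemma dotv_addl (A : pzRingType) (x y z : 'rV[A]_d) :
  dotv (x + y) z = dotv x z + dotv y z.
Proof.
by rewrite /dotv -big_split; apply: eq_bigr => j _; rewrite mxE mulrDl.
Qed.

Lemma dotv_addr (A : pzRingType) (x y z : 'rV[A]_d) :
  dotv x (y + z) = dotv x y + dotv x z.
Proof.
by rewrite /dotv -big_split; apply: eq_bigr => j _; rewrite mxE mulrDr.
Qed.

Lemma dotv_oppl (A : pzRingType) (x y : 'rV[A]_d) : dotv (- x) y = - dotv x y.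
Proof. by rewrite /dotv -sumrN; apply: eq_bigr => j _; rewrite mxE mulNr. Qed.

Lemma dotv_oppr (A : pzRingType) (x y : 'rV[A]_d) : dotv x (- y) = - dotv x y.
Proof. by rewrite /dotv -sumrN; apply: eq_bigr => j _; rewrite mxE mulrN. Qed.

Lemma dotv_scalel (A : pzRingType) c (x y : 'rV[A]_d) :
  dotv (c *: x) y = c * dotv x y.
Proof.
by rewrite /dotv mulr_sumr; apply: eq_bigr => j _; rewrite mxE mulrA.
Qed.

Lemma dotv_scaler (A : comPzRingType) c (x y : 'rV[A]_d) :
  dotv x (c *: y) = c * dotv x y.
Proof. by rewrite dotv_comm dotv_scalel dotv_comm. Qed.

Lemma dotv0l (A : pzRingType) (x : 'rV[A]_d) : dotv 0 x = 0.
Proof. by rewrite /dotv big1 // => j _; rewrite mxE mul0r. Qed.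

Lemma dotv0r (A : pzRingType) (x : 'rV[A]_d) : dotv x 0 = 0.
Proof. by rewrite /dotv big1 // => j _; rewrite mxE mulr0. Qed.

Lemma dotv_delta (A : pzRingType) (x : 'rV[A]_d) j :
  dotv x (delta_mx 0 j) = x 0 j.
Proof.
rewrite /dotv (bigD1 j) //= big1 ?addr0 => [|i /negPf ij].
  by rewrite mxE !eqxx mulr1.
by rewrite mxE eqxx ij mulr0.
Qed.

Lemma to_QpdD x y : to_Qpd (x + y) = to_Qpd x + to_Qpd y.
Proof. exact: map_mxD. Qed.

Lemma to_QpdN x : to_Qpd (- x) = - to_Qpd x.
Proof. exact: map_mxN. Qed.

Lemma to_Qpd0 : to_Qpd 0 = 0 :> 'rV[Qp]_d.
Proof. exact: map_mx0. Qed.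

Lemma to_QpdZ (c : Zp) x : to_Qpd (c *: x) = c%:F *: to_Qpd x.
Proof. exact: map_mxZ. Qed.

Lemma to_Qpd_delta j :
  to_Qpd (delta_mx 0 j) = delta_mx 0 j :> 'rV[Qp]_d.
Proof. exact: map_delta_mx. Qed.

Lemma dotv_to_Qpd x y : dotv (to_Qpd x) (to_Qpd y) = (dotv x y)%:F.
Proof.
by rewrite /dotv rmorph_sum /=; apply: eq_bigr => j _; rewrite !mxE tofracM.
Qed.

Lemma dotv_ideal m x y : Zpd_ideal m%:Z x -> (dotv x y) m = 0%N.
Proof. by move=> /Zpd_ideal_dvd[z ->]; rewrite dotv_scalel res_expM0. Qed.

End Residues.

Arguments residue p d m : clear implicits.

(** * Orthogonality of the additive characters *)

Section Characters.
Context {R : realType} {p : nat} {pp : prime p} {d : nat}.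
Local Notation Zp := (padic_int pp).
Local Notation Qp := (padic pp).
Local Notation Zpd := 'rV[Zp]_d.
Local Notation Qpd := 'rV[Qp]_d.
Implicit Types (m : nat) (x y u w : Zpd) (xi eta : Qpd) (a b : Zp).

Lemma padic_exp_ideal m a b : b m = 0%N ->
  padic_exp R (a%:F / p%:R ^+ m * b%:F : Qp) = 1.
Proof.
move=> /res_eq0_dvd[c ->]; rewrite tofracM tofrac_expp mulrA divfK.
  by rewrite -tofracM padic_exp_zp.
exact: qp_expp_neq0.
Qed.

(** If a b / p^m is integral, dividing by the unit a shows that p^m divides b: the conductor is
    exactly p^m. *)
Lemma padic_exp_unit_neq1 m a b : a \is a GRing.unit ->
  padic_exp R (a%:F / p%:R ^+ m * b%:F : Qp) = 1 -> b m = 0%N.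
Proof.
move=> aU /padic_exp_eq1[c /(congr1 (fun v => v * p%:R ^+ m))].
rewrite mulrAC divfK ?qp_expp_neq0 // -tofrac_expp -!tofracM => /eqP.
rewrite tofrac_eq => /eqP/(congr1 (fun v => a^-1 * v)).
by rewrite mulKr // mulrCA mulrA [_ * p%:R ^+ m]mulrC => ->; rewrite res_expM0.
Qed.

(** Shifting by y multiplies the sum by f y and leaves it unchanged. *)
Lemma sum_multiplicative0 m (f : Zpd -> R[i]) y :
  (forall x y, f (x + y) = f x * f y) -> mod_periodic m f -> f y != 1 ->
  \sum_(e : residue p d m) f (residue_rep e) = 0.
Proof.
move=> fM fP fy; have := sum_residue_shift y fP.
under eq_bigr do rewrite fM; rewrite -mulr_suml => /eqP.
rewrite -subr_eq0 -{2}[\sum_e _]mulr1 -mulrBr mulf_eq0 subr_eq0.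
by rewrite (negPf fy) orbF => /eqP.
Qed.

Lemma sum_padic_exp m a w : a \is a GRing.unit ->
  \sum_(e : residue p d m)
     padic_exp R (a%:F / p%:R ^+ m * (dotv (residue_rep e) w)%:F : Qp) =
  if `[< Zpd_ideal m%:Z w >] then (#|{: residue p d m}|)%:R else 0.
Proof.
move=> aU; case: ifPn => [/asboolP wI|/asboolPn wI].
  rewrite -[in RHS]sum1_card natr_sum; apply: eq_bigr => e _.
  by rewrite padic_exp_ideal // dotv_comm dotv_ideal.
pose f (y : Zpd) := padic_exp R (a%:F / p%:R ^+ m * (dotv y w)%:F : Qp).
have fD y z : f (y + z) = f y * f z.
  by rewrite /f dotv_addl tofracD mulrDr padic_expD.
have fP : mod_periodic m f.
  by move=> y z zI; rewrite fD {2}/f padic_exp_ideal ?mulr1 ?dotv_ideal.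
have [j wj] : exists j, w 0 j m <> 0%N.
  by apply/existsNP => wj; apply: wI; apply/Zpd_idealP.
apply: (sum_multiplicative0 (y := delta_mx 0 j) fD fP); apply/eqP.
by rewrite /f dotv_comm dotv_delta => /(padic_exp_unit_neq1 aU); exact: wj.
Qed.

Lemma quot_reps0_form (lambda : Qp) : quot_reps pp 0 lambda ->
  exists m a, [/\ a \is a GRing.unit, lambda = a%:F / p%:R ^+ m,
    padic_val lambda = - m%:Z & padic_norm R lambda = (p ^ m)%N%:R].
Proof.
move=> lq; suff [m [a [aU lE]]] : exists m a, a \is a GRing.unit /\
    lambda = a%:F / p%:R ^+ m.
  have v : padic_val lambda = - m%:Z.
    by rewrite lE mulrC exprnN padic_val_eq.
  exists m, a; split=> //; rewrite /padic_norm v opprK natrX ifF //.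
  by rewrite lE mulf_eq0 (negPf (tofrac_unit_neq0 aU)) invr_eq0
    (negPf (qp_expp_neq0 _)).
have /quot_repsP[->|[L [j [/andP[j0 jL] ->]]]] := lq.
  by exists 0%N, 1; rewrite unitr1 tofrac1 expr0 divr1.
have jN : (j%:R : Zp) != 0.
  by rewrite -tofrac_eq0 rmorph_nat qp_natr_neq0.
have [k [b [bU jE]]] := zp_decomp jN.
(* Since 0 < j < p^L, the power p^k dividing j does not exhaust the denominator p^L. *)
have kL : (k < L)%N.
  rewrite ltnNge; apply/negP => Lk; have := res_nat (pp := pp) j L.
  by rewrite jE res_expM0 // modn_small // => j0'; rewrite -j0' in j0.
exists (L - k)%N, b; split=> //.
have -> : j%:R = (p%:R ^+ k * b)%:F :> Qp by rewrite -jE rmorph_nat.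
rewrite tofracM tofrac_expp add0n.
rewrite -{1}(subnKC (ltnW kL)) exprD -mulf_div divff ?mul1r //.
exact: qp_expp_neq0.
Qed.

End Characters.

(** * Topology and Haar measure *)

Section PadicTopology.
Context {p : nat} {pp : prime p} {d : nat}.
Local Notation Zp := (padic_int pp).
Local Notation Zpd := 'rV[Zp]_d.

Definition res_filter (x : Zp) : set_system Zp :=
  [set A | exists n, forall y : Zp, y n = x n -> A y].

Lemma res_filter_filter x : Filter (res_filter x).
Proof.
split=> [|A B [n An] [m Bm]|A B AB [n An]]; first by exists 0%N.
- exists (maxn n m) => y yx; split; [apply: An|apply: Bm].
    by rewrite (res_le y (leq_maxl n m)) yx -res_le ?leq_maxl.
  by rewrite (res_le y (leq_maxr n m)) yx -res_le ?leq_maxr.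
- by exists n => y /An /AB.
Qed.

(** Along the filter of congruence balls all residues converge to those of x, so the balls enter
    every open set; conversely a ball is the preimage of a point under a continuous map to the
    discrete space nat. *)
Lemma zp_nbhsP (x : Zp) (A : set Zp) :
  nbhs x A <-> exists n, forall y : Zp, y n = x n -> A y.
Proof.
have FF := res_filter_filter x.
split=> [|[n An]].
  rewrite nbhsE => -[B [[C Cop CB] Bx] BA].
  suff : ((@res p pp : Zp -> {ptws nat -> nat}) @ res_filter x) C.
    by move=> [n Cn]; exists n => y /Cn Cy; apply: BA; rewrite -CB.
  have /pointwise_cvgP h : forall t, (fun g => g t) @
      ((@res p pp : Zp -> {ptws nat -> nat}) @ res_filter x) --> res x t.
    move=> t U /nbhs_singleton Ux /=; exists t => y yx /=.
    by rewrite -yx in Ux.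
  apply: h; apply: open_nbhs_nbhs; split=> //.
  by move: Bx; rewrite -CB.
apply: (@filterS _ (nbhs x) _ [set y : Zp | y n = x n]) => [y /An //|].
have : nbhs ((@res p pp : Zp -> {ptws nat -> nat}) x) [set f | f n = x n].
  have /(_ [set x n]) := @proj_continuous nat (fun=> nat) n (res x).
  by apply; apply/discrete_set1.
exact: (@initial_continuous Zp {ptws nat -> nat} (@res p pp) x).
Qed.

Lemma zpd_nbhsP (x : Zpd) (A : set Zpd) :
  nbhs x A <-> exists n, forall y : Zpd, Zpd_ideal n%:Z (y - x) -> A y.
Proof.
split=> [[P xP PA]|[n An]].
  have /choice[N NP] : forall j, exists n, forall y : Zp,
      y n = x 0 j n -> P 0 j y by move=> j; apply/zp_nbhsP.
  exists (\max_j N j)%N => y /Zpd_ideal_sub yx; apply: PA => i j.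
  rewrite ord1; apply: NP.
  by rewrite (@res_le _ _ _ (N j) (\max_j N j)%N) ?yx -?res_le ?leq_bigmax.
exists (fun _ j => [set y : Zp | y n = x 0 j n]).
  by move=> i j; rewrite ord1; apply/zp_nbhsP; exists n.
by move=> y /= yx; apply: An; apply/Zpd_ideal_sub => j; exact: yx.
Qed.

Definition heis_cong n (g h : heis pp d) :=
  [/\ Zpd_ideal n%:Z (h.1.1 - g.1.1), Zpd_ideal n%:Z (h.1.2 - g.1.2)
    & h.2 n = g.2 n].

Lemma Zpd_ideal_le n m (x : Zpd) : (n <= m)%N ->
  Zpd_ideal m%:Z x -> Zpd_ideal n%:Z x.
Proof.
move=> nm /Zpd_idealP xm; apply/Zpd_idealP => j.
by rewrite (res_le _ nm) xm mod0n.
Qed.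

Lemma heis_cong_le n m g h : (n <= m)%N -> heis_cong m g h -> heis_cong n g h.
Proof.
move=> nm [xm ym zm]; split; [exact: Zpd_ideal_le xm|exact: Zpd_ideal_le ym|].
by rewrite (res_le _ nm) zm -res_le.
Qed.

Lemma heis_nbhsP (g : heis pp d) (A : set (heis pp d)) :
  nbhs g A <-> exists n, forall h, heis_cong n g h -> A h.
Proof.
case: g => [[x y] z]; split.
  move=> [[P Q] [/= [[P1 P2] [/= /zpd_nbhsP[n1 P1n] /zpd_nbhsP[n2 P2n]] P12]
    /zp_nbhsP[n3 Qn]] PQA].
  exists (maxn (maxn n1 n2) n3) => -[[x' y'] z'] hc.
  apply: (PQA (x', y', z')); split=> /=.
    apply: (P12 (x', y')); split=> /=.
      by apply: P1n; case: (heis_cong_le (n := n1) _ hc); first lia.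
    by apply: P2n; case: (heis_cong_le (n := n2) _ hc); first lia.
  by apply: Qn; case: (heis_cong_le (n := n3) _ hc); first lia.
move=> [n An].
exists ([set w : Zpd * Zpd | Zpd_ideal n%:Z (w.1 - x) /\
    Zpd_ideal n%:Z (w.2 - y)], [set z' : Zp | z' n = z n]); last first.
  by move=> [[x' y'] z'] [/= [hx hy] hz]; apply: An.
split=> /=; last by apply/zp_nbhsP; exists n.
exists ([set w : Zpd | Zpd_ideal n%:Z (w - x)],
    [set w : Zpd | Zpd_ideal n%:Z (w - y)]) => //.
by split=> /=; apply/zpd_nbhsP; exists n.
Qed.

(** Periodic maps are locally constant, so any preimage is open; with values in Prop this also
    covers cosets. *)
Lemma mod_periodic_open (T : Type) m (f : Zpd -> T) (Y : set T) :
  mod_periodic m f -> open (f @^-1` Y).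
Proof.
move=> fP; rewrite openE => x Yx; apply/zpd_nbhsP; exists m => y yx.
by rewrite /preimage /= (mod_periodic_eq fP yx).
Qed.

End PadicTopology.

Section HaarMeasure.
Context {R : realType} {p : nat} {pp : prime p} {d : nat}.
Local Notation Zp := (padic_int pp).
Local Notation Zpd := 'rV[Zp]_d.
Variables (mu : probability (borel_Zpd pp d) R).
Hypothesis mu_haar : translation_invariant mu.

Lemma open_borel_measurable (A : set (borel_Zpd pp d)) :
  open (A : set Zpd) -> measurable A.
Proof. by move=> oA; apply: sub_sigma_algebra. Qed.

Lemma mod_periodic_measurable (d' : measure_display) (T : measurableType d') m
  (f : Zpd -> T) : mod_periodic m f ->
  measurable_fun [set: borel_Zpd pp d] (f : borel_Zpd pp d -> T).
Proof.
move=> fP _ Y _; rewrite setTI; apply: open_borel_measurable.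
exact: (mod_periodic_open fP).
Qed.

Lemma mod_periodic_coset m (h : Zpd) :
  mod_periodic m (fun u => Zpd_coset h m%:Z u).
Proof.
move=> u w wI /=; apply/propext; rewrite !Zpd_cosetP; split.
  by move=> uh; rewrite -[u](addrK w) addrAC; apply: Zpd_idealD => //;
    exact: Zpd_idealN.
by move=> uh; rewrite addrAC; apply: Zpd_idealD.
Qed.

Lemma coset_measurable m (h : Zpd) :
  measurable (Zpd_coset h m%:Z : set (borel_Zpd pp d)).
Proof.
have -> : Zpd_coset h m%:Z = (fun u => Zpd_coset h m%:Z u) @^-1` [set True].
  by rewrite predeqE => u; split=> [hu|/= -> //]; apply/propext; split.
apply: open_borel_measurable.
exact: (@mod_periodic_open _ _ _ _ _ _ [set True] (@mod_periodic_coset m h)).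
Qed.

Lemma mod_periodic_expand (V : pzRingType) m (F : Zpd -> V) (u : Zpd) :
  mod_periodic m F ->
  F u = \sum_(e : residue p d m)
          F (residue_rep e) * \1_(Zpd_coset (residue_rep e) m%:Z) u.
Proof.
move=> FP; rewrite (bigD1 (residue_of m u)) //= big1 ?addr0.
  have uC : Zpd_coset (residue_rep (residue_of m u)) m%:Z u.
    by apply/Zpd_cosetP; apply/Zpd_idealC; apply: residue_rep_of.
  by rewrite indicE mem_set // mulr1 mod_periodic_rep.
move=> e eu; rewrite indicE memNset ?mulr0 // => /Zpd_cosetP /residue_of_eq E.
by move: eu; rewrite E residue_repK eqxx.
Qed.

Lemma integral_mod_periodic m (F : Zpd -> R) : mod_periodic m F ->
  (\int[mu]_u (F u)%:E)%E =
  ((\sum_(e : residue p d m) F (residue_rep e)) / (#|{: residue p d m}|)%:R)%:E.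
Proof.
(* By invariance all cosets have the same mass. It stays unknown here and is found afterwards by
   taking G = 1. *)
have key (G : Zpd -> R) : mod_periodic m G -> (\int[mu]_u (G u)%:E)%E =
    ((\sum_(e : residue p d m) G (residue_rep e)) *
     fine (mu (Zpd_ideal m%:Z)))%:E.
  move=> GP; pose ind e (u : borel_Zpd pp d) : R :=
    \1_(Zpd_coset (@residue_rep p pp d m e) m%:Z) u.
  transitivity (\int[mu]_u (\sum_(e : residue p d m)
      (G (residue_rep e))%:E * (ind e u)%:E))%E.
    apply: eq_integral => u _; rewrite [in LHS](mod_periodic_expand u GP).
    by rewrite -sumEFin; apply: eq_bigr => e _; rewrite EFinM.
  have iint e : mu.-integrable setT (fun u => (ind e u)%:E).
    exact: integrable_indic (coset_measurable _ _).
  rewrite integral_sum //; last by move=> e; exact: integrableZl.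
  rewrite mulr_suml -sumEFin; apply: eq_bigr => e _.
  rewrite integralZl // EFinM; congr (_ * _)%E.
  rewrite integral_indic ?setIT //; last exact: coset_measurable.
  have I0 : Zpd_ideal m%:Z = Zpd_coset 0 m%:Z :> set Zpd.
    by rewrite predeqE => u; rewrite Zpd_cosetP subr0.
  rewrite fineK.
    by apply: mu_haar; rewrite I0; exact: coset_measurable.
  by rewrite I0 fin_num_measure //; exact: coset_measurable.
have := key (fun=> 1) (fun _ _ _ => erefl).
have -> : (\int[mu]_u (1 : R)%:E = 1)%E.
  by rewrite integral_cst // mul1e; exact: probability_setT.
rewrite sumr_const => -[].
rewrite -[_ *+ _]mulr_natr mul1r => E FP; rewrite key //; congr (_ * _)%:E.
have NN : (#|{: residue p d m}|)%:R != 0 :> R.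
  by rewrite pnatr_eq0 -lt0n card_residue_gt0.
by apply: (mulfI NN); rewrite divff.
Qed.

End HaarMeasure.

(** * The model representations *)

Section Subspaces.
Context {R : realType} {V : lmodType R[i]} (W : set V).
Hypothesis W_sub : linear_subspace W.

Lemma subspaceD u v : W u -> W v -> W (u + v).
Proof. by move=> Wu Wv; have := W_sub.2 1 u v Wu Wv; rewrite scale1r. Qed.

Lemma subspaceZ a u : W u -> W (a *: u).
Proof. by move=> Wu; have := W_sub.2 a u 0 Wu W_sub.1; rewrite addr0. Qed.

Lemma subspaceB u v : W u -> W v -> W (u - v).
Proof.
by move=> Wu Wv; apply: subspaceD => //; rewrite -scaleN1r;
  exact: subspaceZ.
Qed.

Lemma subspace_sum (I : Type) (s : seq I) (P : pred I) (f : I -> V) :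
  (forall i, P i -> W (f i)) -> W (\sum_(i <- s | P i) f i).
Proof.
by move=> Wf; apply: (big_ind W) => //; [exact: W_sub.1|exact: subspaceD].
Qed.

Lemma lin_span_sub (S : set V) : S `<=` W -> lin_span S `<=` W.
Proof.
move=> SW v [n [c [w [Sw ->]]]]; apply: subspace_sum => i _.
by apply/subspaceZ/SW.
Qed.

End Subspaces.

Lemma lin_span_subspace (R : realType) (V : lmodType R[i]) (S : set V) :
  linear_subspace (lin_span S).
Proof.
split=> [|a u v [n [c [w [Sw ->]]]] [n' [c' [w' [Sw' ->]]]]].
  by exists 0%N, (fun=> 0), (fun=> 0); rewrite big_ord0; split=> // -[].
exists (n + n')%N,
  (fun i => match fintype.split i with inl j => a * c j | inr j => c' j end),
  (fun i => match fintype.split i with inl j => w j | inr j => w' j end); split.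
  by move=> i; case: (fintype.split i).
rewrite big_split_ord /= scaler_sumr; congr (_ + _); apply: eq_bigr => i _.
  by rewrite -/(unsplit (inl i)) unsplitK scalerA.
by rewrite -/(unsplit (inr i)) unsplitK.
Qed.

Section Model.
Context {R : realType} {p : nat} {pp : prime p} {d : nat}.
Local Notation Zp := (padic_int pp).
Local Notation Qp := (padic pp).
Local Notation Zpd := 'rV[Zp]_d.
Local Notation Qpd := 'rV[Qp]_d.
Variables (mu : probability (borel_Zpd pp d) R).
Hypothesis mu_haar : translation_invariant mu.
Variables (xi eta : Qpd) (lambda : Qp) (m : nat) (a : Zp).
Hypothesis a_unit : a \is a GRing.unit.
Hypothesis lambdaE : lambda = a%:F / p%:R ^+ m.

Local Notation rho := (heis_rep mu (xi, eta, lambda)).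
Local Notation fctT := (Zpd -> R[i]^o).
Local Notation N := ((#|{: residue p d m}|)%:R : R[i]).
Local Notation rep := (@residue_rep p pp d m).
Implicit Types (f g : fctT) (h u x y w : Zpd) (z : Zp).

Lemma lambda_val : padic_val lambda = - m%:Z.
Proof. by rewrite lambdaE mulrC exprnN padic_val_eq. Qed.

Lemma lambda_norm : padic_norm R lambda = (p ^ m)%N%:R.
Proof.
rewrite /padic_norm lambda_val opprK natrX ifF //.
by rewrite lambdaE mulf_eq0 (negPf (tofrac_unit_neq0 a_unit)) invr_eq0
  (negPf (qp_expp_neq0 _)).
Qed.

Definition phi_scale : R := (padic_norm R lambda) `^ (d%:R / 2).

Lemma phi_scale_gt0 : 0 < phi_scale.
Proof. by rewrite powR_gt0 // lambda_norm ltr0n expp_gt0. Qed.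

Lemma phi_scale_neq0 : phi_scale%:C%C != 0 :> R[i].
Proof. by rewrite eq_complex /= eqxx andbT gt_eqF // phi_scale_gt0. Qed.

(** A coset has mass 1/N with N the number of classes, so this makes each [phi] a unit vector. *)
Lemma phi_scale_sqr : phi_scale ^+ 2 = (#|{: residue p d m}|)%:R.
Proof.
rewrite /phi_scale lambda_norm -powR_mulrn ?powR_ge0 // -powRrM divfK //.
by rewrite powR_mulrn // card_residue [in RHS]natrX.
Qed.

Lemma phi_scale_sqrC : phi_scale%:C%C * phi_scale%:C%C = N.
Proof. by rewrite -rmorphM -expr2 phi_scale_sqr rmorph_nat. Qed.

Lemma N_neq0 : N != 0.
Proof. by rewrite pnatr_eq0 -lt0n card_residue_gt0. Qed.

Lemma phiE h u :
  phi R lambda h u = phi_scale%:C%C * \1_(Zpd_coset h m%:Z) u.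
Proof. by rewrite /phi lambda_val opprK. Qed.

Lemma phi_periodic h : mod_periodic m (phi R lambda h).
Proof.
move=> u w wI; rewrite !phiE !indicE.
have /= := @mod_periodic_coset p pp d m h u w wI.
by rewrite /in_mem /= /in_set => ->.
Qed.

Lemma phi_expand f : mod_periodic m f ->
  f = \sum_(e : residue p d m)
        (f (rep e) / phi_scale%:C%C) *: phi R lambda (rep e).
Proof.
move=> fP; apply/funext => u; rewrite fct_sumE [LHS](mod_periodic_expand u fP).
apply: eq_bigr => e _.
change (f (rep e) * \1_(Zpd_coset (rep e) m%:Z) u =
  f (rep e) / phi_scale%:C%C * phi R lambda (rep e) u).
by rewrite phiE mulrA divfK ?phi_scale_neq0.
Qed.

Lemma phi_rep (e e' : residue p d m) :
  phi R lambda (rep e) (rep e') = if e == e' then phi_scale%:C%C else 0.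
Proof.
rewrite phiE indicE; case: eqVneq => [->|ee'].
  by rewrite mem_set ?mulr1 //; apply/Zpd_cosetP; rewrite subrr;
    exact: Zpd_ideal0.
rewrite memNset ?mulr0 // => /Zpd_cosetP/residue_of_eq.
by rewrite !residue_repK => /esym/eqP; rewrite (negPf ee').
Qed.

(** Turns membership in a span into periodicity, the only form in which the model space is used in
    computations. *)
Lemma Hspace_periodic f : Hspace R d lambda f <-> mod_periodic m f.
Proof.
split=> [|/phi_expand ->].
  move=> [n [c [w [Hw ->]]]] u v vI; rewrite !fct_sumE; apply: eq_bigr => i _.
  have [h _ <-] := Hw i.
  by change (c i * phi R lambda h (u + v) = c i * phi R lambda h u);
    rewrite phi_periodic.
apply: subspace_sum; first exact: lin_span_subspace.
move=> e _; apply: subspaceZ; first exact: lin_span_subspace.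
exists 1%N, (fun=> 1), (fun=> phi R lambda (rep e)).
by rewrite big_ord1 scale1r; split=> // _; exists (rep e).
Qed.

Lemma Re_sum (I : Type) (s : seq I) (F : I -> R[i]) :
  complex.Re (\sum_(i <- s) F i) = \sum_(i <- s) complex.Re (F i).
Proof. by apply: (big_morph _ (id1 := 0)) => // -[? ?] [? ?]. Qed.

Lemma Im_sum (I : Type) (s : seq I) (F : I -> R[i]) :
  complex.Im (\sum_(i <- s) F i) = \sum_(i <- s) complex.Im (F i).
Proof. by apply: (big_morph _ (id1 := 0)) => // -[? ?] [? ?]. Qed.

Lemma cintegral_periodic (f : Zpd -> R[i]) : mod_periodic m f ->
  cintegral mu f = (\sum_(e : residue p d m) f (rep e)) / N.
Proof.
move=> fP; rewrite /cintegral /Rintegral.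
rewrite !(integral_mod_periodic mu_haar (m := m)) /=; last 2 first.
- by move=> u w wI; rewrite fP.
- by move=> u w wI; rewrite fP.
rewrite -Re_sum -Im_sum -(rmorph_nat (real_complex R)) -fmorphV /=.
by case: (\sum_e _) => ? ? ; apply/eqP; rewrite eq_complex /= !mulr0 subr0 add0r
  !eqxx.
Qed.

Lemma L2_dot_periodic f g : mod_periodic m f -> mod_periodic m g ->
  L2_dot mu f g = (\sum_(e : residue p d m) f (rep e) * (g (rep e))^*) / N.
Proof.
by move=> fP gP; rewrite /L2_dot cintegral_periodic // => u w wI;
  rewrite fP ?gP.
Qed.

End Model.

Lemma mulc_conj (R : rcfType) (z : R[i]) :
  z * z^* = (complex.Re z ^+ 2 + complex.Im z ^+ 2)%:C%C.
Proof.
case: z => x y; apply/eqP; rewrite eq_complex /=; apply/andP; split; apply/eqP.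
  by rewrite mulrN opprK -!expr2.
by rewrite mulrN mulrC addNr.
Qed.

Lemma cauchy_seq_cvg (R : realType) (u : nat -> R) :
  (forall e : R, 0 < e -> exists N, forall m n, (N <= m)%N -> (N <= n)%N ->
     `|u m - u n| < e) -> cvg (u @ \oo).
Proof.
move=> uC; apply/cauchy_cvgP/cauchy_exP => e /uC[N uN].
by exists (u N), N => // n /= Nn; apply: uN.
Qed.

Lemma cvg0_sum (R : realType) (I : Type) (s : seq I) (f : I -> nat -> R) :
  (forall i, f i n @[n --> \oo] --> (0 : R)) ->
  (\sum_(i <- s) f i n) @[n --> \oo] --> (0 : R).
Proof.
move=> f0; elim: s => [|i s IH].
  by under eq_fun do rewrite big_nil; exact: cvg_cst.
under eq_fun do rewrite big_cons.
by have := cvgD (f0 i) IH; rewrite addr0; apply.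
Qed.

Lemma hnorm_ge0 (R : realType) p (pp : prime p) d (r : prerep R pp d)
  (v : ambient r) : 0 <= hnorm v.
Proof. exact: sqrtr_ge0. Qed.

Section ModelRep.
Context {R : realType} {p : nat} {pp : prime p} {d : nat}.
Local Notation Zp := (padic_int pp).
Local Notation Qp := (padic pp).
Local Notation Zpd := 'rV[Zp]_d.
Local Notation Qpd := 'rV[Qp]_d.
Variables (mu : probability (borel_Zpd pp d) R).
Hypothesis mu_haar : translation_invariant mu.
Variables (xi eta : Qpd) (lambda : Qp) (m : nat) (a : Zp).
Hypothesis a_unit : a \is a GRing.unit.
Hypothesis lambdaE : lambda = a%:F / p%:R ^+ m.

Local Notation rho := (heis_rep mu (xi, eta, lambda)).
Local Notation fctT := (Zpd -> R[i]^o).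
Local Notation N := ((#|{: residue p d m}|)%:R : R[i]).
Local Notation rep := (@residue_rep p pp d m).
Implicit Types (f g : fctT) (h u x y w : Zpd) (z : Zp).

Let HP f : Hspace R d lambda f <-> mod_periodic m f.
Proof. exact: Hspace_periodic a_unit lambdaE f. Qed.

Let NR_gt0 : 0 < (#|{: residue p d m}|)%:R :> R.
Proof. by rewrite ltr0n card_residue_gt0. Qed.

Definition heis_phase (x y : Zpd) (z : Zp) u : R[i] :=
  padic_exp R (dotv xi (to_Qpd x) + dotv eta (to_Qpd y)
               + lambda * (z + dotv u y)%:F).

Lemma heis_phase_periodic x y z : mod_periodic m (heis_phase x y z).
Proof.
move=> u w wI; rewrite /heis_phase dotv_addl addrA tofracD mulrDr addrA.
by rewrite [LHS]padic_expD lambdaE padic_exp_ideal ?mulr1 ?dotv_ideal.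
Qed.

Lemma heis_phase_conj x y z u : heis_phase x y z u * (heis_phase x y z u)^* = 1.
Proof. by rewrite padic_exp_conj mulrC padic_expN_mul. Qed.

Lemma heis_rep_actE x y z f u :
  @act _ _ _ _ rho (x, y, z) f u = heis_phase x y z u * f (u + x).
Proof. by []. Qed.

Lemma heis_act_periodic (s : heis pp d) f : mod_periodic m f ->
  mod_periodic m (@act _ _ _ _ rho s f).
Proof.
case: s => [[x y] z] fP u w wI; rewrite !heis_rep_actE heis_phase_periodic //.
by rewrite addrAC (fP (u + x)).
Qed.

Lemma L2_dotE f g : mod_periodic m f -> mod_periodic m g ->
  @dot _ _ _ _ rho f g = (\sum_(e : residue p d m) f (rep e) * (g (rep e))^*) /
    N.
Proof. exact: L2_dot_periodic. Qed.

Lemma Hspace_subspace : linear_subspace (Hspace R d lambda).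
Proof. exact: lin_span_subspace. Qed.

Lemma L2_dot_self f : mod_periodic m f ->
  @dot _ _ _ _ rho f f = ((\sum_(e : residue p d m)
    (complex.Re (f (rep e)) ^+ 2 + complex.Im (f (rep e)) ^+ 2)) /
      (#|{: residue p d m}|)%:R)%:C%C.
Proof.
move=> fP; rewrite L2_dotE // rmorphM /= fmorphV /= rmorph_nat rmorph_sum /=.
by congr (_ / _); apply: eq_bigr => e _; rewrite mulc_conj.
Qed.

Lemma L2_dot_inner : is_inner_product rho.
Proof.
split=> [c f g h /HP fP /HP gP /HP hP|f g /HP fP /HP gP|f /HP fP f0].
- rewrite !L2_dotE //; last first.
    by move=> u w wI; change (c * f (u + w) + g (u + w) = c * f u + g u);
      rewrite fP ?gP.
  rewrite mulrA -mulrDl; congr (_ / _); rewrite mulr_sumr -big_split /=.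
  apply: eq_bigr => e _.
  change ((c * f (rep e) + g (rep e)) * (h (rep e))^* =
    c * (f (rep e) * (h (rep e))^*) + g (rep e) * (h (rep e))^*).
  by rewrite mulrDl mulrA.
- rewrite !L2_dotE // rmorphM /= fmorphV /= rmorph_nat rmorph_sum /=.
  by congr (_ / _); apply: eq_bigr => e _; rewrite rmorphM /= conjCK mulrC.
rewrite L2_dot_self // ltcR divr_gt0 // lt_def sumr_ge0 ?andbT => [|e _];
  last first.
  by rewrite addr_ge0 // sqr_ge0.
apply: contra f0; rewrite psumr_eq0 => [/allP s0|e _]; last first.
  by rewrite addr_ge0 // sqr_ge0.
apply/eqP/funext => u; rewrite -(mod_periodic_rep u fP).
have := s0 (residue_of m u) (mem_index_enum _).
rewrite /= paddr_eq0 ?sqr_ge0 // !sqrf_eq0 => /andP[/eqP fR /eqP fI].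
by apply/eqP; rewrite eq_complex fR fI /= !eqxx.
Qed.

Lemma hnorm_model f : mod_periodic m f -> hnorm (f : ambient rho) = Num.sqrt
  ((\sum_(e : residue p d m)
    (complex.Re (f (rep e)) ^+ 2 + complex.Im (f (rep e)) ^+ 2)) /
      (#|{: residue p d m}|)%:R).
Proof. by move=> fP; rewrite /hnorm L2_dot_self. Qed.

(** The square root of N undoes the averaging in the norm. This bound passes the Cauchy property on
    to single values. *)
Lemma hnorm_model_ge f e : mod_periodic m f ->
  `|complex.Re (f (rep e))| <=
    Num.sqrt (#|{: residue p d m}|)%:R * hnorm (f : ambient rho) /\
  `|complex.Im (f (rep e))| <=
    Num.sqrt (#|{: residue p d m}|)%:R * hnorm (f : ambient rho).
Proof.
move=> fP; rewrite hnorm_model // -sqrtrM ?ler0n // mulrC divfK ?gt_eqF //.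
have le : complex.Re (f (rep e)) ^+ 2 + complex.Im (f (rep e)) ^+ 2 <=
    \sum_(e : residue p d m)
      (complex.Re (f (rep e)) ^+ 2 + complex.Im (f (rep e)) ^+ 2).
  rewrite (bigD1 e) //= lerDl sumr_ge0 // => e' _.
  by rewrite addr_ge0 // sqr_ge0.
rewrite -!sqrtr_sqr !ler_wsqrtr // (le_trans _ le) // ?lerDl ?lerDr sqr_ge0 //.
Qed.

(** Finitely many values determine a periodic function, so real and imaginary parts at the
    representatives converge separately. *)
Lemma model_complete : is_complete rho.
Proof.
move=> s sH sC.
have sP n : mod_periodic m (s n) by apply/HP; exact: sH.
have sBP i j : mod_periodic m (s i - s j).
  by apply/HP; apply: (subspaceB Hspace_subspace); exact: sH.
have cauchy (pr : R[i] -> R) e :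
    (forall f, mod_periodic m f -> `|pr (f (rep e))| <=
      Num.sqrt (#|{: residue p d m}|)%:R * hnorm (f : ambient rho)) ->
    (forall z1 z2 : R[i], pr (z1 - z2) = pr z1 - pr z2) ->
    cvg ((fun n => pr (s n (rep e))) @ \oo).
  move=> prle prB; apply: cauchy_seq_cvg => eps eps0.
  have q0 : 0 < Num.sqrt (#|{: residue p d m}|)%:R :> R by rewrite sqrtr_gt0.
  have [M MP] := sC (eps / Num.sqrt (#|{: residue p d m}|)%:R)
    (divr_gt0 eps0 q0).
  exists M => i j Mi Mj; rewrite -prB.
  apply: le_lt_trans (prle _ (sBP i j)) _.
  by rewrite mulrC -ltr_pdivlMr //; apply: MP.
have cR e : cvg ((fun n => complex.Re (s n (rep e))) @ \oo).
  apply: (cauchy (@complex.Re R) e) => [f fP|[? ?] [? ?] //].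
  by have [] := hnorm_model_ge e fP.
have cI e : cvg ((fun n => complex.Im (s n (rep e))) @ \oo).
  apply: (cauchy (@complex.Im R) e) => [f fP|[? ?] [? ?] //].
  by have [] := hnorm_model_ge e fP.
(* Limits are taken at the representatives only and extended by periodicity. *)
pose l : fctT := fun u =>
  (limn (fun n => complex.Re (s n (rep (residue_of m u)))) +i*
   limn (fun n => complex.Im (s n (rep (residue_of m u)))))%C.
have lP : mod_periodic m l.
  move=> u w wI; rewrite /l (_ : residue_of m (u + w) = residue_of m u) //.
  by apply/residue_of_eq; rewrite addrC addKr.
exists l; first exact/HP.
have slP n : mod_periodic m (s n - l).
  by apply/HP; apply: (subspaceB Hspace_subspace); [exact: sH|exact/HP].
rewrite /hcvg; under eq_fun do rewrite hnorm_model //.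
pose A n := (\sum_(e : residue p d m)
  (complex.Re ((s n - l) (rep e)) ^+ 2 + complex.Im ((s n - l) (rep e)) ^+ 2)) /
    (#|{: residue p d m}|)%:R.
have RI n e : complex.Re ((s n - l) (rep e)) = complex.Re (s n (rep e)) -
      limn (fun n => complex.Re (s n (rep e))) /\
    complex.Im ((s n - l) (rep e)) = complex.Im (s n (rep e)) -
      limn (fun n => complex.Im (s n (rep e))).
  change ((s n - l) (rep e)) with (s n (rep e) - l (rep e)).
  by rewrite /l residue_repK; case: (s n (rep e)) => ? ?; split.
have sq (u : nat -> R) : cvg (u @ \oo) ->
    (u n - limn u) ^+ 2 @[n --> \oo] --> (0 : R).
  move=> uL; have uL0 : (u n - limn u) @[n --> \oo] --> (0 : R).
    by have := cvgB uL (cvg_cst (limn u)); rewrite subrr; apply.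
  by have := cvgM uL0 uL0; rewrite mulr0; apply.
have A0 : A n @[n --> \oo] --> (0 : R).
  have S0 : (\sum_(e : residue p d m) (complex.Re ((s n - l) (rep e)) ^+ 2 +
      complex.Im ((s n - l) (rep e)) ^+ 2)) @[n --> \oo] --> (0 : R).
    apply: cvg0_sum => e.
    under eq_fun do rewrite (RI _ _).1 (RI _ _).2.
    by have := cvgD (sq _ (cR e)) (sq _ (cI e)); rewrite addr0; apply.
  have := cvgM S0 (cvg_cst ((#|{: residue p d m}|)%:R^-1 : R)).
  by rewrite mul0r; apply.
apply/cvgr0Pnorm_lt => eps eps0.
have /cvgr0Pnorm_lt/(_ (eps ^+ 2)) := A0.
rewrite exprn_gt0 // => /(_ isT); apply: filterS => n An.
rewrite -/(A n) ger0_norm ?sqrtr_ge0 // -(ger0_norm (ltW eps0)) -sqrtr_sqr.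
rewrite ltr_sqrt ?exprn_gt0 //.
exact: le_lt_trans (ler_norm _) An.
Qed.

Lemma model_unitary : is_unitary_action rho.
Proof.
split=> [g f /HP fP|g c f f' _ _|f _|g g' f _|g f f' /HP fP /HP f'P].
- exact/HP/heis_act_periodic.
- case: g => [[x y] z]; apply/funext => u.
  change (heis_phase x y z u * (c * f (u + x) + f' (u + x)) =
    c * (heis_phase x y z u * f (u + x)) + heis_phase x y z u * f' (u + x)).
  by rewrite mulrDr mulrCA.
- apply/funext => u; rewrite [LHS]heis_rep_actE addr0 /heis_phase.
  by rewrite to_Qpd0 !dotv0r addr0 !add0r tofrac0 mulr0 padic_exp0 mul1r.
- case: g g' => [[x y] z] [[x' y'] z']; apply/funext => u.
  rewrite (heis_rep_actE x y z) (heis_rep_actE x' y' z').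
  rewrite [LHS]heis_rep_actE mulrA addrA; congr (_ * _).
  (* The inner phase is evaluated at u + x; the resulting x . y' is the twist of the group law. *)
  rewrite /heis_phase -padic_expD !to_QpdD !dotv_addr dotv_addl.
  by congr padic_exp; rewrite !tofracD; ring.
case: g => [[x y] z].
rewrite (L2_dotE fP f'P).
rewrite (L2_dotE (heis_act_periodic (x, y, z) fP) (heis_act_periodic _ f'P)).
congr (_ / _).
(* Unitarity is invariance of the mean under u |-> u + x, once the phases of modulus one cancel. *)
rewrite -[RHS](sum_residue_shift (m := m) x (f := fun u => f u * (f' u)^*)).
  apply: eq_bigr => e _; rewrite !heis_rep_actE rmorphM /= mulrACA.
  by rewrite heis_phase_conj mul1r.
by move=> u w wI; rewrite fP ?f'P.
Qed.

End ModelRep.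

Section ExpVectors.
Context {R : realType} {p : nat} {pp : prime p} {d : nat}.
Local Notation Zp := (padic_int pp).
Local Notation Qp := (padic pp).
Local Notation Zpd := 'rV[Zp]_d.
Local Notation Qpd := 'rV[Qp]_d.

Lemma padic_exp_sum (I : Type) (s : seq I) (u : I -> Qp) :
  padic_exp R (\sum_(i <- s) u i) = \prod_(i <- s) padic_exp R (u i).
Proof. exact: (big_morph _ padic_expD padic_exp0). Qed.

Lemma padic_exp_dotvD (kappa x y : Qpd) : padic_exp R (dotv kappa (x + y)) =
  padic_exp R (dotv kappa x) * padic_exp R (dotv kappa y).
Proof. by rewrite dotv_addr padic_expD. Qed.

Lemma padic_exp_dotvN (kappa x : Qpd) :
  padic_exp R (dotv kappa (- x)) = padic_exp R (- dotv kappa x).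
Proof. by rewrite dotv_oppr. Qed.

Lemma padic_exp_affine (k l x x' y y' : Qpd) (t z z' : Qp) :
  padic_exp R (dotv k (x + x') + dotv l (y + y') + t * (z + z')) =
  padic_exp R (dotv k x) * padic_exp R (dotv l y) * padic_exp R (t * z) *
  padic_exp R (dotv k x' + dotv l y' + t * z').
Proof.
rewrite !dotv_addr mulrDr -!padic_expD.
apply: congr1; ring.
Qed.

(** The level is the largest exponent among the denominators of the coordinates. *)
Lemma padic_exp_vec_trivial (kappa : Qpd) : exists n, forall w : Zpd,
  Zpd_ideal n%:Z w -> padic_exp R (dotv kappa (to_Qpd w)) = 1.
Proof.
have /choice[N /choice[b bE]] : forall j, exists n, exists b : Zp,
    kappa 0 j = b%:F / p%:R ^+ n by move=> j; exact: qp_form.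
exists (\max_j N j)%N => w wI; rewrite padic_exp_sum big1 // => j _.
rewrite mxE bE padic_exp_ideal //.
have /Zpd_idealP := @Zpd_ideal_le _ _ _ (N j) _ w (leq_bigmax j) wI.
exact.
Qed.

End ExpVectors.

(** * Continuity and irreducibility of the models *)

Section ModelIrreducible.
Context {R : realType} {p : nat} {pp : prime p} {d : nat}.
Local Notation Zp := (padic_int pp).
Local Notation Qp := (padic pp).
Local Notation Zpd := 'rV[Zp]_d.
Local Notation Qpd := 'rV[Qp]_d.
Variables (mu : probability (borel_Zpd pp d) R).
Hypothesis mu_haar : translation_invariant mu.
Variables (xi eta : Qpd) (lambda : Qp) (m : nat) (a : Zp).
Hypothesis a_unit : a \is a GRing.unit.
Hypothesis lambdaE : lambda = a%:F / p%:R ^+ m.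

Local Notation rho := (heis_rep mu (xi, eta, lambda)).
Local Notation fctT := (Zpd -> R[i]^o).
Local Notation N := ((#|{: residue p d m}|)%:R : R[i]).
Local Notation rep := (@residue_rep p pp d m).
Local Notation phase := (@heis_phase R p pp d xi eta lambda).
Local Notation c := ((phi_scale (R := R) (d := d) lambda)%:C%C).
Implicit Types (f g : fctT) (h u x y w : Zpd) (z : Zp).

Let HP f : Hspace R d lambda f <-> mod_periodic m f.
Proof. exact: Hspace_periodic a_unit lambdaE f. Qed.

Let c_neq0 : c != 0 := phi_scale_neq0 a_unit lambdaE.

(** The level is uniform in u: the dependence on u is through lambda u . y, which only sees y modulo
    p^m. *)
Lemma heis_phase_locally_const x y z : exists n, forall x' y' z' u,
  heis_cong n (x, y, z) (x', y', z') -> phase x' y' z' u = phase x y z u.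
Proof.
have [n1 xi1] := @padic_exp_vec_trivial R _ _ _ xi.
have [n2 eta1] := @padic_exp_vec_trivial R _ _ _ eta.
exists (maxn m (maxn n1 n2)) => x' y' z' u hc.
have [/= _ yI zm] := heis_cong_le (leq_maxl m (maxn n1 n2)) hc.
have [/= xI1 _ _] : heis_cong n1 (x, y, z) (x', y', z').
  by apply: heis_cong_le hc; lia.
have [/= _ yI2 _] : heis_cong n2 (x, y, z) (x', y', z').
  by apply: heis_cong_le hc; lia.
have {}zm : (z' - z) m = 0%N by apply/eqP; rewrite res_sub_eq0 zm.
rewrite /heis_phase -[x'](subrK x) -[y'](subrK y) -[z'](subrK z).
move: (x' - x) (y' - y) (z' - z) yI xI1 yI2 zm {hc} => x1 y1 z1 yI xI1 yI2 zm.
have zE : z1 + z + dotv u (y1 + y) = (z1 + dotv u y1) + (z + dotv u y).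
  by rewrite dotv_addr; ring.
rewrite !to_QpdD zE tofracD; apply: etrans (padic_exp_affine _ _ _ _ _ _ _ _ _)
  _.
have z1y1 : (z1 + dotv u y1) m = 0%N.
  by rewrite resD zm add0n dotv_comm dotv_ideal // mod0n.
have e1 : padic_exp R (lambda * (z1 + dotv u y1)%:F) = 1.
  by rewrite lambdaE padic_exp_ideal.
by rewrite (xi1 _ xI1) (eta1 _ yI2) e1 !mul1r.
Qed.

Lemma hnorm_model0 : hnorm (0 : ambient rho) = 0.
Proof.
rewrite (hnorm_model mu_haar xi eta lambda (m := m)); last by move=> u w _.
by rewrite big1 ?mul0r ?sqrtr0 // => e _; rewrite /= expr0n addr0.
Qed.

(** Orbit maps are even locally constant: phase and translated function both agree exactly near
    g. *)
Lemma model_continuous : strongly_continuous rho.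
Proof.
move=> f /HP fP [[x y] z]; apply: cvg_near_cst.
have [n phE] := heis_phase_locally_const x y z.
apply/heis_nbhsP; exists (maxn m n) => -[[x' y'] z'] hc.
have [/= xI _ _] := heis_cong_le (leq_maxl m n) hc.
suff E : @act _ _ _ _ rho (x', y', z') f = @act _ _ _ _ rho (x, y, z) f.
  change (hnorm (@act _ _ _ _ rho (x', y', z') f - @act _ _ _ _ rho (x, y, z)
    f) = 0).
  by rewrite E subrr hnorm_model0.
apply/funext => u; rewrite !heis_rep_actE.
rewrite (phE _ _ _ _ (heis_cong_le (leq_maxr m n) hc)).
congr (_ * _); apply: (mod_periodic_eq fP).
by rewrite opprD addrACA subrr add0r.
Qed.

(** Stated for arbitrary invariant subspaces, so that it applies also to the image of the
    intertwiner. *)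
Lemma model_uirrep_subspace (W : set (ambient rho)) :
  W `<=` carrier rho -> linear_subspace W ->
  (forall (s : heis pp d) v, W v -> W (act s v)) -> (exists2 f, W f & f != 0) ->
  W = carrier rho.
Proof.
move=> WH Wsub Wact [f Wf f0].
have fP : mod_periodic m f by apply/HP; exact: WH.
have [u0 fu0] : exists u0, f u0 != 0.
  apply/not_existsP => fu; move: f0 => /eqP; apply; apply/funext => u.
  by apply/eqP; apply: contraT => /fu.
have Wphi0 : W (phi R lambda u0).
  (* The weights are the inverse phases at u0, so the sum over y is an orthogonality relation
     isolating the coset of u0. *)
  pose k (e : residue p d m) := padic_exp R (- (dotv eta (to_Qpd (rep e)) +
    lambda * (dotv u0 (rep e))%:F)).
  have : W (\sum_e k e *: @act _ _ _ _ rho (0, rep e, 0) f).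
    by apply: (subspace_sum Wsub) => e _; apply/(subspaceZ Wsub)/Wact.
  have -> : \sum_e k e *: @act _ _ _ _ rho (0, rep e, 0) f =
      (N * f u0 / c) *: phi R lambda u0.
    apply/funext => u; rewrite fct_sumE.
    change (\sum_e k e * @act _ _ _ _ rho (0, rep e, 0) f u =
      (N * f u0 / c) * phi R lambda u0 u).
    rewrite (phiE a_unit lambdaE) mulrA divfK // indicE.
    transitivity ((\sum_(e : residue p d m) padic_exp R
        (lambda * (dotv (rep e) (u - u0))%:F)) * f u).
      rewrite mulr_suml; apply: eq_bigr => e _.
      rewrite heis_rep_actE addr0 /heis_phase mulrA -padic_expD.
      rewrite to_Qpd0 dotv0r !add0r (dotv_comm (rep e)) dotv_addl dotv_oppl.
      by congr (padic_exp _ _ * _); rewrite tofracD tofracN; ring.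
    rewrite lambdaE sum_padic_exp //; case: asboolP => uI.
      rewrite mem_set ?mulr1; last exact/Zpd_cosetP.
      by rewrite (mod_periodic_eq fP uI).
    by rewrite memNset ?mulr0 ?mul0r // => /Zpd_cosetP.
  move=> /(subspaceZ Wsub (N * f u0 / c)^-1); rewrite scalerA mulVf ?scale1r //.
  by rewrite mulf_neq0 ?invr_eq0 // mulf_neq0 // N_neq0.
apply/seteqP; split=> // g; apply: (lin_span_sub Wsub) => _ [h _ <-].
(* Translation by u0 - h carries the coset of u0 to that of h; the scalar removes the phase from
   xi. *)
have -> : phi R lambda h = padic_exp R (- dotv xi (to_Qpd (u0 - h))) *:
    @act _ _ _ _ rho (u0 - h, 0, 0) (phi R lambda u0).
  apply/funext => u.
  change (phi R lambda h u = padic_exp R (- dotv xi (to_Qpd (u0 - h))) *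
    @act _ _ _ _ rho (u0 - h, 0, 0) (phi R lambda u0) u).
  rewrite heis_rep_actE mulrA -padic_expD to_Qpd0 !dotv0r !addr0 tofrac0 mulr0.
  rewrite addr0 addNr padic_exp0 mul1r !(phiE a_unit lambdaE) !indicE.
  congr (_ * (nat_of_bool _)%:R); apply/idP/idP => /set_mem/Zpd_cosetP uh;
    apply/mem_set/Zpd_cosetP; move: uh.
    by rewrite addrA addrAC addrK.
  by rewrite addrA addrAC addrK.
by apply/(subspaceZ Wsub)/Wact.
Qed.

Lemma model_uirrep : is_uirrep rho.
Proof.
split; first split; first split.
- exact: Hspace_subspace.
- exact: L2_dot_inner a_unit lambdaE.
- exact: model_complete a_unit lambdaE.
- exact: model_unitary a_unit lambdaE.
- exact: model_continuous.
split=> [|W WH Wsub _ Wact].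
  exists (phi R lambda 0).
    by apply/HP; exact: phi_periodic a_unit lambdaE _.
  apply/eqP => /(congr1 (fun f : fctT => f 0)) /eqP;
    rewrite (phiE a_unit lambdaE).
  rewrite indicE mem_set ?mulr1; first by rewrite (negPf c_neq0).
  by apply/Zpd_cosetP; rewrite subrr; exact: Zpd_ideal0.
have [[f Wf f0]|no] := pselect (exists2 f, W f & f != 0).
  by right; apply: model_uirrep_subspace => //; exists f.
left; apply/seteqP; split=> f /=; last by move=> ->; exact: Wsub.1.
by move=> Wf; apply: contra_notP no => /eqP f0; exists f.
Qed.

End ModelIrreducible.

(** * Basis, dimension, matrix coefficients and characters *)

Section ModelFormulas.
Context {R : realType} {p : nat} {pp : prime p} {d : nat}.
Local Notation Zp := (padic_int pp).
Local Notation Qp := (padic pp).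
Local Notation Zpd := 'rV[Zp]_d.
Local Notation Qpd := 'rV[Qp]_d.
Variables (mu : probability (borel_Zpd pp d) R).
Hypothesis mu_haar : translation_invariant mu.
Variables (xi eta : Qpd) (lambda : Qp) (m : nat) (a : Zp).
Hypothesis a_unit : a \is a GRing.unit.
Hypothesis lambdaE : lambda = a%:F / p%:R ^+ m.

Local Notation rho := (heis_rep mu (xi, eta, lambda)).
Local Notation fctT := (Zpd -> R[i]^o).
Local Notation E := (residue p d m).
Local Notation N := ((#|{: E}|)%:R : R[i]).
Local Notation rep := (@residue_rep p pp d m).
Local Notation phase := (@heis_phase R p pp d xi eta lambda).
Local Notation c := ((phi_scale (R := R) (d := d) lambda)%:C%C).
Implicit Types (f : fctT) (h u x y w : Zpd) (z : Zp).

Let HP f : Hspace R d lambda f <-> mod_periodic m f.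
Proof. exact: Hspace_periodic a_unit lambdaE f. Qed.

Let c_neq0 : c != 0 := phi_scale_neq0 a_unit lambdaE.

Definition coset_rep (i : 'I_#|{: E}|) : Zpd := rep (enum_val i).

Lemma coset_rep_system : coset_system m%:Z coset_rep.
Proof.
move=> u; exists (enum_rank (residue_of m u)); split.
  apply/Zpd_cosetP; rewrite /coset_rep enum_rankK.
  by apply/Zpd_idealC; exact: residue_rep_of.
move=> i /Zpd_cosetP/residue_of_eq ->.
by rewrite residue_repK enum_valK.
Qed.

Lemma sum_coset_rep (V : nmodType) (F : E -> V) :
  \sum_(i < #|{: E}|) F (enum_val i) = \sum_(e : E) F e.
Proof. by rewrite -(big_enum_val F); apply: eq_bigl => e; rewrite inE. Qed.

Lemma phi_basis :
  lin_basis (Hspace R d lambda) (fun i => phi R lambda (coset_rep i)).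
Proof.
split=> [k k0 i|].
  (* The supports are disjoint, so evaluation at a representative isolates one coefficient. *)
  have /(congr1 (fun f : fctT => f (coset_rep i))) := k0.
  rewrite fct_sumE (bigD1 i) //= big1 ?addr0 => [|j ji].
    change (k i * phi R lambda (coset_rep i) (coset_rep i) = 0 -> k i = 0).
    rewrite (phi_rep a_unit lambdaE) eqxx => /eqP.
    by rewrite mulf_eq0 (negPf c_neq0) orbF => /eqP.
  change (k j * phi R lambda (coset_rep j) (coset_rep i) = 0).
  by rewrite (phi_rep a_unit lambdaE) (inj_eq enum_val_inj) (negPf ji) mulr0.
apply/seteqP; split=> f.
  move=> /HP/(phi_expand a_unit lambdaE) fE.
  exists #|{: E}|, (fun i => f (coset_rep i) / c),
    (fun i => phi R lambda (coset_rep i)); split; first by move=> i; exists i.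
  rewrite {1}fE -(sum_coset_rep
    (fun e => (f (rep e) / c) *: (phi R lambda (rep e) : fctT))).
  by [].
apply: lin_span_sub; first exact: lin_span_subspace.
move=> _ [i _ <-]; apply/HP.
exact: phi_periodic a_unit lambdaE _.
Qed.

Lemma Hspace_dim : has_dim (Hspace R d lambda) #|{: E}|.
Proof. by exists (fun i => phi R lambda (coset_rep i)); exact: phi_basis. Qed.

Lemma card_residue_norm : (#|{: E}|)%:R = padic_norm R lambda ^+ d.
Proof. by rewrite (lambda_norm a_unit lambdaE) card_residue natrX. Qed.

Lemma Hspace_L2 : Hspace R d lambda `<=` L2 mu.
Proof.
move=> f /HP fP; split.
- by apply: mod_periodic_measurable => u w wI; rewrite fP.
- by apply: mod_periodic_measurable => u w wI; rewrite fP.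
rewrite (integral_mod_periodic mu_haar (m := m)) ?ltry //.
by move=> u w wI; rewrite fP.
Qed.

Lemma heis_matrix_coef h h' x y z :
  @matrix_coef _ _ _ _ rho (phi R lambda h) (phi R lambda h') (x, y, z) =
  phase x y z h' * \1_(Zpd_coset (h - h') m%:Z) x.
Proof.
have phP (k : Zpd) := phi_periodic (R := R) a_unit lambdaE k.
rewrite /matrix_coef (L2_dotE mu_haar xi eta lambda
  (heis_act_periodic mu xi eta lambdaE (x, y, z) (phP h)) (phP h')).
(* F is the image of [phi R lambda h] without its constant. Pairing with the indicator at h'
   evaluates F at h', and the two constants cancel the N of the mean. *)
pose F u := phase x y z u * \1_(Zpd_coset h m%:Z) (u + x) : R[i].
have FP : mod_periodic m F.
  move=> u w wI; rewrite /F (heis_phase_periodic _ _ lambdaE) //; congr (_ * _).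
  have := phP h (u + x) w wI; rewrite !(phiE a_unit lambdaE) addrAC.
  by move=> /(mulfI c_neq0).
have hc h1 u : \1_(Zpd_coset h1 m%:Z) u = \1_(Zpd_coset u m%:Z) h1 :> R[i].
  rewrite !indicE; congr (nat_of_bool _)%:R.
  by apply/idP/idP => /set_mem/Zpd_cosetP/Zpd_idealC uh;
    apply/mem_set/Zpd_cosetP.
transitivity (F h'); last first.
  rewrite /F; congr (_ * _); rewrite !indicE; congr (nat_of_bool _)%:R.
  have xE : h' + x - h = x - (h - h') by rewrite opprB addrCA addrA.
  apply/idP/idP => /set_mem/Zpd_cosetP xI; apply/mem_set/Zpd_cosetP.
    by rewrite -xE.
  by rewrite xE.
rewrite (mod_periodic_expand h' FP) mulr_suml; apply: eq_bigr => e _.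
rewrite heis_rep_actE !(phiE a_unit lambdaE) rmorphM /=.
rewrite (_ : c^* = c); last by rewrite [LHS]conjc_real.
rewrite (_ : (\1_(Zpd_coset h' m%:Z) (rep e))^* = \1_(Zpd_coset (rep e) m%:Z)
  h');
  last by rewrite -hc indicE rmorph_nat.
rewrite -(phi_scale_sqrC (d := d) a_unit lambdaE) /F.
by field; rewrite c_neq0.
Qed.

Lemma heis_character x y z : is_trace (carrier rho) (@act _ _ _ _ rho (x, y, z))
  (N * padic_exp R (dotv xi (to_Qpd x) + dotv eta (to_Qpd y) + lambda * z%:F) *
   \1_(Zpd_ideal m%:Z) x * \1_(Zpd_ideal m%:Z) y).
Proof.
pose b i : fctT := phi R lambda (coset_rep i).
exists #|{: E}|, b, (\matrix_(i, j)
  (@act _ _ _ _ rho (x, y, z) (b j) (coset_rep i) / c)); split.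
- exact: phi_basis.
- move=> j; rewrite [LHS](phi_expand a_unit lambdaE); last first.
    by apply: (heis_act_periodic _ _ _ lambdaE);
      exact: phi_periodic a_unit lambdaE _.
  rewrite -(sum_coset_rep (fun e =>
    (@act _ _ _ _ rho (x, y, z) (b j) (rep e) / c) *: (phi R lambda (rep e) :
      fctT))).
  by apply: eq_bigr => i _; rewrite mxE.
rewrite /mxtrace.
(* A diagonal entry survives only if x fixes every coset; summing the phases over the cosets then
   gives N times the indicator in y. *)
transitivity (\sum_(e : E) phase x y z (rep e) * \1_(Zpd_ideal m%:Z) x : R[i]);
  last first.
  rewrite -sum_coset_rep; apply: eq_bigr => i _; rewrite mxE heis_rep_actE.
  rewrite /b (phiE a_unit lambdaE) mulrCA [c * _]mulrC mulfK //; congr (_ * _).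
  rewrite !indicE; congr (nat_of_bool _)%:R.
  apply/idP/idP => /set_mem xI; apply/mem_set.
    by apply/Zpd_cosetP; rewrite addrAC subrr add0r.
  by move: xI => /Zpd_cosetP; rewrite addrAC subrr add0r.
rewrite -mulr_suml mulrAC; congr (_ * _).
transitivity (padic_exp R (dotv xi (to_Qpd x) + dotv eta (to_Qpd y) + lambda *
  z%:F)
  * \sum_(e : E) padic_exp R (lambda * (dotv (rep e) y)%:F)); last first.
  rewrite mulr_sumr; apply: eq_bigr => e _.
  by rewrite -padic_expD /heis_phase tofracD mulrDr addrA.
rewrite lambdaE sum_padic_exp // indicE mulrAC mulrC; congr (_ * _).
by case: asboolP => yI; [rewrite mem_set ?mulr1|rewrite memNset ?mulr0].
Qed.

End ModelFormulas.

(** * Hilbert space representations *)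

Section SubRepresentation.
Context {R : realType} {p : nat} {pp : prime p} {d : nat}.
Variables (r : prerep R pp d) (rW : linear_subspace (carrier r)).

(** The proof is an argument because the submodule instance attached to the predicate depends on
    it. *)
Definition carrier_pred of linear_subspace (carrier r) : {pred ambient r} :=
  fun v => `[< carrier r v >].

Lemma carrier_pred_closed : submod_closed (carrier_pred rW).
Proof.
split=> [|c u v]; first exact/asboolP/rW.1.
by move=> /asboolP ru /asboolP rv; apply/asboolP/rW.2.
Qed.

HB.instance Definition _ :=
  GRing.isSubmodClosed.Build R[i] (ambient r) (carrier_pred rW)
    carrier_pred_closed.

Record carrier_type := CarrierType {
  carrier_val : ambient r; _ : carrier_val \in carrier_pred rW }.

HB.instance Definition _ := [isSub for carrier_val].
HB.instance Definition _ := [Choice of carrier_type by <:].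
HB.instance Definition _ := [SubChoice_isSubLmodule of carrier_type by <:].

(* Restricting the ambient space removes all membership side conditions. *)
Definition full_rep : prerep R pp d :=
  {| ambient := (carrier_type : lmodType R[i]);
     carrier := [set: carrier_type];
     dot := fun u v => dot (val u) (val v);
     act := fun g v => insubd (0 : carrier_type) (act g (val v)) |}.

Lemma carrier_valP (v : carrier_type) : carrier r (val v).
Proof. by apply/asboolP; exact: (valP v). Qed.

Lemma carrier_valE (v : ambient r) : carrier r v -> exists w : carrier_type,
  val w = v.
Proof. by move=> /asboolP rv; exists (CarrierType rv). Qed.

Lemma carrier_val_linear c (u v : carrier_type) :
  val (c *: u + v) = c *: val u + val v.
Proof. exact: (linearP (\val : carrier_type -> ambient r)). Qed.

Hypothesis rU : is_uirrep r.

(** The default of [insubd] is never reached, since the action preserves the carrier. *)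
Lemma full_rep_actE g (v : carrier_type) :
  val (act (g : heis pp d) (v : ambient full_rep) : carrier_type) = act g (val
    v).
Proof.
have [[_ [rA _ _ _ _] _] _] := rU.
rewrite /= insubdK //; apply/asboolP/rA; exact: carrier_valP.
Qed.

Lemma full_rep_unitarily_equiv : unitarily_equiv full_rep r.
Proof.
exists val; split=> [c u v _ _||//|g v _]; first exact: carrier_val_linear.
- apply/seteqP; split=> [_ [v _ <-]|v /carrier_valE[w <-]]; last by exists w.
  exact: carrier_valP.
- exact: full_rep_actE.
Qed.

Lemma full_rep_uirrep : is_uirrep full_rep.
Proof.
have [[[_ [rl rs rp] rc] [rA rAl rA1 rAM rAd] rct] [[v0 rv0 v00] rI]] := rU.
split; first split; first split.
- by [].
- split=> [c u v w _ _ _|u v _ _|u _ u0].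
  + change (dot (val (c *: u + v : carrier_type)) (val w) =
      c * dot (val u) (val w) + dot (val v) (val w)).
    by rewrite carrier_val_linear rl //; exact: carrier_valP.
  + by apply: rs; exact: carrier_valP.
  + by apply: rp; [exact: carrier_valP|].
- move=> s _ sC; have [|e e0|l rl0 sl] := rc (fun n => val (s n :
    carrier_type)).
  + by move=> n; exact: carrier_valP.
  + by have [M MP] := sC e e0; exists M.
  by have [w wE] := carrier_valE rl0; exists w => //; rewrite -wE in sl.
- split=> [//|g c u v _ _|v _|g h v _|g u v _ _].
  + apply: val_inj; rewrite full_rep_actE !carrier_val_linear !full_rep_actE.
    by rewrite rAl //; exact: carrier_valP.
  + by apply: val_inj; rewrite full_rep_actE rA1 //; exact: carrier_valP.
  + apply: val_inj; rewrite !full_rep_actE rAM //; exact: carrier_valP.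
  + by rewrite /= !full_rep_actE rAd //; exact: carrier_valP.
- move=> v _ g; have := rct (val (v : carrier_type)) (carrier_valP _) g.
  apply: cvg_trans; apply: near_eq_cvg; near=> h.
  by rewrite /hnorm /= !full_rep_actE.
split.
  have [w wE] := carrier_valE rv0; exists w => //; apply: contraNneq v00 => w0.
  by rewrite -wE w0.
move=> W _ Wsub Wcl Wact.
(* Irreducibility transfers by taking images under [val]; closedness of the image needs a lift of
   both the sequence and its limit. *)
have [|||g _ [v Wv <-]|W0|WT] := rI [set val w | w in (W : set carrier_type)].
- by move=> _ [v Wv <-]; exact: carrier_valP.
- split; first by exists 0 => //; exact: Wsub.1.
  move=> c _ _ [u Wu <-] [v Wv <-]; exists (c *: u + v); first exact: Wsub.2.
  exact: carrier_val_linear.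
- move=> s l sW rl0 sl; have [w wE] := carrier_valE rl0.
  have /choice[t tP] : forall n, exists u : carrier_type, W u /\ val u = s n.
    by move=> n; have [u Wu <-] := sW n; exists u.
  exists w => //; apply: (Wcl t); [by move=> n; exact: (tP n).1|by []|].
  move: sl; rewrite /hcvg -wE; apply: cvg_trans; apply: near_eq_cvg.
  by near=> n; rewrite /hnorm /= -(tP n).2.
- by exists (act g (v : ambient full_rep)); [exact: Wact|rewrite full_rep_actE].
- left; apply/seteqP; split=> v /=; last by move=> ->; exact: Wsub.1.
  move=> Wv; apply: val_inj.
  have : [set val w | w in (W : set carrier_type)] (val v) by exists v.
  by rewrite W0.
- right; apply/seteqP; split=> // v _.
  have : carrier r (val v) by exact: carrier_valP.
  by rewrite -WT => -[w Ww /val_inj <-].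
Unshelve. all: by end_near. Qed.

End SubRepresentation.

(** * Norm estimates and finite averages *)

Section HilbertSpace.
Context {R : realType} {p : nat} {pp : prime p} {d : nat}.
Variable r : prerep R pp d.
Hypothesis rT : forall v, carrier r v.
Hypothesis rI : is_inner_product r.
Local Notation V := (ambient r).
Implicit Types (u v w : V) (c : R[i]).

Lemma dotDl u v w : dot (u + v) w = dot u w + dot v w.
Proof. by have [rl _ _] := rI; rewrite -[u]scale1r rl // mul1r scale1r. Qed.

Lemma dot0l w : dot 0 w = 0.
Proof. by apply: (addIr (dot 0 w)); rewrite -dotDl !add0r. Qed.

Lemma dotZl c u w : dot (c *: u) w = c * dot u w.
Proof. by have [rl _ _] := rI; rewrite -[c *: u]addr0 rl // dot0l addr0. Qed.

Lemma dotC u v : dot v u = (dot u v)^*.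
Proof. by have [_ rs _] := rI; exact: rs. Qed.

Lemma dotDr u v w : dot w (u + v) = dot w u + dot w v.
Proof. by rewrite dotC dotDl rmorphD /= -!dotC. Qed.

Lemma dotZr c u w : dot w (c *: u) = c^* * dot w u.
Proof. by rewrite dotC dotZl rmorphM /= -dotC. Qed.

Lemma dot0r w : dot w 0 = 0.
Proof. by rewrite dotC dot0l rmorph0. Qed.

Lemma dotNl u w : dot (- u) w = - dot u w.
Proof. by rewrite -scaleN1r dotZl mulN1r. Qed.

Lemma dotNr u w : dot w (- u) = - dot w u.
Proof. by rewrite dotC dotNl rmorphN /= -dotC. Qed.

Lemma dot_suml (I : Type) (s : seq I) (f : I -> V) w :
  dot (\sum_(i <- s) f i) w = \sum_(i <- s) dot (f i) w.
Proof.
by apply: (big_morph (fun u => dot u w)) => [u v|]; rewrite ?dotDl ?dot0l.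
Qed.

Lemma dot_ge0 v : 0 <= dot v v.
Proof.
have [_ _ rp] := rI; have [->|v0] := eqVneq v 0; first by rewrite dot0l.
exact/ltW/rp.
Qed.

Lemma dot_self v : dot v v = (hnorm v ^+ 2)%:C%C.
Proof.
have := dot_ge0 v; rewrite lecE => /= /andP[/eqP im re].
rewrite sqr_sqrtr //; apply/eqP; rewrite eq_complex /= eqxx /=.
by rewrite im.
Qed.

Lemma hnorm_eq0 v : hnorm v = 0 -> v = 0.
Proof.
move=> v0; have [_ _ rp] := rI; apply/eqP; apply: contraT => /(rp _ (rT v)).
by rewrite dot_self v0 expr0n ltxx.
Qed.

Lemma hnorm_zero : hnorm (0 : V) = 0.
Proof. by rewrite /hnorm dot0l sqrtr0. Qed.

Lemma Cauchy_Schwarz u v :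
  complex.Re (dot u v) ^+ 2 + complex.Im (dot u v) ^+ 2 <=
  (hnorm u * hnorm v) ^+ 2.
Proof.
have [->|v0] := eqVneq v 0.
  by rewrite dot0r hnorm_zero mulr0 /= expr0n addr0.
have [_ _ rp] := rI; have := rp _ (rT v) v0; set D := dot v v => D0.
pose b := dot u v.
have : 0 <= D * (D * dot u u - b * b^*).
  have DR : D^* = D by rewrite /D -dotC.
  suff <- : dot (D *: u - b *: v) (D *: u - b *: v) = D * (D * dot u u - b *
    b^*).
    exact: dot_ge0.
  rewrite !(dotDl, dotDr, dotNl, dotNr, dotZl, dotZr) DR (dotC u v) -/b -/D.
  ring.
rewrite pmulr_rge0 // subr_ge0 mulc_conj /D !dot_self -rmorphM /= lecR.
by rewrite mulrC exprMn.
Qed.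

Lemma hnormD u v : hnorm (u + v) <= hnorm u + hnorm v.
Proof.
rewrite -(ler_pXn2r (n := 2)) ?nnegrE ?addr_ge0 ?hnorm_ge0 //.
have -> : hnorm (u + v) ^+ 2 = hnorm u ^+ 2 + hnorm v ^+ 2 +
    complex.Re (dot u v) *+ 2.
  apply: (@complexI R); rewrite -dot_self !(dotDl, dotDr) !dot_self (dotC u v).
  by apply/eqP; rewrite eq_complex /=; case: (dot u v) => ? ? /=;
    apply/andP; split; apply/eqP; ring.
have re : complex.Re (dot u v) <= hnorm u * hnorm v.
  have uv0 : 0 <= hnorm u * hnorm v by rewrite mulr_ge0 ?hnorm_ge0.
  apply: le_trans (ler_norm _) _.
  rewrite -(ger0_norm uv0) -!sqrtr_sqr ler_wsqrtr //.
  by apply: le_trans (Cauchy_Schwarz u v); rewrite lerDl sqr_ge0.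
by rewrite sqrrD !mulr2n; lra.
Qed.

Lemma hnormN v : hnorm (- v) = hnorm v.
Proof. by rewrite /hnorm dotNl dotNr opprK. Qed.

Lemma hnormBC u v : hnorm (u - v) = hnorm (v - u).
Proof. by rewrite -hnormN opprB. Qed.

Lemma hnormB_le u v w : hnorm (u - w) <= hnorm (u - v) + hnorm (v - w).
Proof. by rewrite -[u - w](subrKA v) hnormD. Qed.

Lemma hnorm_scale_nat (n : nat) v : (0 < n)%N ->
  hnorm ((n%:R : R[i])^-1 *: v) = hnorm v / n%:R.
Proof.
move=> n0; rewrite /hnorm dotZl dotZr dot_self.
have -> : (n%:R : R[i])^-1 = ((n%:R : R)^-1)%:C%C by rewrite fmorphV rmorph_nat.
rewrite (_ : (_%:C%C)^* = ((n%:R : R)^-1)%:C%C);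
  last by rewrite [LHS]conjc_real.
rewrite -!rmorphM /= mulrA -expr2 sqrtrM ?sqr_ge0 // !sqrtr_sqr.
rewrite !ger0_norm ?invr_ge0 ?ler0n ?hnorm_ge0 //.
by rewrite mulrC.
Qed.

Lemma hnorm_sum (I : Type) (s : seq I) (f : I -> V) :
  hnorm (\sum_(i <- s) f i) <= \sum_(i <- s) hnorm (f i).
Proof.
elim: s => [|i s IH]; first by rewrite !big_nil hnorm_zero.
by rewrite !big_cons (le_trans (hnormD _ _)) // lerD2l.
Qed.

Definition average (I : finType) (f : I -> V) : V :=
  (#|I|%:R : R[i])^-1 *: \sum_i f i.

Lemma average_dist (I : finType) (f g : I -> V) (e : R) : (0 < #|I|)%N ->
  (forall i, hnorm (f i - g i) <= e) -> hnorm (average f - average g) <= e.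
Proof.
move=> I0 fg; rewrite /average -scalerBr hnorm_scale_nat // -sumrB.
rewrite ler_pdivrMr ?ltr0n //; apply: le_trans (hnorm_sum _ _) _.
have h : \sum_i hnorm (f i - g i) <= \sum_(i : I) e by apply: ler_sum.
by apply: le_trans h _; rewrite sumr_const -[e *+ _]mulr_natr.
Qed.

Lemma average_cst (I : finType) v : (0 < #|I|)%N -> average (fun _ : I => v) =
  v.
Proof.
move=> I0; rewrite /average sumr_const -[v *+ _]scaler_nat scalerA mulVf
  ?scale1r //.
by rewrite pnatr_eq0 -lt0n.
Qed.

Lemma hnorm_small_eq0 v : (forall e : R, 0 < e -> hnorm v <= e) -> v = 0.
Proof.
move=> ve; apply: hnorm_eq0; apply/eqP; rewrite eq_le hnorm_ge0 andbT.
by apply/ler_addgt0Pl => e e0; rewrite addr0 ve.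
Qed.

End HilbertSpace.

(** * Eigenvectors of unitary actions of Z_p^k *)

Section AbelianAction.
Context {R : realType} {p : nat} {pp : prime p} {d : nat}.
Variable r : prerep R pp d.
Hypothesis rT : forall v, carrier r v.
Hypothesis rI : is_inner_product r.
Hypothesis rC : is_complete r.
Local Notation Zp := (padic_int pp).
Local Notation Qp := (padic pp).
Local Notation V := (ambient r).

(** Continuity at 0 suffices for an isometric action. The rank k is free: 1 serves the centre, d the
    x- and y-variables. *)
Record isometric_action k (B : 'rV[Zp]_k -> V -> V) := IsometricAction {
  isoact_lin : forall y (c : R[i]) u v, B y (c *: u + v) = c *: B y u + B y v;
  isoact_add : forall x y v, B (x + y) v = B x (B y v);
  isoact_norm : forall y v, hnorm (B y v) = hnorm v;
  isoact_cont : forall v (e : R), 0 < e -> exists n, forall y,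
    Zpd_ideal n%:Z y -> hnorm (B y v - v) <= e }.

Section Action.
Context {k : nat} (B : 'rV[Zp]_k -> V -> V) (BA : isometric_action B).
Local Notation rep := (@residue_rep p pp k _).
Implicit Types (x y : 'rV[Zp]_k) (u v w : V) (m n : nat).

Lemma isoactD y u v : B y (u + v) = B y u + B y v.
Proof. by have := isoact_lin BA y 1 u v; rewrite !scale1r. Qed.

Lemma isoact0r y : B y 0 = 0.
Proof. by apply: (addIr (B y 0)); rewrite -isoactD !add0r. Qed.

Lemma isoactZ y c u : B y (c *: u) = c *: B y u.
Proof. by have := isoact_lin BA y c u 0; rewrite !addr0 isoact0r addr0. Qed.

Lemma isoactB y u v : B y (u - v) = B y u - B y v.
Proof. by rewrite isoactD -scaleN1r isoactZ scaleN1r. Qed.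

Lemma isoact_sum y (I : Type) (s : seq I) (f : I -> V) :
  B y (\sum_(i <- s) f i) = \sum_(i <- s) B y (f i).
Proof. by apply: (big_morph (B y)) => [u v|]; rewrite ?isoactD ?isoact0r. Qed.

Lemma isoact_comm x y v : B x (B y v) = B y (B x v).
Proof. by rewrite -!(isoact_add BA) addrC. Qed.

Lemma isoact_average y (I : finType) (f : I -> V) :
  B y (average f) = average (fun i => B y (f i)).
Proof. by rewrite /average isoactZ isoact_sum. Qed.

Definition orbit_mean m v : V := average (fun e : residue p k m => B (rep e) v).

(** Shifting by y permutes the classes; each representative is then off by an element of p^m Z_p^k,
    which moves v by at most eps. *)
Lemma orbit_mean_inv m v (eps : R) y :
  (forall z, Zpd_ideal m%:Z z -> hnorm (B z v - v) <= eps) ->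
  hnorm (B y (orbit_mean m v) - orbit_mean m v) <= eps.
Proof.
move=> osc; rewrite isoact_average.
have -> : orbit_mean m v = average (fun e : residue p k m =>
    B (rep (residue_of m (rep e + y))) v).
  by rewrite /orbit_mean /average (reindex_inj (@shift_residue_inj _ _ _ m y)).
apply: (average_dist rT rI); first exact: card_residue_gt0.
move=> e; rewrite -(isoact_add BA).
set t := rep (residue_of _ _).
have tI : Zpd_ideal m%:Z (y + rep e - t).
  by apply/Zpd_idealC; rewrite [y + _]addrC; exact: residue_rep_of.
rewrite -[y + rep e](subrK t) [_ - t + t]addrC (isoact_add BA) -isoactB.
by rewrite (isoact_norm BA) osc.
Qed.

Lemma orbit_mean_comm m n v :
  average (fun e : residue p k m => B (rep e) (orbit_mean n v)) =
  average (fun e : residue p k n => B (rep e) (orbit_mean m v)).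
Proof.
rewrite /average; under eq_bigr do rewrite isoact_average /average.
under [in RHS]eq_bigr do rewrite isoact_average /average.
rewrite -!scaler_sumr !scalerA mulrC exchange_big; congr (_ *: _).
by apply: eq_bigr => e _; apply: eq_bigr => e' _; rewrite isoact_comm.
Qed.

(* Both means are compared with the mean of one of them over the other orbit,
   which does not depend on the order. *)
Lemma orbit_mean_cauchy m n v (eps eps' : R) :
  (forall z, Zpd_ideal m%:Z z -> hnorm (B z v - v) <= eps) ->
  (forall z, Zpd_ideal n%:Z z -> hnorm (B z v - v) <= eps') ->
  hnorm (orbit_mean m v - orbit_mean n v) <= eps + eps'.
Proof.
move=> om on; apply: le_trans (hnormB_le rT rI _
  (average (fun e : residue p k n => B (rep e) (orbit_mean m v))) _) _.
apply: lerD.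
  rewrite (hnormBC rT rI) -{2}(average_cst (orbit_mean m v) (@card_residue_gt0
    p pp k n)).
  apply: (average_dist rT rI); first exact: card_residue_gt0.
  by move=> e; exact: orbit_mean_inv.
rewrite -orbit_mean_comm -{2}(average_cst (orbit_mean n v) (@card_residue_gt0 p
  pp k m)).
apply: (average_dist rT rI); first exact: card_residue_gt0.
by move=> e; exact: orbit_mean_inv.
Qed.

(** The orbit means converge by completeness; the limit is invariant, and nonzero because every mean
    stays within half the norm of v from v. *)
Lemma fixed_vector v : v != 0 ->
  (forall y, hnorm (B y v - v) <= hnorm v / 2) ->
  exists2 w, w != 0 & forall y, B y w = w.
Proof.
move=> v0 half; pose a m := orbit_mean m v.
have osc (e : R) : 0 < e -> exists n, forall m, (n <= m)%N ->
    forall z, Zpd_ideal m%:Z z -> hnorm (B z v - v) <= e.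
  move=> /(isoact_cont BA v)[n nP]; exists n => m nm z zI.
  by apply: nP; exact: Zpd_ideal_le nm zI.
have e3 (e : R) : 0 < e -> 0 < e / 3 by move=> e0; rewrite divr_gt0.
have [||w _ aw] := rC (s := a); first by move=> n; exact: rT.
  move=> e e0; have [n nP] := osc _ (e3 _ e0); exists n => m m' nm nm'.
  apply: le_lt_trans (orbit_mean_cauchy (nP m nm) (nP m' nm')) _.
  by lra.
have near_w (e : R) : 0 < e -> exists n, hnorm (a n - w) <= e /\
    forall z, Zpd_ideal n%:Z z -> hnorm (B z v - v) <= e.
  move=> e0; have /cvgr0Pnorm_lt/(_ _ e0)[N _ NP] := aw.
  have [n nP] := osc _ e0; exists (maxn N n); split; last first.
    by apply: nP; exact: leq_maxr.
  by apply: ltW; rewrite -[ltLHS]ger0_norm ?hnorm_ge0 //; apply: NP;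
    exact: leq_maxl.
exists w.
  (* If w = 0, some mean has norm at most a quarter of that of v, and 1/2 + 1/4 < 1 is a
     contradiction. *)
  apply/eqP => w0; have v2 : 0 < hnorm v / 4.
    rewrite divr_gt0 // lt_def hnorm_ge0 andbT.
    by apply: contra v0 => /eqP/(hnorm_eq0 rT rI) ->.
  have [n [an _]] := near_w _ v2; rewrite w0 subr0 in an.
  have : hnorm (a n - v) <= hnorm v / 2.
    rewrite -{1}(average_cst v (@card_residue_gt0 p pp k n)).
    by apply: (average_dist rT rI); first exact: card_residue_gt0.
  have := hnormB_le rT rI v (a n) 0; rewrite !subr0 (hnormBC rT rI v).
  by lra.
move=> y; apply/eqP; rewrite -subr_eq0; apply/eqP.
(* Three errors of e/3: w replaced by a mean, that mean moved by y, and the return to w. *)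
apply: (hnorm_small_eq0 rT rI) => e /e3 e30.
have [n [an nP]] := near_w _ e30.
apply: le_trans (hnormB_le rT rI _ (B y (a n)) _) _.
apply: le_trans (lerD (lexx _) (hnormB_le rT rI _ (a n) _)) _.
rewrite -isoactB (isoact_norm BA) (hnormBC rT rI w).
have := orbit_mean_inv y nP; rewrite -/(a n); lra.
Qed.

Lemma fixed_eigenvector n w : w != 0 ->
  (forall y, Zpd_ideal n%:Z y -> B y w = w) ->
  exists (kappa : 'rV[Qp]_k) v, v != 0 /\
    forall y, B y v = padic_exp R (dotv kappa (to_Qpd y)) *: v.
Proof.
move=> w0 wfix.
(* The vectors [kap e] list the characters trivial on p^n Z_p^k, and [P e] is, up to a scalar, the
   projection of w to the matching eigenspace. *)
pose kap (e : residue p k n) : 'rV[Qp]_k := (1%:F / p%:R ^+ n) *: to_Qpd (rep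
  e).
pose P e := \sum_(e' : residue p k n)
  padic_exp R (- dotv (kap e) (to_Qpd (rep e'))) *: B (rep e') w.
have kapE e y : dotv (kap e) (to_Qpd y) = 1%:F / p%:R ^+ n * (dotv (rep e)
  y)%:F.
  by rewrite /kap dotv_scalel dotv_to_Qpd.
have PB e y : B y (P e) = padic_exp R (dotv (kap e) (to_Qpd y)) *: P e.
  pose f x := padic_exp R (- dotv (kap e) (to_Qpd x)) *: B x w.
  have fP : mod_periodic n f.
    move=> x z zI; have xzE : B (x + z) w = B x w by rewrite (isoact_add BA)
      wfix.
    rewrite /f xzE.
    apply: (congr1 (fun t => t *: B x w)).
    rewrite -!padic_exp_conj to_QpdD padic_exp_dotvD rmorphM /=.
    rewrite [X in _ * X^*](_ : _ = 1) ?rmorph1 ?mulr1 //.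
    by rewrite kapE padic_exp_ideal // dotv_comm dotv_ideal.
  rewrite /P isoact_sum -(sum_residue_shift y fP) scaler_sumr.
  apply: eq_bigr => e' _; rewrite isoactZ /f scalerA -padic_expD.
  rewrite -(isoact_add BA) [y + _]addrC; congr (padic_exp _ _ *: _).
  by rewrite to_QpdD dotv_addr opprD; ring.
(* Fourier inversion at 0: only the zero class of e' survives, so not all projections vanish. *)
have sumP : \sum_e P e = (#|{: residue p k n}|)%:R *: w.
  rewrite /P exchange_big /= (bigD1 (residue_of n 0)) //= [X in _ + X]big1.
    rewrite addr0 -scaler_suml; congr (_ *: _).
      transitivity (\sum_(e : residue p k n) (1 : R[i])); last first.
        by rewrite sumr_const.
      apply: eq_bigr => e _; rewrite kapE -padic_exp_conj padic_exp_ideal.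
        by rewrite rmorph1.
      rewrite dotv_comm dotv_ideal //.
      by have := residue_rep_of n (0 : 'rV[Zp]_k); rewrite subr0.
    apply: wfix; by have := residue_rep_of n (0 : 'rV[Zp]_k); rewrite subr0.
  move=> e' e'0; rewrite -scaler_suml.
  rewrite (_ : \sum_e _ = 0) ?scale0r //.
  transitivity ((\sum_(e : residue p k n) padic_exp R
      (1%:F / p%:R ^+ n * (dotv (rep e) (rep e'))%:F))^*).
    by rewrite rmorph_sum /=; apply: eq_bigr => e _;
      rewrite padic_exp_conj kapE.
  rewrite sum_padic_exp ?unitr1 //; case: asboolP => [eI|];
    last by rewrite rmorph0.
  case/eqP: e'0; rewrite -[e']residue_repK; apply/residue_of_eq.
  by rewrite subr0.
have [e Pe] : exists e, P e != 0.
  apply/not_existsP => noP; case/eqP: w0.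
  have : (#|{: residue p k n}|)%:R *: w = 0.
    rewrite -sumP big1 // => e _; apply/eqP; apply: contraT => /noP //.
  move/eqP; rewrite scaler_eq0 pnatr_eq0 => /orP[|/eqP //].
  by rewrite -leqn0 leqNgt card_residue_gt0.
by exists (kap e), (P e).
Qed.

End Action.

(** Reparametrizes the open subgroup p^n Z_p^k as a full Z_p^k, so that [fixed_vector] applies to
    it. *)
Lemma isometric_action_scale k (B : 'rV[Zp]_k -> V -> V) n :
  isometric_action B -> isometric_action (fun y => B (p%:R ^+ n *: y)).
Proof.
move=> BA; split=> [y c u v|x y v|y v|v e /(isoact_cont BA v)[N NP]].
- exact: isoact_lin.
- by rewrite scalerDr isoact_add.
- exact: isoact_norm.
exists N => y /Zpd_ideal_dvd[z ->]; apply: NP.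
by rewrite scalerA mulrC -scalerA; exact: Zpd_ideal_scale.
Qed.

Lemma exists_eigenvector k (B : 'rV[Zp]_k -> V -> V) :
  isometric_action B -> (exists v : V, v != 0) ->
  exists (kappa : 'rV[Qp]_k) v, v != 0 /\
    forall y, B y v = padic_exp R (dotv kappa (to_Qpd y)) *: v.
Proof.
move=> BA [v v0]; have v2 : 0 < hnorm v / 2.
  rewrite divr_gt0 // lt_def hnorm_ge0 andbT.
  by apply: contra v0 => /eqP/(hnorm_eq0 rT rI) ->.
have [n nP] := isoact_cont BA v v2.
have [|w w0 wfix] := fixed_vector (isometric_action_scale n BA) v0.
  by move=> y; apply: nP; exact: Zpd_ideal_scale.
apply: (fixed_eigenvector BA (n := n) w0).
by move=> _ /Zpd_ideal_dvd[y ->]; exact: wfix.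
Qed.

End AbelianAction.

(** * Classification *)

Section Classification.
Context {R : realType} {p : nat} {pp : prime p} {d : nat}.
Variable r : prerep R pp d.
Hypothesis rT : forall v, carrier r v.
Hypothesis rU : is_uirrep r.
Local Notation Zp := (padic_int pp).
Local Notation Qp := (padic pp).
Local Notation Zpd := 'rV[Zp]_d.
Local Notation Qpd := 'rV[Qp]_d.
Local Notation V := (ambient r).
Local Notation A := (@act R p pp d r).
Implicit Types (g h : heis pp d) (u v w : V) (z : Zp).

Let rI : is_inner_product r. Proof. by case: rU => -[[]]. Qed.
Let rC : is_complete r. Proof. by case: rU => -[[]]. Qed.
Let rA : is_unitary_action r. Proof. by case: rU => -[]. Qed.
Let rS : strongly_continuous r. Proof. by case: rU => -[]. Qed.

Lemma actL g (c : R[i]) u v : A g (c *: u + v) = c *: A g u + A g v.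
Proof. by have [_ l _ _ _] := rA; apply: l. Qed.

Lemma actZ g (c : R[i]) u : A g (c *: u) = c *: A g u.
Proof.
have h0 : A g 0 = 0.
  by apply: (addIr (A g 0)); have := actL g 1 0 0;
    rewrite !scale1r !addr0 add0r.
by have := actL g c u 0; rewrite h0 !addr0.
Qed.

Lemma act1 v : A 1%g v = v.
Proof. by have [_ _ o _ _] := rA; apply: o. Qed.

Lemma actM x y z x' y' z' v :
  A (x, y, z) (A (x', y', z') v) = A (x + x', y + y', z + z' + dotv x y') v.
Proof. by have [_ _ _ m _] := rA; rewrite -m. Qed.

Lemma act_dot g u v : dot (A g u) (A g v) = dot u v.
Proof. by have [_ _ _ _ i] := rA; apply: i. Qed.

Lemma act_hnorm g v : hnorm (A g v) = hnorm v.
Proof. by rewrite /hnorm act_dot. Qed.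

Lemma isometric_action_of_morphism k (s : 'rV[Zp]_k -> heis pp d) :
  (forall x y, s (x + y) = (s x * s y)%g) ->
  (forall n, exists m, forall y, Zpd_ideal m%:Z y -> heis_cong n 1%g (s y)) ->
  isometric_action (fun y => A (s y)).
Proof.
move=> sM sC; split=> [y c u v|x y v|y v|v e e0].
- exact: actL.
- by have [_ _ _ m _] := rA; rewrite sM m.
- exact: act_hnorm.
have /cvgr0Pnorm_lt/(_ _ e0)/heis_nbhsP[n nP] := rS (rT v) (1%g : heis pp d).
have [m mP] := sC n; exists m => y /mP /nP /=.
by rewrite act1 ger0_norm ?hnorm_ge0 // => /ltW.
Qed.

Lemma hnorm_padic_exp (t : Qp) v : hnorm (padic_exp R t *: v) = hnorm v.
Proof.
rewrite /hnorm (dotZl rT rI) (dotZr rT rI) mulrA padic_exp_conj mulrC.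
by rewrite [_ * padic_exp _ _]mulrC padic_expN_mul mulr1.
Qed.

Lemma nonzero_vector : exists v : V, v != 0.
Proof. by have [_ [[v _ v0] _]] := rU; exists v. Qed.

Lemma irreducible_sub (W : set V) : linear_subspace W -> hclosed W ->
  (forall g v, W v -> W (A g v)) -> (exists2 v, W v & v != 0) -> forall v, W v.
Proof.
move=> Ws Wc Wa [v Wv v0]; have [_ [_ irr]] := rU.
have [] // := irr W; last by move=> -> u; exact: rT.
by move=> W0; move: Wv; rewrite W0 => /= vE; rewrite vE eqxx in v0.
Qed.

(** The common eigenspace of one eigenvector is closed, and invariant because B commutes with the
    group; irreducibility makes it everything. *)
Lemma schur_scalar k (B : 'rV[Zp]_k -> V -> V) : isometric_action B ->
  (forall y g v, B y (A g v) = A g (B y v)) ->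
  exists kappa : 'rV[Qp]_k, forall y v,
    B y v = padic_exp R (dotv kappa (to_Qpd y)) *: v.
Proof.
move=> BA Bc.
have [kappa [v0 [v00 v0E]]] := exists_eigenvector rT rI rC BA nonzero_vector.
exists kappa => y v; move: v y.
apply: (@irreducible_sub [set v | forall y,
  B y v = padic_exp R (dotv kappa (to_Qpd y)) *: v]).
- split=> [y|c u v uE vE y] /=; first by rewrite (isoact0r BA) scaler0.
  by rewrite (isoact_lin BA) uE vE scalerDr !scalerA mulrC.
- move=> s l sE _ sl y; apply/eqP; rewrite -subr_eq0; apply/eqP.
  apply: (hnorm_small_eq0 rT rI) => e e0.
  have e2 : 0 < e / 2 by rewrite divr_gt0.
  have /cvgr0Pnorm_lt/(_ _ e2)[N _ NP] := sl.
  have {NP} := NP N (leqnn N); rewrite /= ger0_norm ?hnorm_ge0 // => h.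
  apply: le_trans (hnormB_le rT rI _ (B y (s N)) _) _.
  rewrite -(isoactB BA) (isoact_norm BA) (hnormBC rT rI) sE -scalerBr.
  by rewrite hnorm_padic_exp; lra.
- by move=> g v vE y /=; rewrite Bc vE actZ.
by exists v0.
Qed.

Lemma heis_act_central z g v : A (0, 0, z) (A g v) = A g (A (0, 0, z) v).
Proof.
case: g => [[x y] z']; rewrite !actM !add0r !addr0 dotv0l dotv0r !addr0.
by rewrite [z + _]addrC.
Qed.

Lemma central_character : exists lambda : Qp, quot_reps pp 0 lambda /\
  forall z v, A (0, 0, z) v = padic_exp R (lambda * z%:F) *: v.
Proof.
pose B (y : 'rV[Zp]_1) := A (0, 0, y 0 0).
have BA : isometric_action B.
  apply: (isometric_action_of_morphism (s := fun y => (0, 0, y 0 0))).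
    move=> x y; change ((0, 0, (x + y) 0 0) =
      (0 + 0, 0 + 0, x 0 0 + y 0 0 + dotv (0 : Zpd) 0) :> heis pp d).
    by rewrite !addr0 dotv0l addr0 mxE.
  move=> n; exists n => y /Zpd_idealP yI; split=> /=.
  - by rewrite subr0; exact: Zpd_ideal0.
  - by rewrite subr0; exact: Zpd_ideal0.
  - by rewrite yI; rewrite [RHS]res0.
have [kappa kE] := schur_scalar BA (fun y => heis_act_central _).
have [lambda [a [lq lE]]] := quot_reps_ex 0 (kappa 0 0).
exists lambda; split=> // z v.
have := kE (const_mx z) v; rewrite /B mxE => ->; congr (_ *: _).
rewrite /dotv big_ord1 !mxE lE expr0 invr1 mul1r mulrDl -tofracM.
by rewrite padic_exp_addzp.
Qed.

Section CentralCharacter.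
Variables (lambda : Qp) (m : nat) (a : Zp).
Hypothesis a_unit : a \is a GRing.unit.
Hypothesis lambdaE : lambda = a%:F / p%:R ^+ m.
Hypothesis centralE :
  forall z v, A (0, 0, z) v = padic_exp R (lambda * z%:F) *: v.

Lemma act_zD x y z z' v :
  A (x, y, z + z') v = padic_exp R (lambda * z'%:F) *: A (x, y, z) v.
Proof.
by rewrite -centralE actM !add0r dotv0l addr0 addrC.
Qed.

(** For x in p^m Z_p^d, commuting past (x', y', z') costs the central element x . y', on which
    lambda is trivial, so Schur's argument applies. *)
Lemma x_character : exists xi : Qpd,
  (forall j, quot_reps pp m (xi 0 j)) /\
  forall x v, Zpd_ideal m%:Z x ->
    A (x, 0, 0) v = padic_exp R (dotv xi (to_Qpd x)) *: v.
Proof.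
pose B (y : Zpd) := A (p%:R ^+ m *: y, 0, 0).
have BA : isometric_action B.
  apply: (isometric_action_scale (B := fun y => A (y, 0, 0)) m).
  apply: (isometric_action_of_morphism (s := fun y => (y, 0, 0))).
    move=> x y; change ((x + y, 0, 0) =
      (x + y, 0 + 0, 0 + 0 + dotv x 0) :> heis pp d).
    by rewrite dotv0r !addr0.
  move=> n; exists n => y yI; split=> /=.
  - by rewrite subr0.
  - by rewrite subr0; exact: Zpd_ideal0.
  - by [].
have [|kappa kE] := schur_scalar BA.
  move=> y [[x' y'] z'] v; rewrite /B !actM !add0r !addr0 dotv0r addr0.
  rewrite act_zD lambdaE padic_exp_ideal ?scale1r; first by rewrite addrC.
  by rewrite dotv_ideal //; exact: Zpd_ideal_scale.
(* The action is parametrized by y with x = p^m y, so the character of x is kappa / p^m. Changing it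
   by p^(-m) b only adds the integer b . y to the exponent. *)
have /choice[xi /choice[b xiE]] := fun j =>
  quot_reps_ex m (kappa 0 j / p%:R ^+ m).
exists (\row_j xi j); split=> [j|_ v /Zpd_ideal_dvd[y ->]].
  by rewrite mxE; have [] := xiE j.
apply: etrans (kE y v) _; apply: (congr1 (fun t => t *: v)).
have -> : dotv kappa (to_Qpd y) =
    dotv (\row_j xi j) (to_Qpd (p%:R ^+ m *: y)) + (dotv (\row_j b j) y)%:F.
  rewrite -dotv_to_Qpd to_QpdZ dotv_scaler -dotv_scalel -dotv_addl.
  congr dotv; apply/rowP => j; rewrite !mxE tofrac_expp.
  have [_ /(congr1 (fun t => p%:R ^+ m * t))] := xiE j.
  by rewrite mulrC divfK ?qp_expp_neq0 // mulrDr mulrA divff ?qp_expp_neq0 //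
    mul1r.
by rewrite padic_exp_addzp.
Qed.

Lemma y_eigenvector : exists (eta : Qpd) v,
  [/\ forall j, quot_reps pp m (eta 0 j), hnorm v = 1 &
    forall y, A (0, y, 0) v = padic_exp R (dotv eta (to_Qpd y)) *: v].
Proof.
have BA : isometric_action (fun y : Zpd => A (0, y, 0)).
  apply: (isometric_action_of_morphism (s := fun y => (0, y, 0))).
    move=> x y; change ((0, x + y, 0) =
      (0 + 0, x + y, 0 + 0 + dotv 0 y) :> heis pp d).
    by rewrite dotv0l !addr0.
  move=> n; exists n => y yI; split=> /=.
  - by rewrite subr0; exact: Zpd_ideal0.
  - by rewrite subr0.
  - by [].
have [kappa [v1 [v10 v1E]]] := exists_eigenvector rT rI rC BA nonzero_vector.
have /choice[eta /choice[b etaE]] := fun j => quot_reps_ex m (kappa 0 j).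
(* Translation by h lowers the eigenvalue kappa by lambda h; the required kappa - eta = p^(-m) b
   equals lambda h exactly for h = b / a. *)
pose h : Zpd := \row_j (a^-1 * b j).
pose v2 := A (h, 0, 0) v1.
have v2n : hnorm v2 != 0.
  by rewrite act_hnorm; apply: contra v10 => /eqP/(hnorm_eq0 rT rI) ->.
have v2E y : A (0, y, 0) v2 = padic_exp R (dotv (\row_j eta j) (to_Qpd y)) *:
  v2.
  rewrite /v2 actM add0r addr0 dotv0l !addr0.
  have -> : A (h, y, 0) v1 =
      padic_exp R (lambda * (- dotv h y)%:F) *: A (h, 0, 0) (A (0, y, 0) v1).
    by rewrite -act_zD actM !addr0 !add0r addNr.
  rewrite v1E actZ scalerA -padic_expD; congr (padic_exp _ _ *: _).
  have -> : kappa = \row_j eta j + lambda *: to_Qpd h.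
    apply/rowP => j; rewrite !mxE; have [_ ->] := etaE j; congr (_ + _).
    by rewrite lambdaE tofracM mulrACA -(tofracM a) divrr // tofrac1 mul1r.
  by rewrite dotv_addl dotv_scalel dotv_to_Qpd tofracN; ring.
exists (\row_j eta j), (((hnorm v2)^-1)%:C%C *: v2); split.
- by move=> j; rewrite mxE; have [] := etaE j.
- rewrite {1}/hnorm (dotZl rT rI) (dotZr rT rI) (dot_self rT rI).
  rewrite (_ : (_%:C%C)^* = ((hnorm v2)^-1)%:C%C);
    last by rewrite [LHS]conjc_real.
  by rewrite -!rmorphM /= mulrA -expr2 -exprMn mulVf // expr1n sqrtr1.
- by move=> y; rewrite actZ v2E !scalerA mulrC.
Qed.

End CentralCharacter.
End Classification.

(** * The intertwiner onto the model *)

Section Intertwiner.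
Context {R : realType} {p : nat} {pp : prime p} {d : nat}.
Variables (mu : probability (borel_Zpd pp d) R).
Hypothesis mu_haar : translation_invariant mu.
Variable r : prerep R pp d.
Hypothesis rT : forall v, carrier r v.
Hypothesis rU : is_uirrep r.
Local Notation Zp := (padic_int pp).
Local Notation Qp := (padic pp).
Local Notation Zpd := 'rV[Zp]_d.
Local Notation Qpd := 'rV[Qp]_d.
Local Notation V := (ambient r).
Local Notation A := (@act R p pp d r).

Let rI : is_inner_product r. Proof. by case: rU => -[[]]. Qed.

Variables (xi eta : Qpd) (lambda : Qp) (m : nat) (a : Zp) (v0 : V).
Hypothesis a_unit : a \is a GRing.unit.
Hypothesis lambdaE : lambda = a%:F / p%:R ^+ m.
Hypothesis centralE :
  forall z v, A (0, 0, z) v = padic_exp R (lambda * z%:F) *: v.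
Hypothesis xiE : forall x v, Zpd_ideal m%:Z x ->
  A (x, 0, 0) v = padic_exp R (dotv xi (to_Qpd x)) *: v.
Hypothesis v0_norm : hnorm v0 = 1.
Hypothesis etaE :
  forall y, A (0, y, 0) v0 = padic_exp R (dotv eta (to_Qpd y)) *: v0.

Local Notation rho := (heis_rep mu (xi, eta, lambda)).
Local Notation phase := (@heis_phase R p pp d xi eta lambda).
Local Notation c := ((phi_scale (R := R) (d := d) lambda)%:C%C).
Local Notation rep := (@residue_rep p pp d m).
Local Notation E := (residue p d m).
Local Notation fctT := (Zpd -> R[i]^o).
Implicit Types (u x y h : Zpd) (z : Zp) (v w : V).

Let c_neq0 : c != 0 := phi_scale_neq0 a_unit lambdaE.

(* The vector corresponding to phi_u in the model. *)
Definition translate u : V :=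
  padic_exp R (dotv xi (to_Qpd u)) *: A (- u, 0, 0) v0.

(* The variables keep unification from unfolding the arithmetic of the fraction
   field inside concrete phases. *)
Lemma scale_assoc2 (k1 k2 l : R[i]) w : k1 * k2 = l ->
  k1 *: (k2 *: w) = l *: w.
Proof. by rewrite scalerA => ->. Qed.

(** The phase in xi cancels the scalar by which p^m Z_p^d acts in the x-variable. *)
Lemma translate_periodic : mod_periodic m translate.
Proof.
move=> u i iI; rewrite /translate.
have -> : A (- (u + i), 0, 0) v0 = A (- u, 0, 0) (A (- i, 0, 0) v0).
  by rewrite (actM rT rU) opprD dotv0r !addr0.
rewrite (xiE v0 (Zpd_idealN iI)) (actZ rT rU).
apply: scale_assoc2; rewrite to_QpdD padic_exp_dotvD to_QpdN padic_exp_dotvN.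
by rewrite -mulrA [X in _ * X]mulrC padic_expN_mul mulr1.
Qed.

Lemma scale_assoc3 (k1 k2 k3 l1 l2 : R[i]) w : k1 * k2 * k3 = l1 * l2 ->
  k1 *: (k2 *: (k3 *: w)) = l1 *: (l2 *: w).
Proof. by rewrite !scalerA => ->. Qed.

Lemma padic_exp_shuffle (s t t' t'' : Qp) :
  padic_exp R s * padic_exp R t * padic_exp R t'' * padic_exp R t' =
  padic_exp R (t + t' + t'') * padic_exp R s.
Proof. by rewrite !padic_expD; ring. Qed.

(** The whole intertwining relation on vectors: pairing with it and using unitarity gives
    [coef_map_act]. *)
Lemma act_translate x y z u :
  A (x, y, z) (translate (u + x)) = phase x y z u *: translate u.
Proof.
rewrite /translate (actZ rT rU) (actM rT rU) opprD addrCA subrr addr0 !addr0.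
rewrite dotv0r addr0.
have -> : A (- u, y, z) v0 = padic_exp R (lambda * (z + dotv u y)%:F) *:
    A (- u, 0, 0) (padic_exp R (dotv eta (to_Qpd y)) *: v0).
  rewrite -etaE -(act_zD rT rU centralE) (actM rT rU) !addr0 !add0r.
  by rewrite dotv_oppl addrK.
rewrite (actZ rT rU); apply: scale_assoc3.
rewrite /heis_phase to_QpdD padic_exp_dotvD.
exact: padic_exp_shuffle.
Qed.

Lemma translate_dot u : dot (translate u) (translate u) = 1.
Proof.
rewrite (dot_self rT rI) /translate (hnorm_padic_exp rT rU) (act_hnorm rT rU).
by rewrite v0_norm expr1n.
Qed.

(** The two vectors are eigenvectors of a unitary operator (0, y, 0) with different eigenvalues; y
    is a unit vector along a coordinate separating u from u' modulo p^m. *)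
Lemma translate_ortho u u' : ~ Zpd_ideal m%:Z (u - u') ->
  dot (translate u) (translate u') = 0.
Proof.
move=> uu'; have [j jP] : exists j, (u - u') 0 j m <> 0%N.
  by apply/existsNP => h; apply: uu'; apply/Zpd_idealP.
pose y : Zpd := delta_mx 0 j.
have yE (t : Zpd) : A (0, y, 0) (translate t) = phase 0 y 0 t *: translate t.
  by rewrite -[t in LHS]addr0 act_translate.
have := act_dot rT rU (0, y, 0) (translate u) (translate u').
rewrite !yE (dotZl rT rI) (dotZr rT rI) mulrA => /eqP.
rewrite -subr_eq0 -{2}[dot _ _]mul1r -mulrBl mulf_eq0 => /orP[|/eqP //].
rewrite subr_eq0 padic_exp_conj -padic_expD => /eqP e1; case: jP.
apply: (padic_exp_unit_neq1 (R := R) a_unit (m := m)).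
rewrite -[RHS]e1; congr padic_exp.
have -> : (u - u') 0 j = dotv u y - dotv u' y by rewrite !dotv_delta !mxE.
by rewrite -lambdaE tofracB !add0r; ring.
Qed.

Definition coef_map v : fctT := fun u => c * dot v (translate u).

Lemma coef_map_periodic v : mod_periodic m (coef_map v).
Proof. by move=> u i iI; rewrite /coef_map translate_periodic. Qed.

Lemma coef_map_linear (k : R[i]) v w :
  coef_map (k *: v + w) = k *: coef_map v + coef_map w.
Proof.
apply/funext => u.
change (c * dot (k *: v + w) (translate u) =
  k * (c * dot v (translate u)) + c * dot w (translate u)).
by rewrite (dotDl rT rI) (dotZl rT rI) mulrDr mulrCA.
Qed.

Lemma coef_map_act g v : coef_map (A g v) = @act _ _ _ _ rho g (coef_map v).
Proof.
case: g => [[x y] z]; apply/funext => u; rewrite heis_rep_actE /coef_map.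
rewrite -(act_dot rT rU (x, y, z) v) act_translate (dotZr rT rI).
rewrite mulrCA; congr (_ * _); rewrite mulrA.
by rewrite (heis_phase_conj xi eta lambda) mul1r.
Qed.

Lemma coef_map_translate (e : E) :
  coef_map (translate (rep e)) = phi R lambda (rep e).
Proof.
apply/funext => u.
have := mod_periodic_rep u (coef_map_periodic (translate (rep e))).
have := mod_periodic_rep u (phi_periodic (R := R) (d := d) a_unit lambdaE (rep
  e)).
move=> <- <-; set e' := residue_of m u; rewrite /coef_map (phi_rep a_unit
  lambdaE).
case: eqVneq => [->|ee']; first by rewrite translate_dot mulr1.
rewrite translate_ortho ?mulr0 // => /residue_of_eq; rewrite !residue_repK.
by apply/eqP.
Qed.

Lemma coef_map_surj : [set coef_map v | v in [set: V]] = carrier rho.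
Proof.
apply: (model_uirrep_subspace a_unit lambdaE).
- move=> _ [v _ <-]; apply/(Hspace_periodic a_unit lambdaE).
  exact: coef_map_periodic.
- split=> [|k _ _ [v _ <-] [w _ <-]].
    by exists 0 => //; apply/funext => u; rewrite /coef_map (dot0l rT rI) mulr0.
  by exists (k *: v + w) => //; rewrite coef_map_linear.
- by move=> g _ [v _ <-]; exists (A g v) => //; rewrite coef_map_act.
exists (coef_map (translate 0)); first by exists (translate 0).
apply/eqP => /(congr1 (fun f : fctT => f 0)); rewrite /coef_map translate_dot
  mulr1.
by apply/eqP.
Qed.

(** The kernel is a closed invariant subspace, and [translate 0] lies outside it. *)
Lemma coef_map_eq0 v : coef_map v = 0 -> v = 0.
Proof.
move=> Tv; apply/eqP; apply: contraT => vN0.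
have : forall w, [set w | coef_map w = 0] w.
  apply: (irreducible_sub rT rU); last by exists v.
  - split=> [|k u w /= uE wE].
      by apply/funext => u; rewrite /coef_map (dot0l rT rI) mulr0.
    by rewrite coef_map_linear uE wE scaler0 addr0.
  - move=> s l sE _ sl; apply/funext => u; rewrite /coef_map.
    suff -> : dot l (translate u) = 0 by rewrite mulr0.
    have sE0 n : dot (s n) (translate u) = 0.
      have /(congr1 (fun f : fctT => f u)) /eqP := sE n.
      by rewrite mulf_eq0 (negPf c_neq0) => /eqP.
    (* Closedness of the kernel is continuity of the inner product, by Cauchy-Schwarz against a unit
       vector. *)
    have bnd e : 0 < e -> complex.Re (dot l (translate u)) ^+ 2 +
        complex.Im (dot l (translate u)) ^+ 2 <= e ^+ 2.
      move=> e0; have /cvgr0Pnorm_lt/(_ _ e0)[N _ NP] := sl.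
      have {NP} := NP N (leqnn N); rewrite /= ger0_norm ?hnorm_ge0 // => h.
      have -> : dot l (translate u) = dot (l - s N) (translate u).
        by rewrite (dotDl rT rI) (dotNl rT rI) sE0 subr0.
      apply: le_trans (Cauchy_Schwarz rT rI _ _) _.
      rewrite (_ : hnorm (translate u) = 1); last first.
        by rewrite /hnorm translate_dot sqrtr1.
      rewrite mulr1 (hnormBC rT rI) lerXn2r ?nnegrE ?hnorm_ge0 ?ltW //.
    have : complex.Re (dot l (translate u)) ^+ 2 +
        complex.Im (dot l (translate u)) ^+ 2 <= 0.
      apply/ler_addgt0Pl => e e0; rewrite addr0.
      have se : 0 < Num.sqrt e by rewrite sqrtr_gt0.
      by have := bnd _ se; rewrite sqr_sqrtr // ltW.
    move=> le0; have : complex.Re (dot l (translate u)) ^+ 2 +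
        complex.Im (dot l (translate u)) ^+ 2 == 0.
      by rewrite eq_le le0 addr_ge0 // sqr_ge0.
    rewrite paddr_eq0 ?sqr_ge0 // !sqrf_eq0 => /andP[/eqP re /eqP im].
    by apply/eqP; rewrite eq_complex re im /= !eqxx.
  - move=> [[x y] z] w /= wE; rewrite coef_map_act wE; apply/funext => u.
    by rewrite heis_rep_actE mulr0.
move=> /(_ (translate 0)) /(congr1 (fun f : fctT => f 0)).
by rewrite /coef_map translate_dot mulr1 => /eqP; rewrite (negPf c_neq0).
Qed.

(** Both sides have the same image under the injective [coef_map]; finite dimension appears here. *)
Lemma translate_expand v : v = \sum_(e : E) dot v (translate (rep e)) *:
  translate (rep e).
Proof.
apply/eqP; rewrite -subr_eq0; apply/eqP/coef_map_eq0.
have TB s w : coef_map (s - w) = coef_map s - coef_map w.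
  have := coef_map_linear (-1) w s; rewrite !scaleN1r [- w + s]addrC => ->.
  by rewrite addrC.
have T0 : coef_map 0 = 0.
  by apply/funext => u; rewrite /coef_map (dot0l rT rI) mulr0.
have Tsum (F : E -> R[i]) : coef_map (\sum_e F e *: translate (rep e)) =
    \sum_e F e *: phi R lambda (rep e).
  apply: (big_ind2 (fun s f => coef_map s = f)) => [//|u1 f1 u2 f2 <- <-|e _].
    by have := coef_map_linear 1 u1 u2; rewrite !scale1r.
  have := coef_map_linear (F e) (translate (rep e)) 0.
  by rewrite T0 !addr0 coef_map_translate.
rewrite TB Tsum (phi_expand a_unit lambdaE (coef_map_periodic v)).
apply/eqP; rewrite subr_eq0; apply/eqP; apply: eq_bigr => e _; congr (_ *: _).
by rewrite /coef_map mulrAC divff // mul1r.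
Qed.

Lemma coef_map_isometry v w : @dot _ _ _ _ rho (coef_map v) (coef_map w) = dot
  v w.
Proof.
rewrite (L2_dotE mu_haar xi eta lambda (coef_map_periodic v) (coef_map_periodic
  w)).
rewrite {2}[v]translate_expand (dot_suml rT rI) mulr_suml.
apply: eq_bigr => e _; rewrite (dotZl rT rI) (dotC rT rI w) /coef_map rmorphM
  /=.
rewrite (_ : c^* = c); last by rewrite [LHS]conjc_real.
rewrite -(phi_scale_sqrC (d := d) a_unit lambdaE).
by field; rewrite c_neq0.
Qed.

Lemma full_rep_model_equiv : unitarily_equiv r rho.
Proof.
exists coef_map; split=> [k u v _ _||u v _ _|g v _].
- exact: coef_map_linear.
- rewrite -coef_map_surj; apply/seteqP; split=> _ [v _ <-]; exists v => //.
- exact: coef_map_isometry.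
- exact: coef_map_act.
Qed.

End Intertwiner.

(** * Unitary equivalence is an equivalence relation *)

Section UnitaryEquivalence.
Context {R : realType} {p : nat} {pp : prime p} {d : nat}.
Implicit Types r : prerep R pp d.

Lemma unitarily_equiv_refl r : unitarily_equiv r r.
Proof. by exists id; split=> //; rewrite image_id. Qed.

Lemma unitarily_equiv_trans r1 r2 r3 :
  unitarily_equiv r1 r2 -> unitarily_equiv r2 r3 -> unitarily_equiv r1 r3.
Proof.
move=> [S [Sl Ss Sd Sa]] [T [Tl Ts Td Ta]].
have SC v : carrier r1 v -> carrier r2 (S v) by move=> rv; rewrite -Ss;
  exists v.
exists (T \o S); split=> [c u v ru rv||u v ru rv|g v rv] /=.
- by rewrite Sl // Tl //; exact: SC.
- by rewrite -Ts -Ss image_comp.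
- by rewrite Td ?Sd //; exact: SC.
- by rewrite Sa // Ta //; exact: SC.
Qed.

Lemma unitarily_equiv_sym r1 r2 : is_unitary_rep r1 ->
  unitarily_equiv r1 r2 -> unitarily_equiv r2 r1.
Proof.
move=> [[W1 [i1 i2 i3] _] [a1 _ _ _ _] _] [S [Sl Ss Sd Sa]].
have /choice[T TP] : forall w, exists v, carrier r2 w -> carrier r1 v /\ S v =
  w.
  move=> w; have [|] := pselect (carrier r2 w); last by exists 0.
  by rewrite -Ss => -[v rv <-]; exists v.
have SC v : carrier r1 v -> carrier r2 (S v) by move=> rv; rewrite -Ss;
  exists v.
(* Preservation of a positive definite product forces injectivity, so the chosen preimages form a
   linear inverse. *)
have Sinj u v : carrier r1 u -> carrier r1 v -> S u = S v -> u = v.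
  move=> ru rv uv; apply/eqP; rewrite -subr_eq0; apply: contraT => uv0.
  have ruv : carrier r1 (u - v) by apply: (subspaceB W1).
  have Suv : S (u - v) = 0.
    have -> : u - v = -1 *: v + u by rewrite scaleN1r addrC.
    by rewrite Sl // uv scaleN1r addNr.
  have S0 : S 0 = 0.
    have := Sl (-1) 0 0 W1.1 W1.1; rewrite scaler0 addr0 => ->.
    by rewrite scaleN1r addNr.
  have d0 : dot (0 : ambient r1) 0 = 0.
    have := i1 1 0 0 0 W1.1 W1.1 W1.1; rewrite scaler0 addr0 mul1r => d0E.
    by apply: (addIr (dot (0 : ambient r1) 0)); rewrite add0r -d0E.
  have := i3 _ ruv uv0.
  by rewrite -Sd // Suv -S0 (Sd _ _ W1.1 W1.1) d0 ltxx.
have Tr w : carrier r2 w -> carrier r1 (T w) by move=> /TP[].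
have ST w : carrier r2 w -> S (T w) = w by move=> /TP[].
exists T; split=> [c u v ru rv||u v ru rv|g v rv].
- have cuv : carrier r1 (c *: T u + T v) by apply: W1.2; exact: Tr.
  have E : S (c *: T u + T v) = c *: u + v by rewrite (Sl _ _ _ (Tr _ ru) (Tr _
    rv)) !ST.
  have ruv : carrier r2 (c *: u + v) by rewrite -E; exact: SC.
  by apply: Sinj => //; [exact: Tr|rewrite ST].
- apply/seteqP; split=> [_ [w rw <-]|v rv]; first exact: Tr.
  have rSv := SC _ rv; exists (S v) => //.
  by apply: Sinj => //; [exact: Tr|rewrite ST].
- by rewrite -(Sd _ _ (Tr _ ru) (Tr _ rv)) !ST.
have agv : carrier r1 (act g (T v)) by apply: a1; exact: Tr.
have E : S (act g (T v)) = act g v by rewrite (Sa _ _ (Tr _ rv)) ST.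
have rgv : carrier r2 (act g v) by rewrite -E; exact: SC.
by apply: Sinj => //; [exact: Tr|rewrite ST].
Qed.

End UnitaryEquivalence.

(** * Parametrization of the unitary dual *)

Section UnitaryDual.
Context {R : realType} {p : nat} {pp : prime p} {d : nat}.
Variables (mu : probability (borel_Zpd pp d) R).
Hypothesis mu_haar : translation_invariant mu.
Local Notation Zp := (padic_int pp).
Local Notation Qp := (padic pp).
Local Notation Zpd := 'rV[Zp]_d.
Local Notation Qpd := 'rV[Qp]_d.
Local Notation fctT := (Zpd -> R[i]^o).
Implicit Types (t : Qpd * Qpd * Qp).

Lemma uirrep_equiv_model (r : prerep R pp d) : is_uirrep r ->
  exists2 t, dual_index pp d t & unitarily_equiv r (heis_rep mu t).
Proof.
move=> rU; have rW : linear_subspace (carrier r) by case: (rU) => -[[]].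
have FU := full_rep_uirrep rW rU.
have FT v : carrier (full_rep rW) v by [].
have [lambda [lq lE]] := central_character FT FU.
have [m [a [aU lambdaE lv _]]] := quot_reps0_form (R := R) lq.
have [xi [xiq xiE]] := x_character FT FU lambdaE lE.
have [eta [v [etaq vn vE]]] := y_eigenvector FT FU aU lambdaE lE.
exists (xi, eta, lambda).
  split=> // j; rewrite ?lv ?abszN ?absz_nat.
  - exact: quot_reps_sub (xiq j).
  - exact: quot_reps_sub (etaq j).
  - by split; [exact: xiq|exact: etaq].
apply: unitarily_equiv_trans.
  apply: (unitarily_equiv_sym FU.1); exact: full_rep_unitarily_equiv rU.
exact: (full_rep_model_equiv mu_haar FT FU aU lambdaE lE xiE vn vE).
Qed.

Lemma model_scalar (xi eta : Qpd) (lambda : Qp) m (a : Zp) (x y : Zpd) (z : Zp)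
    (f : fctT) : lambda = a%:F / p%:R ^+ m -> mod_periodic m f ->
  Zpd_ideal m%:Z x -> Zpd_ideal m%:Z y ->
  @act _ _ _ _ (heis_rep mu (xi, eta, lambda)) (x, y, z) f =
  padic_exp R (dotv xi (to_Qpd x) + dotv eta (to_Qpd y) + lambda * z%:F) *: f.
Proof.
move=> lambdaE fP xI yI; apply/funext => u; rewrite heis_rep_actE (fP u) //.
rewrite /heis_phase tofracD mulrDr addrA padic_expD lambdaE.
by rewrite padic_exp_ideal ?mulr1 // dotv_comm dotv_ideal.
Qed.

(** The scalar by which an element acts is an invariant of the class; this is how the parameters are
    recovered. *)
Lemma equiv_scalar_eq (r r' : prerep R pp d) g (k k' : R[i]) :
  is_uirrep r -> is_uirrep r' -> unitarily_equiv r r' ->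
  (forall v, carrier r v -> act g v = k *: v) ->
  (forall v, carrier r' v -> act g v = k' *: v) -> k = k'.
Proof.
move=> rU rU' [T [Tl Ts Td Ta]] rk rk'.
have [[[W [_ _ rp] _] _ _] [[v rv v0] _]] := rU.
have [[[W' [rl' _ _] _] _ _] _] := rU'.
have rTv : carrier r' (T v) by rewrite -Ts; exists v.
have := Ta g v rv; rewrite rk // rk' // -[k *: v]addr0 (Tl _ _ _ rv W.1).
have -> : T 0 = 0.
  have := Tl (-1) 0 0 W.1 W.1; rewrite scaler0 addr0 => ->.
  by rewrite scaleN1r addNr.
rewrite addr0 => /eqP; rewrite -subr_eq0 -scalerBl scaler_eq0 subr_eq0.
case/orP => [/eqP //|/eqP Tv0].
have := rp _ rv v0; rewrite -(Td _ _ rv rv) Tv0.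
have := rl' 1 0 0 0 W'.1 W'.1 W'.1; rewrite scaler0 addr0 mul1r => d0.
have -> : dot (0 : ambient r') 0 = 0.
  by apply: (addIr (dot (0 : ambient r') 0)); rewrite add0r -d0.
by rewrite ltxx.
Qed.

Lemma dual_index_uirrep t : dual_index pp d t -> is_uirrep (heis_rep mu t).
Proof.
case: t => [[xi eta] lambda] [_ _ /(quot_reps0_form (R := R))[m [a [aU lE _
  _]]] _].
exact: model_uirrep mu_haar xi eta _ _ _ aU lE.
Qed.

Lemma dual_index_inj t t' : dual_index pp d t -> dual_index pp d t' ->
  unitarily_equiv (heis_rep mu t) (heis_rep mu t') -> t = t'.
Proof.
move=> tD tD' tt'; have tU := dual_index_uirrep tD;
  have tU' := dual_index_uirrep tD'.
move: t t' tD tD' tt' tU tU' => [[xi eta] lambda] [[xi' eta'] lambda'].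
move=> [_ _ lq xieta] [_ _ lq' xieta'] tt' tU tU'.
have [m [a [aU lE lv _]]] := quot_reps0_form (R := R) lq.
have [m' [a' [aU' lE' lv' _]]] := quot_reps0_form (R := R) lq'.
(* Both levels are imposed because m = m' is only known once the centre has given lambda =
   lambda'. *)
have phases x y z : Zpd_ideal m%:Z x -> Zpd_ideal m%:Z y ->
    Zpd_ideal m'%:Z x -> Zpd_ideal m'%:Z y ->
    padic_exp R (dotv xi (to_Qpd x) + dotv eta (to_Qpd y) + lambda * z%:F) =
    padic_exp R (dotv xi' (to_Qpd x) + dotv eta' (to_Qpd y) + lambda' * z%:F).
  move=> xI yI xI' yI'; apply: (equiv_scalar_eq (g := (x, y, z)) tU tU' tt').
    move=> f /(Hspace_periodic aU lE) fP.
    exact: (model_scalar _ _ _ lE fP xI yI).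
  move=> f /(Hspace_periodic aU' lE') fP.
  exact: (model_scalar _ _ _ lE' fP xI' yI').
have exp_eq (u v : Qp) : padic_exp R u = padic_exp R v ->
    exists b : Zp, u = v + b%:F.
  move=> uv; have /padic_exp_eq1[b bE] : padic_exp R (u - v) = 1.
    by rewrite padic_expD uv -padic_expD subrr padic_exp0.
  by exists b; rewrite -bE addrC subrK.
have ll' : lambda = lambda'.
  have I0 n : Zpd_ideal n%:Z (0 : Zpd) by exact: Zpd_ideal0.
  have [b] := exp_eq _ _ (phases 0 0 1 (I0 _) (I0 _) (I0 _) (I0 _)).
  rewrite to_Qpd0 !dotv0r !add0r tofrac1 !mulr1 => llb.
  by apply: (quot_reps_inj (a := b) lq lq'); rewrite expr0 invr1 mul1r.
have mm' : m' = m by have := lv; rewrite ll' lv'; lia.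
subst m'; rewrite lv abszN absz_nat in xieta; rewrite lv' abszN absz_nat in
  xieta'.
have deltaE (kappa : Qpd) j :
    dotv kappa (to_Qpd (p%:R ^+ m *: (delta_mx 0 j : Zpd))) = p%:R ^+ m * kappa
      0 j.
  by rewrite to_QpdZ tofrac_expp dotv_scaler to_Qpd_delta dotv_delta.
(* Testing on p^m times a basis vector determines a coordinate modulo p^(-m) Z_p, just enough for
   the chosen representatives. *)
have coord_eq (u v : Qp) : quot_reps pp m u -> quot_reps pp m v ->
    padic_exp R (p%:R ^+ m * u) = padic_exp R (p%:R ^+ m * v) -> u = v.
  move=> uq vq /exp_eq[b uvb]; apply: (quot_reps_inj (a := b) uq vq).
  rewrite -[u](mulKf (qp_expp_neq0 m)) uvb mulrDr mulKf ?qp_expp_neq0 //.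
have I0 : Zpd_ideal m%:Z (0 : Zpd) by exact: Zpd_ideal0.
congr (_, _, _) => //; apply/rowP => j; have [xq eq] := xieta j;
  have [xq' eq'] := xieta' j.
  apply: coord_eq => //; have := phases (p%:R ^+ m *: delta_mx 0 j) 0 0.
  rewrite to_Qpd0 !dotv0r tofrac0 !mulr0 !addr0 !deltaE.
  by apply=> //; exact: Zpd_ideal_scale.
apply: coord_eq => //; have := phases 0 (p%:R ^+ m *: delta_mx 0 j) 0.
rewrite to_Qpd0 !dotv0r tofrac0 !mulr0 !addr0 !add0r !deltaE.
by apply=> //; exact: Zpd_ideal_scale.
Qed.

Lemma dual_index_bij :
  bij_onto_dual (dual_index pp d) (fun t => rep_class (heis_rep mu t)).
Proof.
split=> [t tD|t t' tD tD' tt'|_ [r rU ->]].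
- by exists (heis_rep mu t) => //; exact: dual_index_uirrep.
(* A model lies in its own class, so equal classes yield an equivalence between the models. *)
- have : rep_class (heis_rep mu t') (heis_rep mu t).
    rewrite -tt'; split; first exact: dual_index_uirrep.
    exact: unitarily_equiv_refl.
  by move=> [_ /(dual_index_inj tD' tD)].
have [t tD rt] := uirrep_equiv_model rU; exists t => //.
apply/funext => r'; apply/propext; split=> -[r'U er']; split=> //.
  exact: unitarily_equiv_trans rt er'.
apply: unitarily_equiv_trans er'; exact: unitarily_equiv_sym rU.1 rt.
Qed.

End UnitaryDual.

Unset Implicit Arguments.

Theorem theorem1p5 (R : realType) (p : nat) (pp : prime p) (p_gt2 : (2 < p)%N)
    (d : nat) (d_gt0 : (0 < d)%N)
    (mu : probability (borel_Zpd pp d) R) (mu_haar : translation_invariant mu) :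
  bij_onto_dual (dual_index pp d) (fun t => rep_class (heis_rep mu t)) /\
  forall (xi eta : 'rV[padic pp]_d) (lambda : padic pp),
    dual_index pp d (xi, eta, lambda) ->
    [/\ is_uirrep (heis_rep mu (xi, eta, lambda)),
        Hspace R d lambda `<=` L2 mu /\
        (exists2 n, has_dim (Hspace R d lambda) n
                  & n%:R = padic_norm R lambda ^+ d),
        exists n (h : 'I_n -> 'rV[padic_int pp]_d),
          coset_system (- padic_val lambda) h /\
          lin_basis (Hspace R d lambda) (fun i => phi R lambda (h i)),
        forall (h h' x y : 'rV[padic_int pp]_d) (z : padic_int pp),
          @matrix_coef _ _ _ _ (heis_rep mu (xi, eta, lambda))
            (phi R lambda h) (phi R lambda h') (x, y, z) =
          padic_exp R (dotv xi (to_Qpd x) + dotv eta (to_Qpd y)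
                       + lambda * (z + dotv h' y)%:F) *
          \1_(Zpd_coset (h - h') (- padic_val lambda)) x
      & is_character (heis_rep mu (xi, eta, lambda)) (fun g =>
          let: (x, y, z) := g in
          ((padic_norm R lambda) ^+ d)%:C%C *
          padic_exp R (dotv xi (to_Qpd x) + dotv eta (to_Qpd y)
                       + lambda * z%:F) *
          \1_(Zpd_ideal (- padic_val lambda)) x *
          \1_(Zpd_ideal (- padic_val lambda)) y)].
Proof.
split=> [|xi eta lambda tD]; first exact: dual_index_bij.
have [_ _ /(quot_reps0_form (R := R))[m [a [aU lE lv _]]] _] := tD.
have vE : - padic_val lambda = m%:Z by rewrite lv opprK.
rewrite !vE; split.
- exact: dual_index_uirrep.
- split; first exact: Hspace_L2 mu_haar _ _ _ aU lE.
  exists #|{: residue p d m}|; first exact: Hspace_dim aU lE.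
  exact: card_residue_norm aU lE.
- exists #|{: residue p d m}|, (@coset_rep p pp d m); split.
    exact: coset_rep_system.
  exact: phi_basis aU lE.
- by move=> h h' x y z; exact: (heis_matrix_coef mu_haar xi eta aU lE).
move=> [[x y] z]; rewrite -(card_residue_norm (R := R) aU lE) rmorph_nat.
exact: heis_character mu xi eta _ _ _ aU lE x y z.
Qed.
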